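(* Suppose $\mathrm{char}(F)>0$. Then there are a regular system of parameters $u_0=\varpi,u_1,\dots,u_{n-1}$ of $R_0$, a formal $\mathfrak o$-module $\tilde X$ over $\mathfrak R_0=\hat{\mathfrak o}^{nr}[u_1,\dots,u_{n-1}]\subset R_0$, and an isomorphism of formal $\mathfrak o$-modules over $\mathbb F$ $$\tilde\iota:\mathbb X\to\tilde X\times_{\mathfrak R_0}\mathbb F$$ such that (i) $(\tilde X\times_{\mathfrak R_0}R_0,\tilde\iota)$ is a universal deformation of $\mathbb X$ over $R_0$; (ii) there is a coordinate $T$ on $\tilde X$ such that multiplication by $\varpi$ on $\tilde X$ is given by the polynomial $$\varpi T+u_1T^q+\dots+u_{n-1}T^{q^{n-1}}+T^{q^n}.$$
   Context: $F$ is a non-Archimedean local field with ring of integers $\mathfrak o$, uniformizer $\varpi$, and residue field $\mathbb F_q$; $\mathbb F$ is an algebraic closure of $\mathbb F_q$; $\hat{\mathfrak o}^{nr}$ is the ring of integers of the completion of the maximal unramified extension of $F$. A formal $\mathfrak o$-module over an $\mathfrak o$-algebra $R$ is here a one-dimensional smooth formal group over $R$ with an $\mathfrak o$-action inducing on the tangent space the action through $\mathfrak o\to R$. $\mathbb X$ is a fixed formal $\mathfrak o$-module over $\mathbb F$ of $F$-height $n$, i.e. the kernel of multiplication by $\varpi$ is a finite group scheme of rank $q^n$ (such $\mathbb X$ is unique up to isomorphism). Let $\mathcal C$ be the category of complete local noetherian $\hat{\mathfrak o}^{nr}$-algebras with residue field $\mathbb F$. A deformation of $\mathbb X$ over $R\in\mathcal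 C$ is a pair $(X,\iota)$ with $X$ a formal $\mathfrak o$-module over $R$ and $\iota:\mathbb X\to X_{\mathbb F}$ an isomorphism onto the reduction of $X$ modulo the maximal ideal of $R$. $R_0$ is the ring representing the functor of isomorphism classes of deformations of $\mathbb X$ on $\mathcal C$; it is non-canonically isomorphic to $\hat{\mathfrak o}^{nr}[[u_1,\dots,u_{n-1}]]$. The base change $\times_{\mathfrak R_0}\mathbb F$ is along $\mathfrak R_0\subset R_0\to\mathbb F$. *)

(* Defs.v *)
From HB Require Import structures.
From mathcomp Require Import all_boot all_order all_algebra.
From mathcomp Require Import mpoly.

Set Implicit Arguments.
Unset Strict Implicit.
Unset Printing Implicit Defensive.

Import Order.TTheory GRing.Theory Num.Theory.
Local Open Scope ring_scope.

(* Normalised discrete valuations; [dv 0] is a junk value (morally +oo). *)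
Record dvaluation (K : fieldType) := DValuation {
  dv :> K -> int;
  dvM : forall x y, x != 0 -> y != 0 -> dv (x * y) = dv x + dv y;
  dvD : forall x y, x != 0 -> y != 0 -> x + y != 0 ->
          Num.min (dv x) (dv y) <= dv (x + y);
  dv_normalised : exists2 x, x != 0 & dv x = 1 }.

Definition dvint (K : fieldType) (v : dvaluation K) : {pred K} :=
  fun x => (x == 0) || (0 <= v x).

Lemma dv1 (K : fieldType) (v : dvaluation K) : v 1 = 0.
Proof.
by have := dvM v (oner_neq0 K) (oner_neq0 K); rewrite mulr1 -{1}[v 1]addr0 => /addrI.
Qed.

Lemma dvN (K : fieldType) (v : dvaluation K) x : x != 0 -> v (- x) = v x.
Proof.
move=> x0; have m0 : (-1 : K) != 0 by rewrite oppr_eq0 oner_neq0.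
have : v (-1) *+ 2 = 0 by rewrite mulr2n -dvM // mulrNN mulr1 dv1.
move/eqP; rewrite mulrn_eq0 /= => /eqP vm.
by rewrite -mulN1r dvM // vm add0r.
Qed.

Fact dvint_subring (K : fieldType) (v : dvaluation K) :
  GRing.subring_closed (dvint v).
Proof.
split; rewrite ?/in_mem /=.
- by rewrite /dvint dv1 lexx orbT.
- move=> x y; rewrite /in_mem /= /dvint.
  have [->|x0] := eqVneq x 0; have [->|y0] := eqVneq y 0; rewrite ?subr0 ?sub0r //=.
  + by rewrite eqxx.
  + by move=> _ vy; rewrite dvN // vy orbT.
  + by move=> vx _; rewrite vx orbT.
  move=> vx vy; have [//|xy0] := eqVneq (x - y) 0 => /=.
  have yN0 : - y != 0 by rewrite oppr_eq0.
  by apply: le_trans (dvD v x0 yN0 xy0); rewrite le_min vx dvN.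
- move=> x y; rewrite /in_mem /= /dvint.
  have [->|x0] := eqVneq x 0; first by rewrite mul0r eqxx.
  have [->|y0] := eqVneq y 0; first by rewrite mulr0 eqxx.
  by move=> /= vx vy; rewrite dvM // addr_ge0 ?orbT.
Qed.

HB.instance Definition _ (K : fieldType) (v : dvaluation K) :=
  GRing.isSubringClosed.Build K (dvint v) (dvint_subring v).

Record ring_of_integers (K : fieldType) (v : dvaluation K) :=
  RingOfIntegers { int_val :> K; int_valP : int_val \in dvint v }.

HB.instance Definition _ (K : fieldType) (v : dvaluation K) :=
  [isSub for @int_val K v].
HB.instance Definition _ (K : fieldType) (v : dvaluation K) :=
  [Choice of ring_of_integers v by <:].
HB.instance Definition _ (K : fieldType) (v : dvaluation K) :=
  [SubChoice_isSubComNzRing of ring_of_integers v by <:].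

Definition uniformizer (K : fieldType) (v : dvaluation K)
    (pi : ring_of_integers v) :=
  int_val pi != 0 /\ v (int_val pi) = 1.

(* [r] exhibits [k] as the quotient of the ring of integers by its maximal
   ideal. *)
Definition residue_map (K : fieldType) (v : dvaluation K) (k : nzRingType)
    (r : ring_of_integers v -> k) :=
  (forall y, exists x, r x = y) /\
  (forall x, r x = 0 <-> int_val x = 0 \/ 0 < v (int_val x)).

Definition vclose (K : fieldType) (v : dvaluation K) (N : int) (x y : K) :=
  x = y \/ N <= v (x - y).

Definition vcomplete (K : fieldType) (v : dvaluation K) :=
  forall x : nat -> K,
    (forall N, exists M : nat, forall i j : nat,
        (M <= i)%N -> (M <= j)%N -> vclose v N (x i) (x j)) ->
    exists l, forall N, exists M : nat, forall i : nat,
        (M <= i)%N -> vclose v N (x i) l.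

(* Algebraic with ramification index 1.  Separability of the residue extension
   is not imposed: it is automatic, the base being used with a finite (hence
   perfect) residue field. *)
Definition unramified (K E : fieldType) (v : dvaluation K) (w : dvaluation E)
    (j : K -> E) :=
  (forall y, algebraicOver j y) /\ (forall x, x != 0 -> w (j x) = v x).

Definition maximal_unramified (K E : fieldType) (v : dvaluation K)
    (w : dvaluation E) (j : K -> E) :=
  unramified v w j /\
  forall (E' : fieldType) (w' : dvaluation E') (h : {rmorphism E -> E'}),
    unramified v w' (h \o j) -> forall y, exists x, h x = y.

Definition vcompletion (K L : fieldType) (v : dvaluation K) (w : dvaluation L)
    (i : K -> L) :=
  [/\ forall x, x != 0 -> w (i x) = v x,
      vcomplete w
    & forall y N, exists x, vclose w N (i x) y].

Definition prime_ideal (R : comNzRingType) (P : {pred R}) :=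
  idealr_closed P /\ prime_idealr_closed P.

Definition prime_chain (R : comNzRingType) (l : nat) :=
  exists P : nat -> {pred R},
    (forall i : nat, (i <= l)%N -> prime_ideal (P i)) /\
    (forall i : nat, (i < l)%N ->
       {subset P i <= P i.+1} /\ ~ {subset P i.+1 <= P i}).

Definition krull_dim (R : comNzRingType) (d : nat) :=
  prime_chain R d /\ ~ prime_chain R d.+1.

Definition generates (R : comNzRingType) (N : nat) (g : N.-tuple R)
    (I : {pred R}) :=
  forall x, x \in I <-> exists c : 'I_N -> R, x = \sum_(i < N) c i * tnth g i.

(* [idealr_closed] only covers proper ideals; the unit ideal is generated by 1. *)
Definition noetherian (R : comNzRingType) :=
  forall I : {pred R}, idealr_closed I ->
    exists (N : nat) (g : N.-tuple R), generates g I.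

Definition ideal_pow (R : comNzRingType) (I : {pred R}) (k : nat) (x : R) :=
  exists (N : nat) (a : 'I_N -> R) (b : 'I_N -> 'I_k -> R),
    (forall i j, b i j \in I) /\ x = \sum_(i < N) a i * \prod_(j < k) b i j.

Definition adic_complete (R : comNzRingType) (I : {pred R}) :=
  (forall x, (forall k, ideal_pow I k x) -> x = 0) /\
  (forall x : nat -> R, (forall k, ideal_pow I k (x k.+1 - x k)) ->
     exists l, forall k, ideal_pow I k (l - x k)).

Record cln_alg (O : comNzRingType) (k : fieldType) (red : O -> k) := ClnAlg {
  cln_ring :> comNzRingType;
  cln_str : {rmorphism O -> cln_ring};
  cln_res : {rmorphism cln_ring -> k};
  cln_res_str : forall a, cln_res (cln_str a) = red a;
  cln_res_surj : forall y, exists x, cln_res x = y;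
  (* ker cln_res consists of all non-units, i.e. it is the only maximal ideal *)
  cln_local : forall x, cln_res x != 0 -> exists y, x * y = 1;
  cln_noetherian : noetherian cln_ring;
  cln_complete : adic_complete [pred x | cln_res x == 0] }.

Definition cln_max (O : comNzRingType) (k : fieldType) (red : O -> k)
    (R : cln_alg red) : {pred R} := [pred x | cln_res R x == 0].
Arguments cln_max {O k red} R _.

Record cln_hom (O : comNzRingType) (k : fieldType) (red : O -> k)
    (R S : cln_alg red) := ClnHom {
  cln_fun :> {rmorphism R -> S};
  cln_hom_str : forall a, cln_fun (cln_str R a) = cln_str S a;
  cln_hom_res : forall x, cln_res S (cln_fun x) = cln_res R x }.

Definition regular_system_of_parameters (O : comNzRingType) (k : fieldType)
    (red : O -> k) (R : cln_alg red) (n : nat) (u : n.-tuple R) :=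
  krull_dim R n /\ generates u (cln_max R).

(* A series in k variables is the family of its coefficients; equality of
   series is pointwise equality [=1]. *)
Definition pseries (k : nat) (R : Type) := 'X_{1..k} -> R.

Definition pvar (k : nat) (R : nzRingType) (i : 'I_k) : pseries k R :=
  fun m => (m == U_(i)%MM)%:R.

Definition pzero (k : nat) (R : nzRingType) : pseries k R := fun _ => 0.
Arguments pzero : clear implicits.

Definition series_of_mpoly (k : nat) (R : nzRingType) (p : {mpoly R[k]}) :
  pseries k R := fun m => p@_m.

Definition ptrunc (k : nat) (R : nzRingType) (f : pseries k R) (d : nat) :
    {mpoly R[k]} :=
  \sum_(m : 'X_{1..k < d}) f m *: 'X_[m].

Definition pmul (k : nat) (R : nzRingType) (f g : pseries k R) : pseries k R :=
  fun m => (ptrunc f (mdeg m).+1 * ptrunc g (mdeg m).+1)@_m.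

(* Substitution f(g_1, .., g_k).  It is only meaningful, and only used, when
   the g_i have no constant term; the coefficient at m then only depends on the
   terms of total degree at most mdeg m of f and of the g_i. *)
Definition psubst (k l : nat) (R : nzRingType) (f : pseries k R)
    (g : k.-tuple (pseries l R)) : pseries l R :=
  fun m => (ptrunc f (mdeg m).+1 \mPo
              [tuple ptrunc (tnth g i) (mdeg m).+1 | i < k])@_m.

Definition pmap (k : nat) (R S : Type) (phi : R -> S) (f : pseries k R) :
  pseries k S := fun m => phi (f m).

Definition pT (R : nzRingType) : pseries 1 R := pvar R 0.

(* One-dimensional formal groups are presented by a formal group law, i.e. with
   a chosen coordinate; other coordinates are invertible series without
   constant term, see [coordinate]. *)
Record formal_module (A R : Type) := FormalModule {
  fm_add : pseries 2 R;
  fm_act : A -> pseries 1 R }.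

Definition is_formal_group_law (R : comNzRingType) (F : pseries 2 R) :=
  let x := pvar R (0 : 'I_3) in
  let y := pvar R (1 : 'I_3) in
  let z := pvar R (2 : 'I_3) in
  [/\ F 0%MM = 0,
      psubst F [tuple pT R; pzero 1 R] =1 pT R /\
      psubst F [tuple pzero 1 R; pT R] =1 pT R,
      psubst F [tuple psubst F [tuple x; y]; z] =1
      psubst F [tuple x; psubst F [tuple y; z]]
    & psubst F [tuple pvar R (1 : 'I_2); pvar R (0 : 'I_2)] =1 F].

Definition is_group_hom (R : comNzRingType) (F G : pseries 2 R)
    (f : pseries 1 R) :=
  f 0%MM = 0 /\
  psubst f [tuple F] =1
  psubst G [tuple psubst f [tuple pvar R (0 : 'I_2)];
                  psubst f [tuple pvar R (1 : 'I_2)]].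

(* [s] is the structure map of the A-algebra R; the last clause says that the
   action induced on the tangent space is the one through [s]. *)
Definition is_formal_module (A R : comNzRingType) (s : A -> R)
    (X : formal_module A R) :=
  is_formal_group_law (fm_add X) /\
  [/\ forall a, is_group_hom (fm_add X) (fm_add X) (fm_act X a),
      forall a b, fm_act X (a + b) =1
                  psubst (fm_add X) [tuple fm_act X a; fm_act X b],
      forall a b, fm_act X (a * b) =1 psubst (fm_act X a) [tuple fm_act X b],
      fm_act X 1 =1 pT R
    & forall a, fm_act X a U_(0%R)%MM = s a].

Definition fm_map (A R S : Type) (phi : R -> S) (X : formal_module A R) :
    formal_module A S :=
  FormalModule (pmap phi (fm_add X)) (fun a => pmap phi (fm_act X a)).

Definition is_fm_hom (A R : comNzRingType) (X Y : formal_module A R)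
    (f : pseries 1 R) :=
  is_group_hom (fm_add X) (fm_add Y) f /\
  forall a, psubst f [tuple fm_act X a] =1 psubst (fm_act Y a) [tuple f].

Definition is_fm_iso (A R : comNzRingType) (X Y : formal_module A R)
    (f : pseries 1 R) :=
  is_fm_hom X Y f /\
  exists g, [/\ is_fm_hom Y X g,
                psubst f [tuple g] =1 pT R & psubst g [tuple f] =1 pT R].

(* Coordinates, expressed in terms of the coordinate defining the law. *)
Definition coordinate (R : comNzRingType) (t : pseries 1 R) :=
  t 0%MM = 0 /\
  exists t', [/\ t' 0%MM = 0,
                 psubst t [tuple t'] =1 pT R & psubst t' [tuple t] =1 pT R].

(* Pulling the coordinate t back along [a] gives P(t). *)
Definition act_in_coordinate (A R : comNzRingType) (X : formal_module A R)
    (a : A) (t : pseries 1 R) (P : pseries 1 R) :=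
  psubst t [tuple fm_act X a] =1 psubst P [tuple t].

(* k[[T]]/(g), the coordinate ring of the closed subscheme g = 0 of the formal
   line, has dimension N over k: it has a basis of N elements e_i. *)
Definition quotient_rank (k : fieldType) (g : pseries 1 k) (N : nat) :=
  exists e : 'I_N -> pseries 1 k,
    forall f : pseries 1 k, exists! c : {ffun 'I_N -> k},
      exists h : pseries 1 k,
        forall m, f m = \sum_(i < N) c i * e i m + pmul h g m.

(* The kernel of multiplication by pi is a finite group scheme of rank q ^ n. *)
Definition has_height (A : Type) (k : fieldType) (X : formal_module A k)
    (pi : A) (q n : nat) :=
  quotient_rank (fm_act X pi) (q ^ n).

Record deformation (A R K : Type) := Deformation {
  def_fm : formal_module A R;
  def_iota : pseries 1 K }.

Definition is_deformation (A O : comNzRingType) (sA : A -> O) (k : fieldType)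
    (red : O -> k) (X0 : formal_module A k) (R : cln_alg red)
    (D : deformation A R k) :=
  is_formal_module (cln_str R \o sA) (def_fm D) /\
  is_fm_iso X0 (fm_map (cln_res R) (def_fm D)) (def_iota D).

Definition def_equiv (A O : comNzRingType) (k : fieldType) (red : O -> k)
    (R : cln_alg red) (D D' : deformation A R k) :=
  exists f : pseries 1 R,
    is_fm_iso (def_fm D) (def_fm D') f /\
    psubst (pmap (cln_res R) f) [tuple def_iota D] =1 def_iota D'.

Definition def_map (A O : comNzRingType) (k : fieldType) (red : O -> k)
    (R S : cln_alg red) (phi : cln_hom R S) (D : deformation A R k) :
    deformation A S k :=
  Deformation (fm_map phi (def_fm D)) (def_iota D).

Definition universal_deformation (A O : comNzRingType) (sA : A -> O)
    (k : fieldType) (red : O -> k) (X0 : formal_module A k) (R0 : cln_alg red)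
    (D : deformation A R0 k) :=
  is_deformation sA X0 D /\
  forall (R : cln_alg red) (E : deformation A R k), is_deformation sA X0 E ->
    exists phi : cln_hom R0 R,
      def_equiv (def_map phi D) E /\
      forall psi : cln_hom R0 R, def_equiv (def_map psi D) E -> psi =1 phi.

Definition represents_deformations (A O : comNzRingType) (sA : A -> O)
    (k : fieldType) (red : O -> k) (X0 : formal_module A k)
    (R0 : cln_alg red) :=
  exists D : deformation A R0 k, universal_deformation sA X0 D.

(* Main.v *)
Require Import Defs.
From HB Require Import structures.
From mathcomp Require Import all_boot all_order all_algebra.
From mathcomp Require Import mpoly finfield ring_quotient generic_quotient ring zify.
From Stdlib Require Import FunctionalExtensionality ClassicalEpsilon.

Set Implicit Arguments.
Unset Strict Implicit.
Unset Printing Implicit Defensive.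

Import Order.TTheory GRing.Theory Num.Theory.
Local Open Scope ring_scope.

Local Notation pmap := Defs.pmap.


(** In equal characteristic everything becomes additive. The image of p in o is
    0, so that the formal group of a formal o-module is killed by p, and such a
    group has a logarithm: one constructs an isomorphism f with the additive
    group degree by degree, the obstruction in degree n being a symmetric cocycle
    of the additive group ([symmetric_cocycle], [additive_coordinate]). Averaging
    f over the units of the constant field Fq makes it Fq-linear, and then each
    a in o acts by a series sum_j alpha_j(a) T^(q^j) ([twisted_form]). A formal
    o-module over R is thus a ring homomorphism alpha from o to the ring of
    twisted power series R{{t}}, where t c = c^q t, and alpha is determined by
    alpha(pi).

    Over the algebraically closed field FF, height n means that alpha(pi) starts
    in degree n, and alpha(pi) can be conjugated to t^n ([special_fibre]). If R is
    complete and alpha(pi) reduces to t^n, a Weierstrass preparation produces a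
    unique v = 1 modulo the maximal ideal conjugating alpha(pi) to a monic twisted
    polynomial pi + u_1 t + .. + u_(n-1) t^(n-1) + t^n ([normal_form_exists],
    [normal_form_unique]). Conversely every such polynomial is alpha(pi) for an
    action of o: the other series are forced by commutation with it, and they
    exist already over O[u_1, .., u_(n-1)] ([commuting_family]). So the
    deformations over R correspond to the tuples (u_1, .., u_(n-1)) of elements of
    the maximal ideal, and R0 represents these tuples
    ([represented_by_parameters]). The generic module over O[u_1, .., u_(n-1)],
    with multiplication by pi equal to the required polynomial, therefore induces
    the universal deformation.

    What remains concerns R0 only, known as a complete local noetherian ring with
    parameters u_i that can be sent anywhere in a maximal ideal, in one way. Its
    maximal ideal m is generated by pi and the u_i, since two homomorphisms to the
    quotient by m^2 and these elements must agree ([max_params]). Mapping R0 to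
    the rings FF[X_0, .., X_(n-1)]/(X)^k, with pi acting as X_0, gives a
    homomorphism to FF[[X_0, .., X_(n-1)]] ([expansion]). It yields a chain of n+1
    primes ([parameter_prime_chain]) and the injectivity of
    O[u_1, .., u_(n-1)] -> R0 ([mmap_params_inj]). There is no longer chain of
    primes ([krull_bound]): for primes P0 < P1, if m has a power in
    P0 + (v_1, .., v_d), then R0 is finite modulo P0 over the values of power
    series at v, so that some non-zero power series relation between the v_i holds
    modulo P1, and after Noether normalisation m has a power in
    P1 + (v'_1, .., v'_(d-1)). *)

(** * Low-degree calculus and substitution of power series *)

Section LowDegree.
Variables (R : comNzRingType).
Implicit Types (k l : nat).

(** Membership in the d-th power of the ideal of the variables. *)
Definition lowdeg k d (p : {mpoly R[k]}) :=
  forall m : 'X_{1..k}, (mdeg m < d)%N -> p@_m = 0.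

Lemma lowdeg_zero k d : lowdeg d (0 : {mpoly R[k]}).
Proof. by move=> m _; rewrite mcoeff0. Qed.

Lemma lowdeg0 k (p : {mpoly R[k]}) : lowdeg 0 p.
Proof. by []. Qed.

Lemma lowdegW k d e (p : {mpoly R[k]}) : (e <= d)%N -> lowdeg d p -> lowdeg e p.
Proof. by move=> ed hp m /leq_trans/(_ ed)/hp. Qed.

Lemma lowdegD k d (p q : {mpoly R[k]}) : lowdeg d p -> lowdeg d q -> lowdeg d (p + q).
Proof. by move=> hp hq m hm; rewrite mcoeffD hp // hq // addr0. Qed.

Lemma lowdegZ k d c (p : {mpoly R[k]}) : lowdeg d p -> lowdeg d (c *: p).
Proof. by move=> hp m hm; rewrite mcoeffZ hp // mulr0. Qed.

Lemma lowdeg_sum k d (I : Type) (r : seq I) (P : pred I) (F : I -> {mpoly R[k]}) :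
  (forall i, P i -> lowdeg d (F i)) -> lowdeg d (\sum_(i <- r | P i) F i).
Proof.
move=> hF; elim/big_ind: _ => //; first exact: lowdeg_zero.
by move=> *; apply: lowdegD.
Qed.

Lemma lowdegM k d e (p q : {mpoly R[k]}) :
  lowdeg d p -> lowdeg e q -> lowdeg (d + e) (p * q).
Proof.
move=> hp hq m hm; rewrite mcoeffM big1 // => -[a b] /= /eqP ham.
have {}hm : (mdeg a + mdeg b < d + e)%N by rewrite -mdegD -ham.
have [ha|ha] := ltnP (mdeg a) d; first by rewrite hp // mul0r.
rewrite hq ?mulr0 // -(ltn_add2l d).
by apply: leq_ltn_trans hm; rewrite leq_add2r.
Qed.

Lemma lowdegMl k e (p q : {mpoly R[k]}) : lowdeg e q -> lowdeg e (p * q).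
Proof. exact: (@lowdegM k 0). Qed.

Lemma lowdegMr k e (p q : {mpoly R[k]}) : lowdeg e p -> lowdeg e (p * q).
Proof. by rewrite mulrC; exact: lowdegMl. Qed.

Lemma lowdegX k (m : 'X_{1..k}) : lowdeg (mdeg m) ('X_[m] : {mpoly R[k]}).
Proof. by move=> a; rewrite mcoeffX; case: eqP => // ->; rewrite ltnn. Qed.

Lemma lowdeg_exp k (p : {mpoly R[k]}) d e : lowdeg d p -> lowdeg (d * e) (p ^+ e).
Proof.
move=> hp; elim: e => [|e ih]; first by rewrite muln0.
by rewrite mulnS exprS; apply: lowdegM.
Qed.

(** A monomial of degree d evaluated at two families of constant-free
    polynomials that agree up to degree e gains its own degree: each of its d
    factors already has positive order. *)
Lemma lowdeg_mmap1B k l e (g h : 'I_k -> {mpoly R[l]}) (m : 'X_{1..k}) :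
  (forall i, lowdeg 1 (g i)) -> (forall i, lowdeg 1 (h i)) ->
  (forall i, lowdeg e.+1 (g i - h i)) ->
  [/\ lowdeg (mdeg m) (\prod_i g i ^+ m i), lowdeg (mdeg m) (\prod_i h i ^+ m i) &
  lowdeg (mdeg m + e) (\prod_i g i ^+ m i - \prod_i h i ^+ m i)].
Proof.
move=> hg hh hgh; rewrite mdegE.
pose Q a (x y : {mpoly R[l]}) := [/\ lowdeg a x, lowdeg a y & lowdeg (a + e) (x - y)].
have QM a b x y z t : Q a x y -> Q b z t -> Q (a + b)%N (x * z) (y * t).
  move=> [x1 x2 x3] [y1 y2 y3]; split; try exact: lowdegM.
  have -> : x * z - y * t = (x - y) * z + y * (z - t) by ring.
  apply: lowdegD; last by rewrite -addnA; apply: lowdegM.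
  by rewrite addnAC; apply: lowdegM.
have Q1 : Q 0%N 1 1 by split=> //; rewrite subrr; apply: lowdeg_zero.
have QX i : Q (m i) (g i ^+ m i) (h i ^+ m i).
  elim: (m i) => [//|j ih]; rewrite !exprS -add1n; apply: QM => //.
suff : Q (\sum_i m i)%N (\prod_i g i ^+ m i) (\prod_i h i ^+ m i) by [].
elim: (index_enum _) => [|i s ih]; first by rewrite !big_nil.
by rewrite !big_cons; apply: QM.
Qed.

Lemma lowdeg_comp k l d (p : {mpoly R[k]}) (g : k.-tuple {mpoly R[l]}) :
  (forall i, lowdeg 1 (tnth g i)) -> lowdeg d p -> lowdeg d (p \mPo g).
Proof.
move=> hg hp; rewrite comp_mpolyE; apply: lowdeg_sum => m _.
have [hm|hm] := ltnP (mdeg m) d.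
  by rewrite hp // scale0r; apply: lowdeg_zero.
apply: lowdegZ; apply: lowdegW hm _.
by case: (@lowdeg_mmap1B _ _ 0 (tnth g) (tnth g) m) => // i; rewrite subrr;
   apply: lowdeg_zero.
Qed.

Lemma lowdeg_compB k l d e (p : {mpoly R[k]}) (g h : k.-tuple {mpoly R[l]}) :
  (forall i, lowdeg 1 (tnth g i)) -> (forall i, lowdeg 1 (tnth h i)) ->
  (forall i, lowdeg e.+1 (tnth g i - tnth h i)) ->
  lowdeg d p -> lowdeg (d + e) ((p \mPo g) - (p \mPo h)).
Proof.
move=> hg hh hgh hp; rewrite !comp_mpolyE -sumrB; apply: lowdeg_sum => m _.
rewrite -scalerBr; have [hm|hm] := ltnP (mdeg m) d.
  by rewrite hp // scale0r; apply: lowdeg_zero.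
apply: lowdegZ; apply: (@lowdegW _ (mdeg m + e)); first by rewrite leq_add2r.
by case: (lowdeg_mmap1B m hg hh hgh).
Qed.

Lemma lowdeg_compB0 k l e (p : {mpoly R[k]}) (g h : k.-tuple {mpoly R[l]}) :
  (forall i, lowdeg 1 (tnth g i)) -> (forall i, lowdeg 1 (tnth h i)) ->
  (forall i, lowdeg e (tnth g i - tnth h i)) ->
  lowdeg e ((p \mPo g) - (p \mPo h)).
Proof.
move=> hg hh; case: e => [//|e] hgh.
have -> : (p \mPo g) - (p \mPo h) =
    ((p - (p@_0%MM)%:MP) \mPo g) - ((p - (p@_0%MM)%:MP) \mPo h).
  by rewrite !comp_mpolyB !comp_mpolyC; ring.
rewrite -add1n; apply: lowdeg_compB => // m; rewrite ltnS leqn0 mdeg_eq0 => /eqP ->.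
by rewrite mcoeffB mcoeffC eqxx mulr1 subrr.
Qed.

(** Series are only handled through polynomials that agree with them below some
    degree. *)
Definition approx k d (f : pseries k R) (p : {mpoly R[k]}) :=
  forall m : 'X_{1..k}, (mdeg m < d)%N -> f m = p@_m.

Lemma ptruncE k (f : pseries k R) d m :
  (ptrunc f d)@_m = if (mdeg m < d)%N then f m else 0.
Proof.
rewrite /ptrunc; case: ifP => [hm|/negbT hm]; first exact: mcoeff_mpoly.
rewrite raddf_sum big1 // => i _ /=; rewrite mcoeffZ mcoeffX.
case: eqP => [im|]; last by rewrite mulr0.
by move: hm; rewrite -im bmdeg.
Qed.

Lemma approx_ptrunc k d (f : pseries k R) : approx d f (ptrunc f d).
Proof. by move=> m hm; rewrite ptruncE hm. Qed.

Lemma approxW k d e (f : pseries k R) p : (e <= d)%N -> approx d f p -> approx e f p.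
Proof. by move=> ed hp m /leq_trans/(_ ed)/hp. Qed.

Lemma approx_lowdeg k d (f : pseries k R) p q :
  approx d f p -> approx d f q -> lowdeg d (p - q).
Proof. by move=> hp hq m hm; rewrite mcoeffB -hp // -hq // subrr. Qed.

Lemma approx_lowdegl k d (f : pseries k R) p q :
  approx d f p -> lowdeg d (p - q) -> approx d f q.
Proof. by move=> hp hq m hm; rewrite hp //; apply/eqP; rewrite -subr_eq0 -mcoeffB hq. Qed.

Lemma approx_unique k (f g : pseries k R) :
  (forall d, exists2 p, approx d f p & approx d g p) -> f = g.
Proof.
move=> h; apply: functional_extensionality => m.
by have [p fp gp] := h (mdeg m).+1; rewrite fp // gp.
Qed.

(** Everything about substitution of series is deduced from composition of
    polynomials through this compatibility. *)
Lemma approx_psubst k l d (f : pseries k R) (g : k.-tuple (pseries l R))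
    (p : {mpoly R[k]}) (r : k.-tuple {mpoly R[l]}) :
  (forall i, tnth g i 0%MM = 0) -> (forall i, lowdeg 1 (tnth r i)) ->
  approx d f p -> (forall i, approx d (tnth g i) (tnth r i)) ->
  approx d (psubst f g) (p \mPo r).
Proof.
move=> g0 r0 hp hr m hm; rewrite /psubst; apply/eqP; rewrite -subr_eq0 -mcoeffB.
set d' := (mdeg m).+1; set q := ptrunc _ _; set t := [tuple _ | _ < _].
have t0 i : lowdeg 1 (tnth t i).
  move=> a; rewrite ltnS leqn0 mdeg_eq0 => /eqP ->.
  by rewrite tnth_mktuple ptruncE mdeg0 /= g0.
have tr i : lowdeg d' (tnth t i - tnth r i).
  rewrite tnth_mktuple; exact: approx_lowdeg (approx_ptrunc _) (approxW hm (hr i)).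
have -> : (q \mPo t) - (p \mPo r) = ((q - p) \mPo t) + ((p \mPo t) - (p \mPo r)).
  by rewrite comp_mpolyB addrA subrK.
have hd' : lowdeg d' (q - p).
  by apply: approx_lowdeg (approx_ptrunc _) (approxW hm hp).
rewrite mcoeffD (lowdeg_comp t0 hd') // add0r.
by rewrite (lowdeg_compB0 _ t0 r0 tr).
Qed.

Lemma approxD k d (f g : pseries k R) p q :
  approx d f p -> approx d g q -> approx d (fun m => f m + g m) (p + q).
Proof. by move=> hp hq m hm; rewrite mcoeffD hp // hq. Qed.

Lemma lowdeg1P k (f : pseries k R) p d :
  f 0%MM = 0 -> approx d.+1 f p -> lowdeg 1 p.
Proof.
move=> f0 fp m; rewrite ltnS leqn0 mdeg_eq0 => /eqP ->.
by rewrite -fp ?mdeg0.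
Qed.

Lemma lowdeg1_ptrunc k (f : pseries k R) d : f 0%MM = 0 -> lowdeg 1 (ptrunc f d).
Proof.
move=> f0 m; rewrite ltnS leqn0 mdeg_eq0 => /eqP ->.
by rewrite ptruncE f0; case: ifP.
Qed.

End LowDegree.

(** Substitution with the arguments given by a function. It is locked: the
    conversion test must never unfold coefficients of truncated compositions. *)
HB.lock Definition psub (R : comNzRingType) k l (f : pseries k R)
    (g : 'I_k -> pseries l R) : pseries l R :=
  psubst f [tuple g i | i < k].

Section Substitution.
Variable R : comNzRingType.

Lemma psubE k l (f : pseries k R) (g : k.-tuple (pseries l R)) :
  psubst f g = psub f (tnth g).
Proof.
by rewrite psub.unlock; congr psubst; apply: eq_from_tnth => i; rewrite tnth_mktuple.
Qed.

Lemma approx_psub k l d (f : pseries k R) (g : 'I_k -> pseries l R) p r :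
  (forall i, g i 0%MM = 0) -> (forall i, lowdeg 1 (r i)) ->
  approx d f p -> (forall i, approx d (g i) (r i)) ->
  approx d (psub f g) (p \mPo [tuple r i | i < k]).
Proof.
move=> g0 r0 hp hr; rewrite psub.unlock.
apply: approx_psubst => // i; rewrite tnth_mktuple //.
by rewrite tnth_mktuple.
Qed.

Lemma approx_psub_trunc k l d (f : pseries k R) (g : 'I_k -> pseries l R) :
  (forall i, g i 0%MM = 0) ->
  approx d (psub f g) (ptrunc f d \mPo [tuple ptrunc (g i) d | i < k]).
Proof.
move=> g0; apply: approx_psub => //; try by move=> *; apply: approx_ptrunc.
by move=> i; apply: lowdeg1_ptrunc.
Qed.

Lemma lowdeg1_comp k l (p : {mpoly R[k]}) (r : k.-tuple {mpoly R[l]}) :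
  lowdeg 1 p -> (forall i, lowdeg 1 (tnth r i)) -> lowdeg 1 (p \mPo r).
Proof. by move=> hp hr; apply: lowdeg_comp. Qed.

Lemma psub0 k l (f : pseries k R) (g : 'I_k -> pseries l R) :
  f 0%MM = 0 -> (forall i, g i 0%MM = 0) -> psub f g 0%MM = 0.
Proof.
move=> f0 g0; rewrite (@approx_psub_trunc _ _ 1) ?mdeg0 //.
apply: lowdeg1_comp; rewrite ?mdeg0 //; first exact: lowdeg1_ptrunc.
by move=> i; rewrite tnth_mktuple; apply: lowdeg1_ptrunc.
Qed.

Lemma comp_mpolyA k l j (p : {mpoly R[k]}) (r : 'I_k -> {mpoly R[l]})
    (s : l.-tuple {mpoly R[j]}) :
  (p \mPo [tuple r i | i < k]) \mPo s = p \mPo [tuple r i \mPo s | i < k].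
Proof.
rewrite [in RHS]comp_mpolyE [X in X \mPo s]comp_mpolyE raddf_sum /=.
apply: eq_bigr => m _; rewrite comp_mpolyZ; congr (_ *: _).
rewrite rmorph_prod; apply: eq_bigr => i _.
by rewrite rmorphXn /= !tnth_mktuple.
Qed.

Lemma psubA k l j (f : pseries k R) (g : 'I_k -> pseries l R) (h : 'I_l -> pseries j R) :
  (forall i, g i 0%MM = 0) -> (forall i, h i 0%MM = 0) ->
  psub (psub f g) h = psub f (fun i => psub (g i) h).
Proof.
move=> g0 h0; apply: approx_unique => d.
exists ((ptrunc f d \mPo [tuple ptrunc (g i) d | i < k]) \mPo
          [tuple ptrunc (h i) d | i < l]).
  apply: approx_psub => //; try by move=> *; apply: approx_ptrunc.
    by move=> i; apply: lowdeg1_ptrunc.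
  exact: approx_psub_trunc.
rewrite comp_mpolyA; apply: approx_psub => //; try exact: approx_ptrunc.
- by move=> i; apply: psub0.
- move=> i; apply: lowdeg1_comp; first exact: lowdeg1_ptrunc.
  by move=> a; rewrite tnth_mktuple; apply: lowdeg1_ptrunc.
- by move=> i; apply: approx_psub_trunc.
Qed.

Lemma pvar0 k (i : 'I_k) : pvar R i 0%MM = 0.
Proof. by rewrite /pvar eq_sym mnm1_eq0. Qed.

Lemma approx_pvar k d (i : 'I_k) : approx d (pvar R i) 'X_i.
Proof. by move=> m _; rewrite mcoeffX /pvar eq_sym. Qed.

Lemma lowdeg1_var k (i : 'I_k) : lowdeg 1 ('X_i : {mpoly R[k]}).
Proof. by have := @lowdegX R k U_(i)%MM; rewrite mdeg1. Qed.

Lemma psub_var k l (i : 'I_k) (g : 'I_k -> pseries l R) :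
  (forall i, g i 0%MM = 0) -> psub (pvar R i) g = g i.
Proof.
move=> g0; apply: approx_unique => d.
exists ('X_i \mPo [tuple ptrunc (g i) d | i < k]).
  apply: approx_psub => //; try by move=> *; apply: approx_ptrunc.
    by move=> j; apply: lowdeg1_ptrunc.
  exact: approx_pvar.
by rewrite comp_mpolyXU -tnth_nth tnth_mktuple; apply: approx_ptrunc.
Qed.

Lemma psub_id k (f : pseries k R) : psub f (@pvar k R) = f.
Proof.
apply: approx_unique => d; exists (ptrunc f d); last exact: approx_ptrunc.
rewrite -[X in approx _ _ X]comp_mpoly_id.
apply: approx_psub; try by move=> *; apply: approx_ptrunc.
- exact: pvar0.
- exact: lowdeg1_var.
- by move=> i; apply: approx_pvar.
Qed.

Lemma psubD k l (f f' : pseries k R) (g : 'I_k -> pseries l R) m :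
  psub (fun a => f a + f' a) g m = psub f g m + psub f' g m.
Proof.
rewrite psub.unlock /psubst -mcoeffD -comp_mpolyD; congr ((_ \mPo _)@_m).
by apply/mpolyP => a; rewrite mcoeffD !ptruncE; case: ifP; rewrite ?addr0.
Qed.

Lemma psubZ k l c (f : pseries k R) (g : 'I_k -> pseries l R) m :
  psub (fun a => c * f a) g m = c * psub f g m.
Proof.
rewrite psub.unlock /psubst -mcoeffZ -comp_mpolyZ; congr ((_ \mPo _)@_m).
by apply/mpolyP => a; rewrite mcoeffZ !ptruncE; case: ifP; rewrite ?mulr0.
Qed.

Lemma psub_const0 k l (g : 'I_k -> pseries l R) : psub (pzero k R) g = pzero l R.
Proof.
apply: functional_extensionality => m; rewrite psub.unlock /psubst.
have -> : ptrunc (pzero k R) (mdeg m).+1 = 0.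
  by apply/mpolyP => a; rewrite ptruncE mcoeff0; case: ifP.
by rewrite comp_mpoly0 mcoeff0.
Qed.

Lemma eq_psub k l (f : pseries k R) (g h : 'I_k -> pseries l R) :
  g =1 h -> psub f g = psub f h.
Proof. by move/functional_extensionality ->. Qed.

End Substitution.

Section MapSeries.
Variables (R S : comNzRingType) (phi : {rmorphism R -> S}).

Lemma map_comp_mpoly k l (p : {mpoly R[k]}) (r : 'I_k -> {mpoly R[l]}) :
  map_mpoly phi (p \mPo [tuple r i | i < k]) =
  map_mpoly phi p \mPo [tuple map_mpoly phi (r i) | i < k].
Proof.
have mapZ j c (q : {mpoly R[j]}) : map_mpoly phi (c *: q) = phi c *: map_mpoly phi q.
  by apply/mpolyP => m; rewrite mcoeffZ !mcoeff_map_mpoly mcoeffZ /= rmorphM.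
have mapX (m : 'X_{1..k}) : map_mpoly phi 'X_[m] = 'X_[m].
  by apply/mpolyP => a; rewrite mcoeff_map_mpoly !mcoeffX /= rmorph_nat.
rewrite [p]mpolyE; elim: (msupp p) => [|m s ih].
  by rewrite !big_nil !(raddf0, comp_mpoly0).
rewrite !big_cons !raddfD /= {}ih; congr (_ + _).
rewrite comp_mpolyZ !mapZ mapX comp_mpolyZ; congr (_ *: _).
rewrite !comp_mpolyX rmorph_prod; apply: eq_bigr => i _.
by rewrite rmorphXn /= !tnth_mktuple.
Qed.

Lemma approx_pmap k d (f : pseries k R) p :
  approx d f p -> approx d (pmap phi f) (map_mpoly phi p).
Proof. by move=> hp m hm; rewrite mcoeff_map_mpoly -hp. Qed.

Lemma pmap_psub k l (f : pseries k R) (g : 'I_k -> pseries l R) :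
  (forall i, g i 0%MM = 0) ->
  pmap phi (psub f g) = psub (pmap phi f) (fun i => pmap phi (g i)).
Proof.
move=> g0; apply: approx_unique => d.
exists (map_mpoly phi (ptrunc f d \mPo [tuple ptrunc (g i) d | i < k])).
  by apply: approx_pmap; apply: approx_psub_trunc.
rewrite map_comp_mpoly; apply: approx_psub.
- by move=> i; rewrite /pmap g0 rmorph0.
- move=> i m hm; rewrite mcoeff_map_mpoly (lowdeg1_ptrunc _ (g0 i) hm) //.
  exact: rmorph0.
- by apply: approx_pmap; apply: approx_ptrunc.
- by move=> i; apply: approx_pmap; apply: approx_ptrunc.
Qed.

Lemma pmap_pvar k (i : 'I_k) : pmap phi (pvar R i) = pvar S i.
Proof.
by apply: functional_extensionality => m; rewrite /pmap /pvar; case: eqP => _;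
  rewrite ?rmorph0 ?rmorph1.
Qed.

End MapSeries.

(** * One-variable series and formal group homomorphisms *)

(** Dependent choice along the natural numbers: a sequence is built one term at
    a time from a constraint whose n-th instance only sees the first n+1 terms. *)
Lemma sequence_choice (T : Type) (x0 : T) (P : nat -> (nat -> T) -> Prop) :
  (forall n c c', (forall i, (i <= n)%N -> c i = c' i) -> P n c -> P n c') ->
  (forall n c, (forall m, (m < n)%N -> P m c) ->
     exists x, P n (fun i => if i == n then x else c i)) ->
  exists c, forall n, P n c.
Proof.
move=> Pext step.
pose upd (c : nat -> T) n x := fun i => if i == n then x else c i.
have next n c : exists x, (forall m, (m < n)%N -> P m c) -> P n (upd c n x).
  case: (classic (forall m, (m < n)%N -> P m c)) => [/step[x hx]|h].
    by exists x.
  by exists x0 => /h.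
pose nx n c := proj1_sig (constructive_indefinite_description _ (next n c)).
have nxP n c : (forall m, (m < n)%N -> P m c) -> P n (upd c n (nx n c)).
  exact: (proj2_sig (constructive_indefinite_description _ (next n c))).
pose fix st n := if n is n'.+1 then upd (st n') n' (nx n' (st n')) else fun _ => x0.
have stS n i : (i < n)%N -> st n.+1 i = st n i.
  by move=> hi; rewrite /= /upd ltn_eqF.
have stable n k i : (i < n)%N -> st (n + k)%N i = st n i.
  move=> hi; elim: k => [|k ih]; first by rewrite addn0.
  by rewrite addnS stS ?ih // ltn_addr.
have stE n i : (i < n)%N -> st n i = st i.+1 i.
  by move=> hi; rewrite -(subnKC hi) stable.
have stP n : forall m, (m < n)%N -> P m (st n).
  elim: n => [//|n ih] m; rewrite ltnS leq_eqVlt => /orP[/eqP ->|hm].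
    exact: nxP.
  apply: Pext (ih m hm) => i im.
  by rewrite stS // (leq_ltn_trans im hm).
exists (fun i => st i.+1 i) => n; apply: Pext (stP n.+1 n (ltnSn n)) => i hi.
by rewrite stE.
Qed.

Lemma pvarE (R : comNzRingType) k (i : 'I_k) m : pvar R i m = (m == U_(i)%MM)%:R.
Proof. by []. Qed.

(** Substitution into a series in one, respectively two, variables; locked for
    the same reason as the general substitution. *)
HB.lock Definition sub1 (R : comNzRingType) l (f : pseries 1 R) (g : pseries l R) :
  pseries l R := psub f (fun=> g).

HB.lock Definition app2 (R : comNzRingType) l (F : pseries 2 R)
    (a b : pseries l R) : pseries l R := psub F (tnth [tuple a; b]).

Section OneVariable.
Variable R : comNzRingType.
Implicit Types (f g : pseries 1 R) (c : nat -> R).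

Definition varx : pseries 2 R := pvar R 0.
Definition vary : pseries 2 R := pvar R 1.

Lemma sub1_psub l f (g : pseries l R) : sub1 f g = psub f (fun=> g).
Proof. by rewrite sub1.unlock. Qed.

Lemma app2_psub l (F : pseries 2 R) (a b : pseries l R) :
  app2 F a b = psub F (tnth [tuple a; b]).
Proof. by rewrite app2.unlock. Qed.

Lemma sub1E l f (g : pseries l R) : psubst f [tuple g] = sub1 f g.
Proof. by rewrite psubE sub1_psub; apply: eq_psub => i; rewrite (ord1 i). Qed.

Lemma app2E l (F : pseries 2 R) (a b : pseries l R) :
  psubst F [tuple a; b] = app2 F a b.
Proof. by rewrite psubE app2_psub. Qed.

Lemma ord2_cases (P : 'I_2 -> Prop) : P 0 -> P 1 -> forall i, P i.
Proof.
move=> p0 p1 [[|[|//]] hi].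
  by rewrite (_ : Ordinal hi = 0) //; apply: val_inj.
by rewrite (_ : Ordinal hi = 1) //; apply: val_inj.
Qed.

Lemma sub1_0 l f (g : pseries l R) : f 0%MM = 0 -> g 0%MM = 0 -> sub1 f g 0%MM = 0.
Proof. by move=> f0 g0; rewrite sub1_psub; apply: psub0. Qed.

Lemma app2_0 l F (a b : pseries l R) :
  F 0%MM = 0 -> a 0%MM = 0 -> b 0%MM = 0 -> app2 F a b 0%MM = 0.
Proof. by move=> F0 a0 b0; rewrite app2_psub; apply: psub0 => //; apply: ord2_cases. Qed.

Lemma psub_sub1 k l f (g : pseries k R) (h : 'I_k -> pseries l R) :
  g 0%MM = 0 -> (forall i, h i 0%MM = 0) -> psub (sub1 f g) h = sub1 f (psub g h).
Proof. by move=> g0 h0; rewrite !sub1_psub psubA. Qed.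

Lemma psub_app2 k l F (a b : pseries k R) (h : 'I_k -> pseries l R) :
  a 0%MM = 0 -> b 0%MM = 0 -> (forall i, h i 0%MM = 0) ->
  psub (app2 F a b) h = app2 F (psub a h) (psub b h).
Proof.
move=> a0 b0 h0; rewrite !app2_psub psubA; [|exact: ord2_cases|exact: h0].
by apply: eq_psub; apply: ord2_cases.
Qed.

Lemma sub1_sub1 l f g (h : pseries l R) :
  g 0%MM = 0 -> h 0%MM = 0 -> sub1 (sub1 f g) h = sub1 f (sub1 g h).
Proof. by move=> g0 h0; rewrite [LHS]sub1_psub [sub1 g h]sub1_psub psub_sub1. Qed.

Lemma sub1_app2 l f F (a b : pseries l R) :
  F 0%MM = 0 -> a 0%MM = 0 -> b 0%MM = 0 ->
  app2 (sub1 f F) a b = sub1 f (app2 F a b).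
Proof.
by move=> F0 a0 b0; rewrite !app2_psub psub_sub1 //; apply: ord2_cases.
Qed.

Lemma app2_sub1 l F f g (h : pseries l R) :
  f 0%MM = 0 -> g 0%MM = 0 -> h 0%MM = 0 ->
  sub1 (app2 F f g) h = app2 F (sub1 f h) (sub1 g h).
Proof. by move=> f0 g0 h0; rewrite !sub1_psub psub_app2. Qed.

Lemma app2_app2 l F (a b : pseries 2 R) (c d : pseries l R) :
  a 0%MM = 0 -> b 0%MM = 0 -> c 0%MM = 0 -> d 0%MM = 0 ->
  app2 (app2 F a b) c d = app2 F (app2 a c d) (app2 b c d).
Proof.
move=> a0 b0 c0 d0; rewrite [LHS]app2_psub [app2 a c d]app2_psub [app2 b c d]app2_psub.
by rewrite psub_app2 //; apply: ord2_cases.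
Qed.

Lemma pT0 : pT R 0%MM = 0. Proof. exact: pvar0. Qed.
Lemma varx0 : varx 0%MM = 0. Proof. exact: pvar0. Qed.
Lemma vary0 : vary 0%MM = 0. Proof. exact: pvar0. Qed.

Lemma pTE m : pT R m = (m == U_(0%R)%MM)%:R.
Proof. exact: pvarE. Qed.

Lemma sub1T l (g : pseries l R) : g 0%MM = 0 -> sub1 (pT R) g = g.
Proof. by move=> g0; rewrite sub1_psub psub_var. Qed.

Lemma sub1_id f : sub1 f (pT R) = f.
Proof. by rewrite -[RHS]psub_id sub1_psub; apply: eq_psub => i; rewrite (ord1 i). Qed.

Lemma app2x l (a b : pseries l R) : a 0%MM = 0 -> b 0%MM = 0 -> app2 varx a b = a.
Proof. by move=> a0 b0; rewrite app2_psub psub_var //; apply: ord2_cases. Qed.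

Lemma app2y l (a b : pseries l R) : a 0%MM = 0 -> b 0%MM = 0 -> app2 vary a b = b.
Proof. by move=> a0 b0; rewrite app2_psub psub_var //; apply: ord2_cases. Qed.

Lemma app2_id F : app2 F varx vary = F.
Proof. by rewrite -[RHS]psub_id app2_psub; apply: eq_psub; apply: ord2_cases. Qed.


Definition cf f (d : nat) : R := f (U_(0%R) *+ d)%MM.

Definition ser (c : nat -> R) : pseries 1 R := fun m => c (mdeg m).

Lemma mnm_one (m : 'X_{1..1}) : m = (U_(0%R) *+ mdeg m)%MM.
Proof.
apply/mnmP => i; rewrite (ord1 i) mulmnE mnm1E eqxx mul1n mdegE.
by rewrite big_ord1.
Qed.

Lemma ser_cf f : ser (cf f) = f.
Proof. by apply: functional_extensionality => m; rewrite /ser /cf -mnm_one. Qed.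

Lemma cf_ser c : cf (ser c) = c.
Proof.
by apply: functional_extensionality => d; rewrite /ser /cf mdegMn mdeg1 mul1n.
Qed.

Lemma cf_inj f g : cf f =1 cf g -> f = g.
Proof. by rewrite -{2}[f]ser_cf -{2}[g]ser_cf => /functional_extensionality ->. Qed.

Lemma cf0 f : cf f 0 = f 0%MM. Proof. by rewrite /cf mulm0n. Qed.

Lemma mcoeffXn1 d (m : 'X_{1..1}) : ('X_0 ^+ d : {mpoly R[1]})@_m = (mdeg m == d)%:R.
Proof.
rewrite mcoeffXn [in LHS](mnm_one m); congr (_%:R); congr (nat_of_bool _).
apply/eqP/eqP => [/(congr1 (@mdeg 1))|<- //].
by rewrite !mdegMn mdeg1 !mul1n.
Qed.

Definition serpoly c d : {mpoly R[1]} := \sum_(i < d) c i *: 'X_0 ^+ i.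

Lemma approx_ser c d : approx d (ser c) (serpoly c d).
Proof.
move=> m hm; rewrite /serpoly raddf_sum (bigD1 (Ordinal hm)) //=.
rewrite mcoeffZ mcoeffXn1 eqxx mulr1 big1 ?addr0 // => i /eqP hi.
rewrite mcoeffZ mcoeffXn1; case: eqP => [im|]; last by rewrite mulr0.
by case: hi; apply: val_inj.
Qed.

Lemma approx_sub1 l c (g : pseries l R) d p :
  g 0%MM = 0 -> approx d g p -> approx d (sub1 (ser c) g) (\sum_(i < d) c i *: p ^+ i).
Proof.
case: d => [//|d] g0 gp; rewrite sub1_psub.
have -> : \sum_(i < d.+1) c i *: p ^+ i = serpoly c d.+1 \mPo [tuple p | i < 1].
  rewrite /serpoly raddf_sum; apply: eq_bigr => i _ /=.
  by rewrite comp_mpolyZ rmorphXn /= comp_mpolyXU -tnth_nth tnth_mktuple.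
apply: approx_psub => //; last exact: approx_ser.
by move=> _; apply: lowdeg1P gp.
Qed.

Lemma sub1_coef l c (g : pseries l R) (m : 'X_{1..l}) : g 0%MM = 0 ->
  sub1 (ser c) g m =
  \sum_(i < (mdeg m).+1) c i * (ptrunc g (mdeg m).+1 ^+ i)@_m.
Proof.
move=> g0; rewrite (approx_sub1 c g0 (@approx_ptrunc _ _ (mdeg m).+1 g)) //.
by rewrite raddf_sum; apply: eq_bigr => i _ /=; rewrite mcoeffZ.
Qed.

Lemma lead_exp (p : {mpoly R[1]}) d : lowdeg 1 p ->
  (p ^+ d)@_(U_(0%R) *+ d)%MM = (p@_U_(0%R)%MM) ^+ d.
Proof.
move=> hp; elim: d => [|d ih]; first by rewrite expr0 mulm0n mcoeff1 eqxx.
pose r := p - p@_U_(0%R)%MM *: 'X_0.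
have hr : lowdeg 2 r.
  move=> m; rewrite ltnS leq_eqVlt ltnS leqn0 => /orP[] hm.
    rewrite (mnm_one m) (eqP hm) mulm1n mcoeffB mcoeffZ mcoeffXU eqxx.
    by rewrite mulr1 subrr.
  rewrite mcoeffB mcoeffZ mcoeffX hp ?(eqP hm) // (_ : _ == m = false) ?mulr0 ?subrr //.
  by apply/eqP => um; move: hm; rewrite -um mdeg1.
rewrite exprS -{1}[p](subrK (p@_U_(0%R)%MM *: 'X_0)) -/r mulrDl mcoeffD.
rewrite (lowdegM (d := 2) (e := 1 * d) hr (lowdeg_exp hp)); last first.
  by rewrite mdegMn mdeg1 !mul1n !addSn.
rewrite add0r -scalerAl mcoeffZ mulmS ['X_0 * _]mulrC mcoeffMX ih.
by rewrite exprS.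
Qed.

(** The coefficients of g are found in turn: in degree n the new one enters
    multiplied by the n-th power of the linear coefficient of f. *)
Lemma left_inverse_series f (c : R) : f 0%MM = 0 -> c * cf f 1 = 1 ->
  exists g, [/\ g 0%MM = 0, cf g 1 = c & sub1 g f = pT R].
Proof.
move=> f0 cf1.
pose P d (b : nat -> R) := sub1 (ser b) f (U_(0%R) *+ d)%MM = pT R (U_(0%R) *+ d)%MM.
have Pext n b b' : (forall i, (i <= n)%N -> b i = b' i) -> P n b -> P n b'.
  move=> e; rewrite /P !sub1_coef // mdegMn mdeg1 mul1n => <-.
  by apply: eq_bigr => i _; rewrite e // -ltnS.
have lead n : (ptrunc f n.+1 ^+ n)@_(U_(0%R) *+ n)%MM = cf f 1 ^+ n.
  rewrite lead_exp; last exact: lowdeg1_ptrunc.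
  case: n => [|n]; first by rewrite !expr0.
  by rewrite ptruncE mdeg1 /= /cf mulm1n.
have [|b Pb] := sequence_choice 0 Pext.
  move=> n b _; pose s := \sum_(i < n) b i * (ptrunc f n.+1 ^+ i)@_(U_(0%R) *+ n)%MM.
  exists (c ^+ n * (pT R (U_(0%R) *+ n)%MM - s)).
  rewrite /P sub1_coef // mdegMn mdeg1 mul1n big_ord_recr /= eqxx lead.
  rewrite mulrAC -exprMn cf1 expr1n mul1r.
  rewrite (eq_bigr (fun i : 'I_n => b i * (ptrunc f n.+1 ^+ i)@_(U_(0%R) *+ n)%MM)).
    by rewrite addrC subrK.
  by move=> i _ /=; rewrite ltn_eqF.
have e : sub1 (ser b) f = pT R.
  by apply: cf_inj => d; rewrite /cf Pb.
have b0 : b 0%N = 0.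
  move: (Pb 0%N); rewrite /P sub1_coef // mulm0n mdeg0 big_ord1 expr0 mcoeff1 eqxx.
  by rewrite mulr1 => ->; exact: pT0.
exists (ser b); split=> //; first by rewrite -cf0 cf_ser.
move: (Pb 1%N); rewrite /P sub1_coef // mdegMn mdeg1 !big_ord_recl big_ord0 /=.
rewrite b0 mul0r add0r addr0 lead expr1 => h.
have : b 1%N * cf f 1 = 1 by rewrite h pTE mulm1n eqxx.
move=> h1; rewrite cf_ser; transitivity (c * (b 1%N * cf f 1)); last by rewrite h1 mulr1.
by rewrite mulrCA cf1 mulr1.
Qed.

(** A left inverse g of f has itself a left inverse, which must be f. *)
Lemma inverse_series f (c : R) : f 0%MM = 0 -> c * cf f 1 = 1 ->
  exists g, [/\ g 0%MM = 0, cf g 1 = c, sub1 g f = pT R & sub1 f g = pT R].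
Proof.
move=> f0 cf1; have [g [g0 g1 gf]] := left_inverse_series f0 cf1.
exists g; split=> //.
have [h [h0 h1 hg]] : exists h, [/\ h 0%MM = 0, cf h 1 = cf f 1 & sub1 h g = pT R].
  by apply: left_inverse_series; rewrite // g1 mulrC.
suff -> : f = h by [].
by rewrite -(sub1T f0) -hg sub1_sub1 // gf sub1_id.
Qed.

Lemma cf1_sub1 f g : f 0%MM = 0 -> g 0%MM = 0 -> cf (sub1 f g) 1 = cf f 1 * cf g 1.
Proof.
move=> f0 g0; rewrite -{1}[f]ser_cf /cf sub1_coef // mdegMn mdeg1 !big_ord_recl big_ord0.
rewrite /= -/(cf f 0) cf0 f0 mul0r add0r addr0 expr1; congr (_ * _).
by rewrite ptruncE mdegMn mdeg1.
Qed.


Lemma group_homE (F G : pseries 2 R) f :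
  is_group_hom F G f <-> f 0%MM = 0 /\ sub1 f F = app2 G (sub1 f varx) (sub1 f vary).
Proof.
rewrite /is_group_hom app2E !sub1E; split=> -[f0 h]; split=> //.
  exact: functional_extensionality.
by rewrite h.
Qed.

Lemma group_hom_app (F G : pseries 2 R) f l (a b : pseries l R) :
  F 0%MM = 0 -> G 0%MM = 0 -> is_group_hom F G f -> a 0%MM = 0 -> b 0%MM = 0 ->
  sub1 f (app2 F a b) = app2 G (sub1 f a) (sub1 f b).
Proof.
move=> F0 G0 /group_homE[f0 h] a0 b0.
have fx0 := sub1_0 f0 varx0; have fy0 := sub1_0 f0 vary0.
rewrite -sub1_app2 // h app2_app2 //.
by rewrite (sub1_app2 f varx0) // (sub1_app2 f vary0) // app2x // app2y.
Qed.

Lemma group_hom_comp (F G H : pseries 2 R) f g :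
  F 0%MM = 0 -> G 0%MM = 0 -> H 0%MM = 0 ->
  is_group_hom F G f -> is_group_hom G H g -> is_group_hom F H (sub1 g f).
Proof.
move=> F0 G0 H0 hf hg; have [f0 fE] := (group_homE _ _ _).1 hf.
have [g0 _] := hg; apply/group_homE; split; first exact: sub1_0.
have fx0 := sub1_0 f0 varx0; have fy0 := sub1_0 f0 vary0.
rewrite sub1_sub1 // fE (group_hom_app G0 H0 hg) //.
by rewrite (sub1_sub1 _ f0 varx0) (sub1_sub1 _ f0 vary0).
Qed.

Lemma group_hom_inv (F G : pseries 2 R) f g :
  F 0%MM = 0 -> G 0%MM = 0 -> is_group_hom F G f -> g 0%MM = 0 ->
  sub1 g f = pT R -> sub1 f g = pT R -> is_group_hom G F g.
Proof.
move=> F0 G0 hf g0 gf fg; have [f0 _] := hf; apply/group_homE; split=> //.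
have gx0 := sub1_0 g0 varx0; have gy0 := sub1_0 g0 vary0.
have Fxy0 := app2_0 F0 gx0 gy0.
rewrite -[RHS](sub1T Fxy0) -gf sub1_sub1 //.
rewrite (group_hom_app F0 G0 hf) // -(sub1_sub1 _ g0 varx0) -(sub1_sub1 _ g0 vary0) fg.
by rewrite (sub1T varx0) (sub1T vary0) app2_id.
Qed.

End OneVariable.

(** * Symmetric cocycles in characteristic p *)

Section CharP.
Variables (R : comNzRingType) (p : nat).
Hypothesis pR : p \in [pchar R].

Let p_pr : prime p := pcharf_prime pR.

Lemma natr_unit n : ~~ (p %| n)%N -> exists e : R, e * n%:R = 1.
Proof.
rewrite -prime_coprime // => co; have p0 := prime_gt0 p_pr.
have [a _ /dvdnP[b hb]] := Bezoutl n p0.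
move: hb; rewrite (eqP co) => hb.
exists (- a%:R); have : (1 + a * n)%:R = 0 :> R.
  by rewrite hb natrM (pcharf0 pR) mulr0.
rewrite natrD natrM mulNr => h; apply/eqP.
by rewrite -subr_eq0 -opprD oppr_eq0 addrC h.
Qed.

Lemma natr_cancel n (x y : R) : ~~ (p %| n)%N -> n%:R * x = n%:R * y -> x = y.
Proof.
move=> /natr_unit[e he] h.
by rewrite -[x]mul1r -[y]mul1r -he -!mulrA h.
Qed.

Lemma coef_exp1X n i : ((1 + 'X : {poly R}) ^+ n)`_i = 'C(n, i)%:R.
Proof.
rewrite exprDn coef_sum; under eq_bigr => j _ do rewrite expr1n mul1r coefMn coefXn.
have [hi|hi] := ltnP i n.+1.
  rewrite (bigD1 (Ordinal hi)) //= eqxx big1 ?addr0 // => j /eqP hj.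
  by case: eqP => [e|]; [case: hj; apply: val_inj|rewrite mul0rn].
rewrite bin_small // big1 // => j _.
by rewrite gtn_eqF ?mul0rn // (leq_trans (ltn_ord j)).
Qed.

(** Compare (1 + X)^(pa) with (1 + X^p)^a. *)
Lemma bin_pmul a i : 'C(p * a, i)%:R = (if (p %| i)%N then 'C(a, i %/ p)%:R else 0) :> R.
Proof.
have pX : p \in [pchar {poly R}] by rewrite pchar_poly.
rewrite -[LHS]coef_exp1X -[in RHS]coef_exp1X -coef_comp_poly_Xn ?prime_gt0 //.
rewrite rmorphXn /= exprM rmorphD /= rmorph1 comp_polyX.
by rewrite -!(pFrobenius_autE pX) rmorphD rmorph1.
Qed.

(** A homogeneous symmetric 2-cocycle of the additive group whose sum over the
    p-cyclic group vanishes is a coboundary. For degrees prime to p the first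
    coefficient determines all the others; for degree p the only other cocycle
    is ((x+y)^p-x^p-y^p)/p, which has non-zero sum; in the remaining degrees a
    cocycle is a series in the p-th powers, and one descends. *)
Lemma symmetric_cocycle d (a : nat -> R) : (1 < d)%N ->
  (forall i, (i <= d)%N -> a i = a (d - i)%N) ->
  (forall i j, (0 < i)%N -> (0 < j)%N -> (i + j < d)%N ->
     'C(i + j, i)%:R * a (i + j)%N = 'C(d - i, j)%:R * a i) ->
  a 0%N = 0 -> \sum_(t < p) \sum_(i < d.+1) a i * t%:R ^+ i = 0 ->
  exists c, forall i, (0 < i < d)%N -> a i = c * 'C(d, i)%:R.
Proof.
have p0 := prime_gt0 p_pr; have p1 := prime_gt1 p_pr.
elim/ltn_ind: d a => d IH a d1 asym acoc a0 aN.
have step i : (0 < i < d)%N -> i%:R * a i = 'C(d.-1, i.-1)%:R * a 1%N.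
  case/andP; case: i => [//|[|i]] _ hi; first by rewrite bin0.
  have := acoc 1%N i.+1 isT isT hi.
  by rewrite add1n bin1 subn1.
have [pd|pd] := boolP (p %| d)%N; last first.
  (* p does not divide i or d - i, and a is symmetric *)
  have [e he] := natr_unit pd; exists (e * a 1%N).
  have main i : (0 < i < d)%N -> ~~ (p %| i)%N -> a i = e * a 1%N * 'C(d, i)%:R.
    move=> hi pi; apply: (natr_cancel pi); rewrite step //.
    have hn : (d * 'C(d.-1, i.-1) = i * 'C(d, i))%N.
      by case/andP: hi => i0 _; rewrite mul_bin_diag prednK.
    by rewrite mulrCA -natrM -hn natrM -mulrA [a 1%N * _]mulrCA mulrA he mul1r mulrC.
  move=> i hi; have [pi|pi] := boolP (p %| i)%N; last exact: main.
  have [i0 id] := andP hi.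
  rewrite (asym i (ltnW id)) main ?subn_gt0 ?ltn_subrL ?i0 ?id ?bin_sub ?(ltnW id) //.
    by rewrite (ltn_trans _ d1).
  by apply: contra pd => pdi; rewrite -(subnK (ltnW id)) dvdn_add.
case/dvdnP: (pd) => d' /[1!mulnC] dE.
have d'0 : (0 < d')%N by case: (d') dE d1 => // ->; rewrite muln0.
have a10 : a 1%N = 0.
  have [d'1|d'1] := ltnP 1 d'.
    have hlt : (1 + p.-1 < d)%N.
      by rewrite add1n prednK // dE -{1}[p]muln1 ltn_pmul2l.
    have hp : (0 < p.-1)%N by rewrite -subn1 subn_gt0.
    have := acoc 1%N p.-1 isT hp hlt.
    rewrite add1n prednK // bin1 (pcharf0 pR) mul0r => h.
    apply: (@natr_cancel 'C(d - 1, p.-1)); last by rewrite mulr0 -h.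
    suff : ~~ (p %| 'C(d - 1, p.-1) * (p.-1)`!)%N.
      by apply: contra => h'; rewrite dvdn_mulr.
    rewrite bin_ffact; have : (p.-1 < p)%N by rewrite prednK.
    elim: {-2}(p.-1) (leqnn p.-1) => [|k ih] hk _; first by rewrite ffactn0 gtnNdvd.
    rewrite ffactnSr Euclid_dvdM // negb_or ih ?(ltnW hk) //=; last first.
      by rewrite (leq_ltn_trans (ltnW hk)) // prednK.
    have -> : (d - 1 - k = p * (d' - 1) + (p - k.+1))%N.
      rewrite dE mulnBr muln1 -subnDA add1n addnBA; last by rewrite -(prednK p0) ltnS ltnW.
      by rewrite subnK // leq_pmulr.
    rewrite dvdn_addr ?dvdn_mulr // gtnNdvd //.
      by rewrite subn_gt0 -(prednK p0) ltnS.
    by rewrite ltn_subrL p0.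
  (* for d = p, a is a multiple of C(p,i)/p, and the sum of ((t+1)^p-t^p-1)/p over
     0 <= t < p is p^(p-1) - 1, which is invertible *)
  have d1' : d' = 1%N by apply/eqP; rewrite eqn_leq d'1 d'0.
  have dp : d = p by rewrite dE d1' muln1.
  pose b i := ('C(p, i) %/ p)%N.
  have bE i : (0 < i < p)%N -> (p * b i = 'C(p, i))%N.
    by move=> hi; rewrite mulnC divnK // prime_dvd_bin.
  have ab i : (0 < i < p)%N -> a i = a 1%N * (b i)%:R.
    move=> hi; have pi : ~~ (p %| i)%N by case/andP: hi => i0 ip; rewrite gtnNdvd.
    apply: (natr_cancel pi); rewrite step dp //.
    rewrite mulrCA -natrM mulrC; congr (_ * _%:R).
    apply/eqP; rewrite -(eqn_pmul2l p0) mulnCA bE //; apply/eqP.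
    by case/andP: hi => i0 _; rewrite mul_bin_diag prednK.
  have ap : a p = 0 by rewrite -dp (asym d) // subnn.
  pose S := (\sum_(t < p) \sum_(i < p | (0 < i)%N) b i * t ^ i)%N.
  have NS : \sum_(t < p) \sum_(i < d.+1) a i * t%:R ^+ i = a 1%N * S%:R.
    rewrite /S natr_sum mulr_sumr; apply: eq_bigr => t _.
    rewrite dp big_ord_recr /= ap mul0r addr0.
    rewrite (bigID (fun i : 'I_p => (0 < i)%N)) /= [X in _ + X]big1 ?addr0; last first.
      by move=> i; rewrite lt0n negbK => /eqP ->; rewrite a0 mul0r.
    rewrite natr_sum mulr_sumr; apply: eq_bigr => i i0.
    by rewrite ab ?i0 ?ltn_ord // natrM natrX mulrA.
  have SE : (S + 1 = p ^ p.-1)%N.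
    apply/eqP; rewrite -(eqn_pmul2l p0) mulnDr muln1 -expnS prednK //; apply/eqP.
    have key (t : nat) : ((t.+1) ^ p = p * (\sum_(i < p | (0 < i)%N) b i * t ^ i) + 1 + t ^ p)%N.
      rewrite -add1n expnDn big_ord_recr /= subnn expn0 mul1n binn mul1n.
      congr (_ + _)%N; rewrite (bigID (fun i : 'I_p => (0 < i)%N)) /=; congr (_ + _)%N.
        rewrite big_distrr /=; apply: eq_bigr => i i0.
        by rewrite exp1n mul1n mulnA bE // i0 ltn_ord.
      rewrite (bigD1 (Ordinal p0)) //= bin0 exp1n expn0 big1 // => i.
      by rewrite -leqNgt leqn0 => /andP[/eqP i0 /eqP[]]; apply: val_inj.
    have sumE k : (p * (\sum_(t < k) \sum_(i < p | (0 < i)%N) b i * t ^ i) + k = k ^ p)%N.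
      elim: k => [|k ih]; first by rewrite big_ord0 muln0 exp0n.
      rewrite big_ord_recr /= mulnDr key -ih.
      by move: (p * _)%N (p * _)%N => x y; lia.
    by rewrite /S sumE.
  move: aN; rewrite NS => hS.
  have : a 1%N * (S + 1)%:R = a 1%N by rewrite natrD mulrDr hS add0r mulr1.
  rewrite SE natrX (pcharf0 pR) expr0n; case: eqP => [e|_]; last by rewrite mulr0.
  by move: p1; rewrite -(prednK p0) e.
have ap i : (i <= d)%N -> ~~ (p %| i)%N -> a i = 0.
  move=> id pi; have i0 : (0 < i)%N by case: (i) pi => //; rewrite dvdn0.
  have {}id : (i < d)%N.
    by rewrite ltn_neqAle id andbT; apply: contraNneq pi => ->.
  by apply: (natr_cancel pi); rewrite mulr0 step ?i0 // a10 mulr0.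
have [d'1|d'1] := leqP d' 1.
  exists 0 => i /andP[i0 id]; rewrite mul0r ap ?(ltnW id) // gtnNdvd //.
  by rewrite (leq_trans id) // dE -{2}[p]muln1 leq_pmul2l.
have [|||||c hc] := IH d' _ (fun i => a (p * i)%N) d'1.
- by rewrite dE -{1}[d']mul1n ltn_pmul2r.
- by move=> i id; rewrite mulnBr -dE asym // dE leq_pmul2l.
- move=> i j i0 j0 ijd.
  have := acoc (p * i)%N (p * j)%N; rewrite !muln_gt0 p0 i0 j0 -mulnDr => /(_ isT isT).
  rewrite dE ltn_pmul2l // => /(_ ijd).
  by rewrite -mulnBr !bin_pmul !dvdn_mulr // !mulKn.
- by rewrite muln0.
- rewrite -[RHS]aN; apply: eq_bigr => t _.
  have tp i : t%:R ^+ (p * i) = t%:R ^+ i :> R.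
    by rewrite exprM -(pFrobenius_autE pR) pFrobenius_aut_nat.
  have -> : \sum_(i < d'.+1) a (p * i)%N * t%:R ^+ i =
            \sum_(i < d'.+1) a (p * i)%N * t%:R ^+ (p * i).
    by apply: eq_bigr => i _; rewrite tp.
  rewrite [RHS](bigID (fun i : 'I_d.+1 => (p %| i)%N)) /= [X in _ = _ + X]big1 ?addr0.
    rewrite (reindex_onto (fun i : 'I_d'.+1 => inord (p * i) : 'I_d.+1)
                          (fun i : 'I_d.+1 => inord (i %/ p))) /=; last first.
      move=> i /dvdnP[k hk].
      have hpk : (p * k < d.+1)%N by rewrite mulnC -hk.
      have hk' : (k < d'.+1)%N by rewrite ltnS -(leq_pmul2l p0) -dE -ltnS.
      apply: val_inj; rewrite /= hk mulnK // (inordK hk') inordK //.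
      exact: mulnC.
    apply: eq_big => [i|i _].
      have hi : (p * i < d.+1)%N by rewrite ltnS dE leq_pmul2l // -ltnS.
      rewrite inordK // dvdn_mulr //= mulKn //; apply/esym/eqP.
      exact: inord_val.
    by rewrite inordK // ltnS dE leq_pmul2l // -ltnS.
  by move=> i pi; rewrite ap ?mul0r // -ltnS.
exists c => i /andP[i0 id]; rewrite dE bin_pmul.
case: ifP => [/dvdnP[k ik]|/negbT pi]; last by rewrite mulr0 ap // ltnW.
move: i0 id; rewrite ik mulnK // mulnC dE ltn_pmul2l // muln_gt0 p0 /= => k0 kd.
by rewrite hc ?k0.
Qed.

End CharP.

(** * Formal groups killed by p are additive *)

Section AdditiveGroup.
Variable R : comNzRingType.

Definition gadd : pseries 2 R := fun m => varx R m + vary R m.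

Lemma psubB k l (f g : pseries k R) (h : 'I_k -> pseries l R) m :
  psub (fun a => f a - g a) h m = psub f h m - psub g h m.
Proof.
have -> : (fun a => f a - g a) = (fun a => f a + -1 * g a).
  by apply: functional_extensionality => a; rewrite mulN1r.
by rewrite psubD psubZ mulN1r.
Qed.

Lemma gadd0 : gadd 0%MM = 0.
Proof. by rewrite /gadd varx0 vary0 addr0. Qed.

Lemma app2_gadd l (a b : pseries l R) : a 0%MM = 0 -> b 0%MM = 0 ->
  app2 gadd a b = fun m => a m + b m.
Proof.
move=> a0 b0; apply: functional_extensionality => m.
by rewrite app2_psub psubD -!app2_psub app2x // app2y.
Qed.

(** Failure of a series f to be a homomorphism from F to the additive group. *)
Definition defect (F : pseries 2 R) (f : pseries 1 R) : pseries 2 R :=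
  fun m => sub1 f F m - (sub1 f (varx R) m + sub1 f (vary R) m).

Lemma app2_defect F f l (u v : pseries l R) m :
  F 0%MM = 0 -> u 0%MM = 0 -> v 0%MM = 0 ->
  app2 (defect F f) u v m = sub1 f (app2 F u v) m - (sub1 f u m + sub1 f v m).
Proof.
move=> F0 u0 v0; rewrite app2_psub psubB psubD -!app2_psub.
by rewrite !sub1_app2 ?varx0 ?vary0 // app2x // app2y.
Qed.

Definition mnm2 i j : 'X_{1..2} := (U_(0%R) *+ i + U_(1%R) *+ j)%MM.

Lemma mnm2_eta (m : 'X_{1..2}) : m = mnm2 (m 0) (m 1).
Proof.
apply/mnmP; apply: ord2_cases; rewrite mnmDE !mulmnE !mnm1E /=; lia.
Qed.

Lemma mdeg_mnm2 i j : mdeg (mnm2 i j) = (i + j)%N.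
Proof. by rewrite mdegD !mdegMn !mdeg1 !mul1n. Qed.

Lemma mnm2_0 i j : mnm2 i j 0 = i.
Proof. by rewrite mnmDE !mulmnE !mnm1E /= mul1n mul0n addn0. Qed.

Lemma mpolyX_mnm2 i j : 'X_[mnm2 i j] = 'X_0 ^+ i * 'X_1 ^+ j :> {mpoly R[2]}.
Proof. by rewrite mpolyXD !mpolyXn. Qed.

Definition homog2 (a : nat -> R) n : {mpoly R[2]} :=
  \sum_(s < n.+1) a s *: ('X_0 ^+ s * 'X_1 ^+ (n - s)).

Lemma homog2_lowdeg a n : lowdeg n (homog2 a n).
Proof.
apply: lowdeg_sum => s _; apply: lowdegZ; rewrite -mpolyX_mnm2.
by have := @lowdegX R 2 (mnm2 s (n - s)); rewrite mdeg_mnm2 subnKC // -ltnS.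
Qed.

Lemma approx_homog2 (C : pseries 2 R) n : (forall m, (mdeg m < n)%N -> C m = 0) ->
  approx n.+1 C (homog2 (fun s => C (mnm2 s (n - s))) n).
Proof.
move=> hC m; rewrite ltnS leq_eqVlt => /orP[/eqP hm|hm]; last first.
  by rewrite hC // (homog2_lowdeg _ hm).
have hm' : (m 0%R + m 1%R = n)%N by rewrite -hm [in RHS](mnm2_eta m) mdeg_mnm2.
have h0 : (m 0%R < n.+1)%N by rewrite ltnS -hm' leq_addr.
rewrite /homog2 raddf_sum (bigD1 (Ordinal h0)) //= mcoeffZ -mpolyX_mnm2 mcoeffX.
have -> : (n - m 0%R)%N = m 1 by rewrite -hm' addKn.
rewrite -mnm2_eta eqxx mulr1 big1 ?addr0 // => s /eqP hs.
rewrite mcoeffZ -mpolyX_mnm2 mcoeffX; case: eqP => [e|]; last by rewrite mulr0.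
by case: hs; apply: val_inj; rewrite /= -e mnm2_0.
Qed.

(** Only the linear parts of u and v contribute to the leading form of C(u,v). *)
Lemma homog_app2 (C : pseries 2 R) n l (u v : pseries l R) (U V : {mpoly R[l]}) :
  (forall m, (mdeg m < n)%N -> C m = 0) -> u 0%MM = 0 -> v 0%MM = 0 ->
  approx 2 u U -> approx 2 v V -> forall m, mdeg m = n ->
  app2 C u v m = (\sum_(s < n.+1) C (mnm2 s (n - s)) *: (U ^+ s * V ^+ (n - s)))@_m.
Proof.
move=> hC u0 v0 hU hV m hm; set a := fun s => C (mnm2 s (n - s)).
have lt (w : pseries l R) d : w 0%MM = 0 -> lowdeg 1 (ptrunc w d).
  by move=> w0; apply: lowdeg1_ptrunc.
pose r := tnth [tuple ptrunc u n.+2; ptrunc v n.+2].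
have hr i : lowdeg 1 (r i) by move: i; apply: ord2_cases; apply: lt.
rewrite app2_psub (@approx_psub R 2 l n.+1 C _ (homog2 a n) r) ?hm //; last first.
- by apply: ord2_cases; apply: approxW (@approx_ptrunc _ _ n.+2 _).
- exact: approx_homog2.
- by apply: ord2_cases.
have -> : \sum_(s < n.+1) a s *: (U ^+ s * V ^+ (n - s)) = homog2 a n \mPo [tuple U; V].
  rewrite /homog2 raddf_sum; apply: eq_bigr => s _ /=.
  by rewrite comp_mpolyZ rmorphM !rmorphXn /= !comp_mpolyXU.
have U1 : lowdeg 1 U by apply: lowdeg1P hU.
have V1 : lowdeg 1 V by apply: lowdeg1P hV.
have key : lowdeg n.+1 ((homog2 a n \mPo [tuple r i | i < 2]) - (homog2 a n \mPo [tuple U; V])).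
  rewrite -addn1; apply: lowdeg_compB; try exact: homog2_lowdeg.
  - by move=> i; rewrite tnth_mktuple.
  - by apply: ord2_cases.
  - by apply: ord2_cases; rewrite tnth_mktuple; [apply: approx_lowdeg hU|apply: approx_lowdeg hV];
      apply: approxW (@approx_ptrunc _ _ n.+2 _).
by apply/eqP; rewrite -subr_eq0 -mcoeffB key ?hm.
Qed.

End AdditiveGroup.

Section FormalGroupLaw.
Variables (R : comNzRingType) (F : pseries 2 R).
Hypothesis FGL : is_formal_group_law F.

Lemma fgl0 : F 0%MM = 0. Proof. by case: FGL. Qed.

Lemma fgl_zero l (u : pseries l R) : u 0%MM = 0 -> app2 F u (pzero l R) = u.
Proof.
have [F0 [hT _] _ _] := FGL; move=> u0.
move: hT; rewrite app2E => /functional_extensionality hT.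
have := congr1 (fun f => sub1 f u) hT; rewrite app2_sub1 ?pT0 //.
by rewrite sub1T // [sub1 (pzero _ _) _]sub1_psub psub_const0.
Qed.

Lemma fgl_comm l (u v : pseries l R) : u 0%MM = 0 -> v 0%MM = 0 ->
  app2 F u v = app2 F v u.
Proof.
have [F0 _ _ hC] := FGL; move=> u0 v0.
move: hC; rewrite app2E => /functional_extensionality hC.
rewrite -{1}hC app2_app2 ?varx0 ?vary0 ?pvar0 //.
by congr app2; [apply: app2y|apply: app2x].
Qed.

Lemma fgl_zerol l (u : pseries l R) : u 0%MM = 0 -> app2 F (pzero l R) u = u.
Proof. by move=> u0; rewrite fgl_comm // fgl_zero. Qed.

Lemma fgl_assoc l (u v w : pseries l R) : u 0%MM = 0 -> v 0%MM = 0 -> w 0%MM = 0 ->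
  app2 F (app2 F u v) w = app2 F u (app2 F v w).
Proof.
have [F0 _ hA _] := FGL; move=> u0 v0 w0.
move: hA; rewrite !app2E => /functional_extensionality hA.
pose r := tnth [tuple u; v; w].
have r0 i : r i 0%MM = 0 by case: i => [[|[|[|//]]] hi].
have e0 : psub (pvar R (0 : 'I_3)) r = u by rewrite psub_var.
have e1 : psub (pvar R (1 : 'I_3)) r = v by rewrite psub_var.
have e2 : psub (pvar R (2 : 'I_3)) r = w by rewrite psub_var.
have := congr1 (fun f => psub f r) hA.
by rewrite !psub_app2 ?app2_0 ?pvar0 // e0 e1 e2.
Qed.

Lemma fgl_linear : F U_(0%R)%MM = 1 /\ F U_(1%R)%MM = 1.
Proof.
have key (u v : pseries 1 R) (U V : {mpoly R[1]}) :
    u 0%MM = 0 -> v 0%MM = 0 -> approx 2 u U -> approx 2 v V ->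
    app2 F u v U_(0%R)%MM =
    F U_(1%R)%MM * V@_U_(0%R)%MM + F U_(0%R)%MM * U@_U_(0%R)%MM.
  move=> u0 v0 hU hV.
  rewrite (@homog_app2 _ F 1 _ u v U V) ?mdeg1 //; last first.
    move=> m; rewrite ltnS leqn0 mdeg_eq0 => /eqP ->; exact: fgl0.
  rewrite !big_ord_recl big_ord0 /= addr0 mcoeffD !mcoeffZ subn0 subnn.
  rewrite !expr0 !expr1 mul1r mulr1 /mnm2 !mulm0n !mulm1n add0m addm0.
  by [].
have T1 : approx 2 (pT R) ('X_0 : {mpoly R[1]}) by apply: approx_pvar.
have Z1 : approx 2 (pzero 1 R) (0 : {mpoly R[1]}) by move=> m _; rewrite mcoeff0.
have pTU : pT R U_(0%R)%MM = 1 by rewrite pTE eqxx.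
split.
- have := key _ _ _ _ (pT0 R) erefl T1 Z1; rewrite fgl_zero ?pT0 // pTU.
  by rewrite mcoeff0 mcoeffXU eqxx mulr0 mulr1 add0r.
- have := key _ _ _ _ erefl (pT0 R) Z1 T1; rewrite fgl_zerol ?pT0 // pTU.
  by rewrite mcoeff0 mcoeffXU eqxx mulr0 mulr1 addr0.
Qed.

End FormalGroupLaw.

Lemma mcoeff_sum (R : comNzRingType) k (I : Type) (r : seq I) (P : pred I)
    (G : I -> {mpoly R[k]}) m :
  (\sum_(i <- r | P i) G i)@_m = \sum_(i <- r | P i) (G i)@_m.
Proof. exact: raddf_sum. Qed.

Lemma sum_ord_single (R : nmodType) n (g : nat -> R) i : (i < n)%N ->
  (forall s, (s < n)%N -> s <> i -> g s = 0) -> \sum_(s < n) g s = g i.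
Proof.
move=> hi h; rewrite (bigD1 (Ordinal hi)) //= big1 ?addr0 // => s /eqP hs.
by apply: h => // e; case: hs; apply: val_inj.
Qed.

Section Logarithm.
Variables (R : comNzRingType) (p : nat).
Hypothesis pR : p \in [pchar R].

Definition mnm3 i j k : 'X_{1..3} :=
  (U_(0%R) *+ i + U_(1%R) *+ j + U_(2%R) *+ k)%MM.

Lemma mdeg_mnm3 i j k : mdeg (mnm3 i j k) = (i + j + k)%N.
Proof. by rewrite !mdegD !mdegMn !mdeg1 !mul1n. Qed.

Lemma mpolyX_mnm3 i j k :
  'X_[mnm3 i j k] = 'X_0 ^+ i * 'X_1 ^+ j * 'X_2 ^+ k :> {mpoly R[3]}.
Proof. by rewrite !mpolyXD !mpolyXn. Qed.

Lemma mnm3_eq i j k i' j' k' :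
  (mnm3 i j k == mnm3 i' j' k') = [&& i == i', j == j' & k == k'].
Proof.
apply/eqP/and3P => [e|[/eqP-> /eqP-> /eqP-> //]].
have E a b c : [/\ mnm3 a b c 0 = a, mnm3 a b c 1 = b & mnm3 a b c 2 = c].
  by split; rewrite !mnmDE !mulmnE !mnm1E /=; lia.
by have [a1 a2 a3] := E i j k; have [b1 b2 b3] := E i' j' k';
  split; apply/eqP; congruence.
Qed.

Lemma coef_xy_z s t i j k : (s + t = i + j + k)%N ->
  ((('X_0 + 'X_1) ^+ s * 'X_2 ^+ t : {mpoly R[3]}))@_(mnm3 i j k) =
  (s == i + j)%N%:R * 'C(s, i)%:R.
Proof.
move=> st; rewrite addrC exprDn mulr_suml raddf_sum /=.
transitivity (\sum_(a < s.+1) ((s - a == j)%N && (a == i :> nat) && (t == k))%:R * 'C(s, a)%:R : R).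
  apply: eq_bigr => a _; rewrite [in LHS]mulrnAl mcoeffMn ['X_1 ^+ _ * _]mulrC -mpolyX_mnm3.
  by rewrite mcoeffX mnm3_eq mulr_natr andbA [(nat_of_ord a == i) && _]andbC.
have [sij|sij] := eqVneq s (i + j)%N.
  have hi : (i < s.+1)%N by rewrite ltnS sij leq_addr.
  rewrite mul1r (bigD1 (Ordinal hi)) //= big1 ?addr0.
    by rewrite eqxx sij addKn eqxx (_ : t == k) ?mul1r //; lia.
  move=> a /eqP ha; have -> : (a == i :> nat) = false.
    by apply/eqP => e; case: ha; apply: val_inj.
  by rewrite andbF mul0r.
rewrite mul0r big1 // => a _; have := ltn_ord a => ha.
by rewrite (_ : _ && _ = false) ?mul0r //; lia.
Qed.

Lemma coef_x_yz s t i j k : (s + t = i + j + k)%N ->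
  (('X_0 ^+ s * ('X_1 + 'X_2) ^+ t : {mpoly R[3]}))@_(mnm3 i j k) =
  (s == i)%N%:R * 'C(t, j)%:R.
Proof.
move=> st; rewrite ['X_1 + _]addrC exprDn mulr_sumr raddf_sum /=.
transitivity (\sum_(a < t.+1) ((s == i)%N && (a == j :> nat) && (t - a == k)%N)%:R * 'C(t, a)%:R : R).
  apply: eq_bigr => a _; rewrite [in LHS]mulrnAr mcoeffMn ['X_2 ^+ _ * _]mulrC mulrA -mpolyX_mnm3.
  by rewrite mcoeffX mnm3_eq mulr_natr andbA.
have [si|si] := eqVneq s i.
  have hj : (j < t.+1)%N by lia.
  rewrite mul1r (bigD1 (Ordinal hj)) //= big1 ?addr0.
    by rewrite eqxx (_ : _ == k) ?mul1r //; lia.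
  move=> a /eqP ha; have -> : (a == j :> nat) = false.
    by apply/eqP => e; case: ha; apply: val_inj.
  by rewrite mul0r.
by rewrite mul0r big1 // => a _; rewrite mul0r.
Qed.

Variable F : pseries 2 R.
Hypothesis FGL : is_formal_group_law F.

(** The iterates m.T of the formal group, m = 0, .., p; the last hypothesis on
    them says that p kills the group. *)
Variable mult : nat -> pseries 1 R.
Hypothesis mult0 : forall m, mult m 0%MM = 0.
Hypothesis mult1 : forall m, cf (mult m) 1 = m%:R.
Hypothesis multS : forall m, mult m.+1 = app2 F (mult m) (pT R).
Hypothesis multp : mult p = mult 0.

Let F0 := fgl0 FGL.

(** The first non-vanishing homogeneous part of the defect of a series is a
    symmetric cocycle of the additive group; it is a coboundary because its sum
    over the multiples of T telescopes to zero. *)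
Lemma defect_coboundary f n : (1 < n)%N -> f 0%MM = 0 ->
  (forall m, (mdeg m < n)%N -> defect F f m = 0) ->
  exists c, forall m, mdeg m = n ->
    defect F f m = c * ((('X_0 + 'X_1) ^+ n - 'X_0 ^+ n - 'X_1 ^+ n) : {mpoly R[2]})@_m.
Proof.
move=> n1 f0; have [C CE] : exists C, C = defect F f by exists (defect F f).
rewrite -CE => hC.
have [a aE] : exists a, forall s, a s = C (mnm2 s (n - s)).
  by exists (fun s => C (mnm2 s (n - s))).
have ex l (u v : pseries l R) U V : u 0%MM = 0 -> v 0%MM = 0 -> approx 2 u U ->
    approx 2 v V -> forall m, mdeg m = n ->
    app2 C u v m = (\sum_(s < n.+1) a s *: (U ^+ s * V ^+ (n - s)))@_m.
  move=> u0 v0 hU hV m hm; rewrite (homog_app2 hC u0 v0 hU hV hm).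
  by under eq_bigr => s _ do rewrite -aE.
have Cdef l (u v : pseries l R) m : u 0%MM = 0 -> v 0%MM = 0 ->
    app2 C u v m = sub1 f (app2 F u v) m - (sub1 f u m + sub1 f v m).
  by rewrite CE => u0 v0; rewrite app2_defect.
have vx k (i : 'I_k) : approx 2 (pvar R i) 'X_i by exact: approx_pvar.
(* commutativity of F makes the leading form symmetric *)
have asym i : (i <= n)%N -> a i = a (n - i)%N.
  move=> hi; have CC : app2 C (vary R) (varx R) = C.
    apply: functional_extensionality => m; rewrite Cdef ?varx0 ?vary0 //.
    by rewrite (fgl_comm FGL) ?varx0 ?vary0 // app2_id [X in _ - X]addrC CE.
  have hm : mdeg (mnm2 i (n - i)) = n by rewrite mdeg_mnm2 subnKC.
  rewrite [LHS]aE -CC (ex _ _ _ 'X_1 'X_0) ?varx0 ?vary0 //; last 2 first.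
  - exact: vx.
  - exact: vx.
  rewrite raddf_sum /=; have hj : (n - i < n.+1)%N by lia.
  rewrite (bigD1 (Ordinal hj)) //= big1 ?addr0.
    by rewrite mcoeffZ ['X_1 ^+ _ * _]mulrC -mpolyX_mnm2 subKn // mcoeffX eqxx mulr1.
  move=> s /eqP hs; rewrite mcoeffZ ['X_1 ^+ _ * _]mulrC -mpolyX_mnm2 mcoeffX.
  case: eqP => [e|]; last by rewrite mulr0.
  case: hs; apply: val_inj => /=.
  by have := congr1 (fun m : 'X_{1..2} => m 0) e; rewrite !mnm2_0; have := ltn_ord s; lia.
(* associativity of F gives the cocycle identity, read off at x^i y^j z^k *)
have acoc i j : (0 < i)%N -> (0 < j)%N -> (i + j < n)%N ->
    'C(i + j, i)%:R * a (i + j)%N = 'C(n - i, j)%:R * a i.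
  move=> i0 j0 ijn; pose k := (n - (i + j))%N.
  have nE : (n = i + j + k)%N by rewrite /k; lia.
  pose x := pvar R (0 : 'I_3); pose y := pvar R (1 : 'I_3); pose z := pvar R (2 : 'I_3).
  have x0 : x 0%MM = 0 by apply: pvar0.
  have y0 : y 0%MM = 0 by apply: pvar0.
  have z0 : z 0%MM = 0 by apply: pvar0.
  have hm : mdeg (mnm3 i j k) = n by rewrite mdeg_mnm3.
  have Fuv0 u v : u 0%MM = 0 -> v 0%MM = 0 -> app2 F u v (0%MM : 'X_{1..3}) = 0.
    exact: app2_0.
  have lin (u v : pseries 3 R) (U V : {mpoly R[3]}) : u 0%MM = 0 -> v 0%MM = 0 ->
      approx 2 u U -> approx 2 v V -> approx 2 (app2 F u v) (U + V).
    move=> u0 v0 hU hV m; rewrite ltnS leq_eqVlt ltnS leqn0 => /orP[] /eqP hd.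
      rewrite (@homog_app2 _ F 1 _ u v U V) //; last first.
        by move=> b; rewrite ltnS leqn0 mdeg_eq0 => /eqP ->.
      have [e0 e1] := fgl_linear FGL.
      rewrite !big_ord_recl big_ord0 /= addr0 [LHS]mcoeffD !mcoeffZ subn0 subnn.
      rewrite !expr0 !expr1 mul1r mulr1 /mnm2 !mulm0n !mulm1n add0m addm0.
      by rewrite e0 e1 !mul1r addrC mcoeffD.
    have -> : m = 0%MM by apply/eqP; rewrite -mdeg_eq0 hd.
    rewrite Fuv0 // mcoeffD -hU ?mdeg0 // -hV ?mdeg0 // u0 v0 addr0.
    by [].
  have E1 := ex _ (app2 F x y) z _ _ (Fuv0 _ _ x0 y0) z0
    (lin _ _ _ _ x0 y0 (vx _ _) (vx _ _)) (vx _ _) _ hm.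
  have E2 := ex _ x (app2 F y z) _ _ x0 (Fuv0 _ _ y0 z0) (vx _ _)
    (lin _ _ _ _ y0 z0 (vx _ _) (vx _ _)) _ hm.
  have E3 := ex _ x y _ _ x0 y0 (vx _ _) (vx _ _) _ hm.
  have E4 := ex _ y z _ _ y0 z0 (vx _ _) (vx _ _) _ hm.
  have coc : app2 C (app2 F x y) z (mnm3 i j k) + app2 C x y (mnm3 i j k) =
             app2 C x (app2 F y z) (mnm3 i j k) + app2 C y z (mnm3 i j k).
    rewrite !Cdef ?Fuv0 // (fgl_assoc FGL) //.
    by move: (sub1 f (app2 F x y) _) (sub1 f (app2 F y z) _) => t1 t2; ring.
  have V3 : app2 C x y (mnm3 i j k) = 0.
    rewrite E3 mcoeff_sum big1 // => s _; rewrite mcoeffZ.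
    rewrite -['X_0 ^+ _ * _]mulr1 -(expr0 'X_2) -mpolyX_mnm3 mcoeffX mnm3_eq.
    by rewrite (_ : [&& _, _ & _] = false) ?mulr0 //; lia.
  have V4 : app2 C y z (mnm3 i j k) = 0.
    rewrite E4 mcoeff_sum big1 // => s _; rewrite mcoeffZ.
    rewrite -['X_1 ^+ _ * _]mul1r -(expr0 'X_0) mulrA -mpolyX_mnm3 mcoeffX mnm3_eq.
    by rewrite (_ : [&& _, _ & _] = false) ?mulr0 //; lia.
  have S1 : app2 C (app2 F x y) z (mnm3 i j k) = 'C(i + j, i)%:R * a (i + j)%N.
    rewrite E1 mcoeff_sum.
    pose g s := (a s *: (('X_0 + 'X_1) ^+ s * 'X_2 ^+ (n - s)) : {mpoly R[3]})@_(mnm3 i j k).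
    rewrite (@sum_ord_single _ _ g (i + j)) /g; first last.
    - move=> s hs sij; rewrite mcoeffZ coef_xy_z; last by lia.
      by case: eqP => // _; rewrite mul0r mulr0.
    - by lia.
    rewrite mcoeffZ coef_xy_z; last by lia.
    by rewrite eqxx mul1r mulrC.
  have S2 : app2 C x (app2 F y z) (mnm3 i j k) = 'C(n - i, j)%:R * a i.
    rewrite E2 mcoeff_sum.
    pose g s := (a s *: ('X_0 ^+ s * ('X_1 + 'X_2) ^+ (n - s)) : {mpoly R[3]})@_(mnm3 i j k).
    rewrite (@sum_ord_single _ _ g i) /g; first last.
    - move=> s hs si; rewrite mcoeffZ coef_x_yz; last by lia.
      by case: eqP => // _; rewrite mul0r mulr0.
    - by lia.
    rewrite mcoeffZ coef_x_yz; last by lia.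
    by rewrite eqxx mul1r mulrC.
  by move: coc; rewrite V3 V4 S1 S2 [LHS]addr0 [RHS]addr0.
have hT : approx 2 (pT R) ('X_0 : {mpoly R[1]}) by apply: vx.
have hn1 : mdeg (U_(0%R) *+ n : 'X_{1..1})%MM = n by rewrite mdegMn mdeg1 mul1n.
have X1n : ('X_0 ^+ n : {mpoly R[1]})@_(U_(0%R) *+ n)%MM = 1.
  by rewrite mcoeffXn1 hn1 eqxx.
have a0 : a 0%N = 0.
  have : app2 C (pzero 1 R) (pT R) (U_(0%R) *+ n)%MM = 0.
    rewrite Cdef ?pT0 // (fgl_zerol FGL) ?pT0 //.
    rewrite -[f in sub1 f (pzero _ _)]ser_cf sub1_coef // big1 ?add0r ?subrr // => i _.
    have -> : ptrunc (pzero 1 R) (mdeg (U_(0%R) *+ n : 'X_{1..1})%MM).+1 = 0.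
      by apply/mpolyP => m; rewrite ptruncE mcoeff0; case: ifP.
    by rewrite expr0n; case: eqP => [-> |]; rewrite ?mcoeff0 ?mulr0 // cf0 f0 mul0r.
  rewrite (ex _ _ _ 0 'X_0) ?pT0 //; last by move=> m _; rewrite mcoeff0.
  rewrite big_ord_recl big1 ?addr0 /=.
    by rewrite expr0 mul1r subn0 mcoeffZ X1n mulr1.
  by move=> s _; rewrite expr0n /= mul0r scaler0.
(* the sum of the defects at (tT, T) is f(pT) - p f(T) = 0 *)
have aN : \sum_(t < p) \sum_(i < n.+1) a i * t%:R ^+ i = 0.
  have e (t : 'I_p) : \sum_(i < n.+1) a i * t%:R ^+ i =
      app2 C (mult t) (pT R) (U_(0%R) *+ n)%MM.
    rewrite (ex _ _ _ (t%:R *: 'X_0) 'X_0) ?pT0 //.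
      rewrite mcoeff_sum; apply: eq_bigr => s _.
      have sn : (s <= n)%N by rewrite -ltnS.
      by rewrite exprZn -scalerAl -exprD subnKC // !mcoeffZ X1n mulr1.
    move=> m; rewrite ltnS leq_eqVlt ltnS leqn0 mcoeffZ => /orP[] /eqP hd.
      by rewrite (mnm_one m) hd mulm1n mcoeffXU eqxx mulr1 -(mult1 t) /cf mulm1n.
    have -> : m = 0%MM by apply/eqP; rewrite -mdeg_eq0 hd.
    by rewrite mult0 mcoeffX mnm1_eq0 mulr0.
  rewrite (eq_bigr _ (fun t _ => e t)).
  under eq_bigr => t _ do rewrite Cdef ?pT0 // -multS opprD addrA.
  rewrite sumrB sumr_const card_ord mulrn_pchar // subr0.
  pose g t := sub1 f (mult t) (U_(0%R) *+ n)%MM.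
  by rewrite -(big_mkord xpredT (fun t => g t.+1 - g t)) telescope_sumr // /g multp subrr.
have [c hc] := symmetric_cocycle pR n1 asym acoc a0 aN.
exists c => m hm; rewrite (mnm2_eta m).
have hm' : (m 0%R + m 1%R = n)%N by rewrite -hm [in RHS](mnm2_eta m) mdeg_mnm2.
move: (m 0%R) (m 1%R) hm' => i j ij {m hm}.
have -> : j = (n - i)%N by lia.
rewrite -aE ['X_0 + 'X_1]addrC !mcoeffB exprDn mcoeff_sum.
have hi : (i < n.+1)%N by lia.
rewrite (bigD1 (Ordinal hi)) //= big1 ?addr0; last first.
  move=> s /eqP hs; rewrite mcoeffMn ['X_1 ^+ _ * _]mulrC -mpolyX_mnm2 mcoeffX.
  case: eqP => [e|]; last by rewrite mul0rn.
  case: hs; apply: val_inj => /=.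
  by have := congr1 (fun m : 'X_{1..2} => m 0) e; rewrite !mnm2_0.
rewrite mcoeffMn ['X_1 ^+ _ * _]mulrC -mpolyX_mnm2 mcoeffX eqxx.
have e0 : ('X_0 ^+ n : {mpoly R[2]}) = 'X_[mnm2 n 0] by rewrite mpolyX_mnm2 expr0 mulr1.
have e1 : ('X_1 ^+ n : {mpoly R[2]}) = 'X_[mnm2 0 n] by rewrite mpolyX_mnm2 expr0 mul1r.
have eqm x y x' y' : (mnm2 x y == mnm2 x' y') = (x == x') && (y == y').
  apply/eqP/andP => [e|[/eqP -> /eqP -> //]].
  have h0 := congr1 (fun m : 'X_{1..2} => m 0) e.
  have h1 := congr1 (@mdeg 2) e.
  by move: h0 h1; rewrite !mnm2_0 !mdeg_mnm2 => -> /addnI ->.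
rewrite e0 e1 !mcoeffX !eqm.
have [i0|i0] := posnP i.
  rewrite i0 a0 bin0 subn0 !eqxx /= (_ : n == 0%N = false) ?subr0 ?subrr ?mulr0 //; lia.
have [ni|ni] := eqVneq i n.
  rewrite ni asym // subnn a0 binn eqxx /= (_ : 0%N == n = false) ?subr0 ?subrr ?mulr0 //; lia.
rewrite hc ?i0; last lia.
rewrite (_ : 0%N == i = false) /= ?subr0 //; lia.
Qed.

Lemma lowdeg_expB k (u v : {mpoly R[k]}) n :
  lowdeg 1 u -> lowdeg 1 v -> lowdeg 2 (u - v) -> lowdeg n.+1 (u ^+ n - v ^+ n).
Proof.
move=> hu hv huv; elim: n => [|n ih]; first by rewrite !expr0 subrr; apply: lowdeg_zero.
have -> : u ^+ n.+1 - v ^+ n.+1 = (u - v) * u ^+ n + v * (u ^+ n - v ^+ n).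
  by rewrite !exprS; ring.
apply: lowdegD; last by rewrite -[n.+2]add1n; apply: lowdegM.
by rewrite -[n.+2]add2n; apply: lowdegM => //; have := lowdeg_exp (e := n) hu; rewrite mul1n.
Qed.

Lemma fgl_approx2 : approx 2 F ('X_0 + 'X_1).
Proof.
have [e0 e1] := fgl_linear FGL.
move=> m; rewrite ltnS leq_eqVlt ltnS leqn0 => /orP[|].
  case/mdeg1P => i /eqP ->; rewrite mcoeffD !mcoeffXU.
  by move: i; apply: ord2_cases; rewrite /= ?e0 ?e1 ?addr0 ?add0r.
by rewrite mdeg_eq0 => /eqP ->; rewrite F0 mcoeffD !mcoeffX !mnm1_eq0 addr0.
Qed.

(** The logarithm, constructed degree by degree: adding c T^n to f changes the
    part of degree n of its defect by c ((X+Y)^n - X^n - Y^n), so the coboundary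
    found there can be removed. *)
Lemma additive_coordinate :
  exists f, [/\ cf f 1 = 1 & is_group_hom F (gadd R) f].
Proof.
pose P n (b : nat -> R) := [/\ n = 0%N -> b 0%N = 0, n = 1%N -> b 1%N = 1 &
  forall m, mdeg m = n -> defect F (ser b) m = 0].
have defE b m : defect F (ser b) m =
    \sum_(i < (mdeg m).+1) b i * ((ptrunc F (mdeg m).+1 ^+ i)@_m -
      ((ptrunc (varx R) (mdeg m).+1 ^+ i)@_m + (ptrunc (vary R) (mdeg m).+1 ^+ i)@_m)).
  rewrite /defect !sub1_coef ?varx0 ?vary0 // -big_split -sumrB /=.
  by apply: eq_bigr => i _; rewrite mulrBr mulrDr.
have Pext n b b' : (forall i, (i <= n)%N -> b i = b' i) -> P n b -> P n b'.
  move=> e [h0 h1 h]; split; first by move=> n0; rewrite -e ?h0.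
    by move=> n1; rewrite -e ?n1 ?h1.
  move=> m hm; rewrite -(h m hm) !defE; apply: eq_bigr => i _.
  by rewrite e // -ltnS -hm.
have step n b : (forall m, (m < n)%N -> P m b) ->
    exists x, P n (fun i => if i == n then x else b i).
  move=> hb; case: n hb => [|[|n]] hb.
  - exists 0; split=> // m /eqP; rewrite mdeg_eq0 => /eqP ->.
    by rewrite defE mdeg0 big_ord1 mul0r.
  - exists 1; split=> // m hm.
    have [b0 _ _] := hb 0%N isT.
    rewrite defE hm !big_ord_recl big_ord0 /= b0 // mul0r add0r addr0 !expr1 mul1r.
    have /mdeg1P[i /eqP mi] : mdeg m == 1%N by rewrite hm.
    have [e0 e1] := fgl_linear FGL.
    have U01 : (U_(0%R)%MM == U_(1%R)%MM :> 'X_{1..2}) = false.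
      by apply/eqP => /mnmP/(_ 0); rewrite !mnm1E.
    rewrite mi !ptruncE !mdeg1 /=; move: i {mi hm m}.
    by rewrite /varx /vary; apply: ord2_cases;
      rewrite ?e0 ?e1 !pvarE ?eqxx ?[U_(1%R)%MM == _]eq_sym ?U01 ?addr0 ?add0r subrr.
  set N := n.+2 in hb *.
  pose b' i := if i == N then 0 else b i.
  have lo i : (i < N)%N -> b' i = b i by rewrite /b' => /ltn_eqF ->.
  have b'0 : b' 0%N = 0 by rewrite lo //; have [-> ] := hb 0%N isT.
  have hd m : (mdeg m < N)%N -> defect F (ser b') m = 0.
    move=> hm; have [_ _ h] := hb _ hm.
    transitivity (defect F (ser b) m); last exact: h.
    rewrite !defE; apply: eq_bigr => i _; rewrite lo //.
    by apply: leq_trans (ltn_ord i) _.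
  have [||c hc] := @defect_coboundary (ser b') N isT; [by rewrite -cf0 cf_ser|by []|].
  exists (- c); split=> // m hm.
  have -> : defect F (ser (fun i => if i == N then - c else b i)) m =
      defect F (ser b') m - c * (('X_0 + 'X_1) ^+ N - 'X_0 ^+ N - 'X_1 ^+ N)@_m.
    rewrite !defE hm [in RHS]big_ord_recr big_ord_recr /= /b' eqxx mul0r addr0.
    congr (_ + _); first by apply: eq_bigr => i _; rewrite /= ltn_eqF // ltn_ord.
    rewrite mulNr; congr (- (c * _)).
    have key (u : pseries 2 R) U : u 0%MM = 0 -> approx 2 u U ->
        (ptrunc u N.+1 ^+ N)@_m = (U ^+ N)@_m.
      move=> u0 uU; apply/eqP; rewrite -subr_eq0 -mcoeffB; apply/eqP.
      apply: lowdeg_expB; last by rewrite hm.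
      - exact: lowdeg1_ptrunc.
      - exact: lowdeg1P uU.
      - by apply: approx_lowdeg uU; apply: approxW (@approx_ptrunc _ _ N.+1 _).
    rewrite (key F ('X_0 + 'X_1)) // ?(key (varx R) 'X_0) ?(key (vary R) 'X_1) //.
    - by rewrite !mcoeffB opprD addrA.
    - exact: vary0.
    - exact: approx_pvar.
    - exact: varx0.
    - exact: approx_pvar.
    - exact: fgl_approx2.
  by rewrite hc // subrr.
have [b hb] := sequence_choice 0 Pext step.
exists (ser b); split; first by rewrite cf_ser; have [_ ->] := hb 1%N.
apply/group_homE; split; first by rewrite -cf0 cf_ser; have [->] := hb 0%N.
have f0 : ser b 0%MM = 0 by rewrite -cf0 cf_ser; have [->] := hb 0%N.
rewrite app2_gadd ?sub1_0 ?varx0 ?vary0 //.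
apply: functional_extensionality => m; apply/eqP; rewrite -subr_eq0.
by have [_ _ h] := hb (mdeg m); have := h m erefl; rewrite /defect => ->.
Qed.

End Logarithm.

(** * Additive series and twisted power series *)

Section Frobenius.
Variables (S : comNzRingType) (p m : nat).
Hypothesis pS : p \in [pchar S].

Lemma frobeniusD (x y : S) : (x + y) ^+ (p ^ m) = x ^+ (p ^ m) + y ^+ (p ^ m).
Proof. by apply: exprDn_pchar; rewrite pnatX pnatE ?pS // (pcharf_prime pS). Qed.

Lemma frobenius0 : (0 : S) ^+ (p ^ m) = 0.
Proof. by rewrite expr0n expn_eq0 gtn_eqF ?(prime_gt0 (pcharf_prime pS)). Qed.

Lemma frobeniusN (x : S) : (- x) ^+ (p ^ m) = - x ^+ (p ^ m).
Proof.
apply/eqP; rewrite -subr_eq0 opprK -frobeniusD addNr; apply/eqP.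
exact: frobenius0.
Qed.

Lemma frobeniusB (x y : S) : (x - y) ^+ (p ^ m) = x ^+ (p ^ m) - y ^+ (p ^ m).
Proof. by rewrite frobeniusD frobeniusN. Qed.

Lemma frobenius_sum (I : Type) (r : seq I) (P : pred I) (F : I -> S) :
  (\sum_(i <- r | P i) F i) ^+ (p ^ m) = \sum_(i <- r | P i) F i ^+ (p ^ m).
Proof.
by apply: (big_morph (fun x => x ^+ (p ^ m)) frobeniusD); exact: frobenius0.
Qed.

End Frobenius.

Lemma pchar_mpoly (R : comNzRingType) k p :
  p \in [pchar R] -> p \in [pchar {mpoly R[k]}].
Proof.
move=> pR; rewrite inE /= (pcharf_prime pR) /=.
by rewrite -mpolyC_nat (pcharf0 pR) mpolyC0.
Qed.

Lemma pchar_rmorph (A R : comNzRingType) (s : {rmorphism A -> R}) p :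
  p \in [pchar A] -> p \in [pchar R].
Proof.
move=> pA; rewrite inE /= (pcharf_prime pA) /= -(rmorph_nat s) (pcharf0 pA).
by rewrite rmorph0.
Qed.

(** Product of twisted power series in one variable t with t c = c ^ q t. *)
Definition tmul (R : comNzRingType) (q : nat) (a b : nat -> R) : nat -> R :=
  fun k => \sum_(i < k.+1) a i * b (k - i)%N ^+ (q ^ i).

(** The series sum_j c_j T^(q^j). *)
Definition aser (R : comNzRingType) (q : nat) (c : nat -> R) : pseries 1 R :=
  ser (fun d => \sum_(j < d.+1) c j *+ (d == q ^ j)%N).

Definition tconst (R : comNzRingType) (z : R) : nat -> R := fun j => z *+ (j == 0%N).

Section Twisted.
Variables (R : comNzRingType) (p e : nat).
Hypotheses (pR : p \in [pchar R]) (e0 : (0 < e)%N).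
Let q := (p ^ e)%N.
Implicit Types a b c : nat -> R.

Lemma qX i : (q ^ i = p ^ (e * i))%N. Proof. by rewrite /q expnM. Qed.

Lemma q_gt1 : (1 < q)%N.
Proof. by rewrite /q -(expn0 p) ltn_exp2l // (prime_gt1 (pcharf_prime pR)). Qed.

Lemma qX_inj : injective (expn q).
Proof. by move=> i j; apply: expnI; exact: q_gt1. Qed.

Lemma ltn_qX i : (i < q ^ i)%N. Proof. exact: ltn_expl q_gt1. Qed.

Lemma aser_coef c d : cf (aser q c) d = \sum_(j < d.+1) c j *+ (d == q ^ j)%N.
Proof. by rewrite /aser cf_ser. Qed.

Lemma aser_qX c i : cf (aser q c) (q ^ i) = c i.
Proof.
rewrite aser_coef (@sum_ord_single _ _ (fun j => c j *+ (q ^ i == q ^ j)%N) i).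
- by rewrite eqxx.
- by rewrite ltnS ltnW // ltn_qX.
- by move=> j _ ji; rewrite (inj_eq qX_inj) eq_sym; case: eqP ji.
Qed.

Lemma aser_nqX c d : (forall i, d <> q ^ i)%N -> cf (aser q c) d = 0.
Proof.
move=> h; rewrite aser_coef big1 // => j _.
by case: eqP => [/h|].
Qed.

Lemma aser_inj a b : aser q a = aser q b -> a = b.
Proof.
move=> h; apply: functional_extensionality => i.
by rewrite -(aser_qX a) h aser_qX.
Qed.

Lemma aser0 c : aser q c 0%MM = 0.
Proof.
rewrite -cf0 aser_nqX // => i /esym/eqP.
by rewrite expn_eq0 gtn_eqF // (ltn_trans _ q_gt1).
Qed.

Lemma aser1 c : cf (aser q c) 1 = c 0%N.
Proof. by rewrite -(expn0 q) aser_qX. Qed.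

Lemma aser_ext f c : (forall i, cf f (q ^ i) = c i) ->
  (forall d, (forall i, d <> q ^ i)%N -> cf f d = 0) -> f = aser q c.
Proof.
move=> h1 h2; apply: cf_inj => d.
case: (classic (exists i, d = q ^ i)%N) => [[i ->]|h]; first by rewrite h1 aser_qX.
have h' i : (d <> q ^ i)%N by move=> di; apply: h; exists i.
by rewrite h2 // aser_nqX.
Qed.

Definition aserpoly k c d (u : {mpoly R[k]}) : {mpoly R[k]} :=
  \sum_(j < d) c j *: u ^+ (q ^ j).

Lemma approx_aser c d : approx d (aser q c) (aserpoly c d 'X_0).
Proof.
move=> m hm; rewrite mcoeff_sum {1}(mnm_one m) -/(cf _ _).
under eq_bigr => j _ do rewrite mcoeffZ mcoeffXn1.
case: (classic (exists i, mdeg m = q ^ i)%N) => [[i mi]|h].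
  rewrite mi aser_qX (@sum_ord_single _ _ (fun j => c j * (q ^ i == q ^ j)%N%:R) i).
  - by rewrite eqxx mulr1.
  - by rewrite (leq_trans (ltn_qX i)) // -mi ltnW.
  - by move=> j _ ji; rewrite (inj_eq qX_inj) eq_sym; case: eqP ji => //; rewrite mulr0.
have h' i : (mdeg m <> q ^ i)%N by move=> di; apply: h; exists i.
by rewrite aser_nqX // big1 // => j _; case: eqP => [/h'|]; rewrite // mulr0.
Qed.

Lemma approx_sub1_aser l c (g : pseries l R) d u : g 0%MM = 0 -> approx d g u ->
  approx d (sub1 (aser q c) g) (aserpoly c d u).
Proof.
case: d => [//|d] g0 gu; rewrite sub1_psub.
have -> : aserpoly c d.+1 u = aserpoly c d.+1 'X_0 \mPo [tuple u | i < 1].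
  rewrite /aserpoly raddf_sum; apply: eq_bigr => i _ /=.
  by rewrite comp_mpolyZ rmorphXn /= comp_mpolyXU -tnth_nth tnth_mktuple.
apply: approx_psub => //; last exact: approx_aser.
by move=> _; apply: lowdeg1P gu.
Qed.

Lemma aser_add l c (u v : pseries l R) : u 0%MM = 0 -> v 0%MM = 0 ->
  sub1 (aser q c) (fun m => u m + v m) =
  fun m => sub1 (aser q c) u m + sub1 (aser q c) v m.
Proof.
move=> u0 v0; apply: approx_unique => d.
have hu := @approx_ptrunc _ _ d u; have hv := @approx_ptrunc _ _ d v.
exists (aserpoly c d (ptrunc u d + ptrunc v d)).
  by apply: approx_sub1_aser; [rewrite u0 v0 addr0|apply: approxD].
rewrite (_ : aserpoly c d _ = aserpoly c d (ptrunc u d) + aserpoly c d (ptrunc v d)).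
  by apply: approxD; apply: approx_sub1_aser.
rewrite /aserpoly -[RHS]big_split; apply: eq_bigr => j _ /=.
by rewrite qX (frobeniusD _ (pchar_mpoly l pR)) scalerDr.
Qed.

Lemma aser_hom c : is_group_hom (gadd R) (gadd R) (aser q c).
Proof.
apply/group_homE; split; first exact: aser0.
rewrite /gadd aser_add ?varx0 ?vary0 // -/(gadd R) app2_gadd //.
  by apply: sub1_0; [exact: aser0|exact: varx0].
by apply: sub1_0; [exact: aser0|exact: vary0].
Qed.

Lemma sub1_aser a b : sub1 (aser q a) (aser q b) = aser q (tmul q a b).
Proof.
apply: approx_unique => d; exists (aserpoly (tmul q a b) d 'X_0); last exact: approx_aser.
have hab := approx_sub1_aser a (aser0 b) (@approx_aser b d).
apply: (approx_lowdegl hab).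
pose h i j : {mpoly R[1]} := (a i * b j ^+ (q ^ i)) *: 'X_0 ^+ (q ^ (i + j)).
have -> : aserpoly a d (aserpoly b d 'X_0) = \sum_(i < d) \sum_(j < d) h i j.
  rewrite [LHS]/aserpoly; apply: eq_bigr => i _; rewrite {1}qX /aserpoly (frobenius_sum _ (pchar_mpoly 1 pR)) scaler_sumr.
  apply: eq_bigr => j _; rewrite exprZn scalerA -!qX -exprM -expnD /h.
  by rewrite addnC.
have -> : aserpoly (tmul q a b) d 'X_0 = \sum_(i < d) \sum_(j < d | (i + j < d)%N) h i j.
  transitivity (\sum_(k < d) \sum_(i < d | (i <= k)%N) h i (k - i)%N).
    rewrite [LHS]/aserpoly; apply: eq_bigr => k _; rewrite /tmul scaler_suml.
    rewrite (big_ord_widen d (fun i => (a i * b (k - i)%N ^+ (q ^ i)) *: 'X_0 ^+ (q ^ k)) (ltn_ord k)).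
    by apply: eq_bigr => i; rewrite ltnS => ik; rewrite /h subnKC.
  rewrite (exchange_big_dep xpredT) //=; apply: eq_bigr => i _.
  rewrite -(big_mkord (fun k => (i <= k)%N) (fun k => h i (k - i)%N)).
  rewrite -(big_mkord (fun j => (i + j < d)%N) (fun j => h i j)).
  rewrite (big_cat_nat (n := i)) ?leq0n ?(ltnW (ltn_ord i)) //= big_nat_cond big1 ?add0r; last first.
    by move=> k /andP[/andP[_ h1] h2]; move: h1; rewrite ltnNge h2.
  rewrite [RHS](big_cat_nat (n := (d - i)%N)) ?leq0n ?leq_subr //=.
  rewrite [X in _ = _ + X]big_nat_cond [X in _ = _ + X]big1 ?addr0; last first.
    by move=> k; lia.
  rewrite big_nat_cond -{1}[nat_of_ord i]add0n big_addn.
  rewrite [RHS]big_nat_cond; apply: eq_big => [k|k _]; first by lia.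
  by rewrite addnK.
rewrite -sumrB; apply: lowdeg_sum => i _.
rewrite [X in X - _](bigID (fun j : 'I_d => (i + j < d)%N)) /= addrAC subrr add0r.
apply: lowdeg_sum => j; rewrite -leqNgt => hij; apply: lowdegZ.
rewrite mpolyXn; apply: (lowdegW _ (@lowdegX R 1 _)).
by rewrite mdegMn mdeg1 mul1n (leq_trans hij) // ltnW // ltn_qX.
Qed.

Lemma tmulA a b c : tmul q a (tmul q b c) = tmul q (tmul q a b) c.
Proof. by apply: aser_inj; rewrite -!sub1_aser sub1_sub1 ?aser0. Qed.

Lemma tmulDr a b c : tmul q a (fun i => b i + c i) = fun i => tmul q a b i + tmul q a c i.
Proof.
apply: functional_extensionality => k; rewrite /tmul -big_split; apply: eq_bigr => i _.
by rewrite /= qX (frobeniusD _ pR) mulrDr.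
Qed.

Lemma tmulDl a b c : tmul q (fun i => a i + b i) c = fun i => tmul q a c i + tmul q b c i.
Proof.
apply: functional_extensionality => k; rewrite /tmul -big_split; apply: eq_bigr => i _.
by rewrite mulrDl.
Qed.

Lemma tmulBr a b c : tmul q a (fun i => b i - c i) = fun i => tmul q a b i - tmul q a c i.
Proof.
apply: functional_extensionality => k; rewrite /tmul -sumrB; apply: eq_bigr => i _.
by rewrite /= qX (frobeniusB _ pR) mulrBr.
Qed.

Lemma tmulBl a b c : tmul q (fun i => a i - b i) c = fun i => tmul q a c i - tmul q b c i.
Proof.
apply: functional_extensionality => k; rewrite /tmul -sumrB; apply: eq_bigr => i _.
by rewrite mulrBl.
Qed.

Lemma tmul_constl z a : tmul q (tconst z) a = fun i => z * a i.
Proof.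
apply: functional_extensionality => k; rewrite /tmul big_ord_recl big1 ?addr0.
  by rewrite /tconst /= mulr1n expn0 expr1 subn0.
by move=> i _; rewrite /tconst /= mulr0n mul0r.
Qed.

Lemma tmul_constr z a : tmul q a (tconst z) = fun i => a i * z ^+ (q ^ i).
Proof.
apply: functional_extensionality => k; rewrite /tmul big_ord_recr big1 ?add0r /=.
  by rewrite subnn /tconst eqxx mulr1n add0r.
move=> i _; rewrite /tconst /= subn_eq0 leqNgt ltn_ord mulr0n qX.
by rewrite (frobenius0 _ pR) mulr0.
Qed.

Lemma aser_const1 : aser q (tconst 1) = pT R.
Proof.
apply/esym/aser_ext => [i|d hd]; rewrite /cf pTE /tconst.
  have -> : ((U_(0%R) *+ q ^ i)%MM == U_(0%R)%MM :> 'X_{1..1}) = (i == 0%N).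
    apply/eqP/eqP => [/(congr1 (@mdeg 1))|-> //].
    by rewrite mdegMn mdeg1 mul1n -(expn0 q) => /qX_inj.
  by [].
case: eqP => // /(congr1 (@mdeg 1)); rewrite mdegMn mdeg1 mul1n => d1.
by case: (hd 0%N); rewrite expn0.
Qed.

Lemma tmul1l a : tmul q (tconst 1) a = a.
Proof. by rewrite tmul_constl; apply: functional_extensionality => i; rewrite mul1r. Qed.

Lemma tmul1r a : tmul q a (tconst 1) = a.
Proof.
by rewrite tmul_constr; apply: functional_extensionality => i; rewrite expr1n mulr1.
Qed.

Lemma tmul_head a b : tmul q a b 0 = a 0%N * b 0%N.
Proof. by rewrite /tmul big_ord1 expn0 expr1. Qed.

End Twisted.

(** * Linearising the action of the constants *)

Section ScaleVariable.
Variable R : comNzRingType.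

Definition scT (z : R) : pseries 1 R := fun m => z * pT R m.

Lemma scT0 z : scT z 0%MM = 0.
Proof. by rewrite /scT pT0 mulr0. Qed.

Lemma sub1_scT l z (g : pseries l R) : g 0%MM = 0 -> sub1 (scT z) g = fun m => z * g m.
Proof.
move=> g0; apply: functional_extensionality => m.
by rewrite sub1_psub psubZ -sub1_psub sub1T.
Qed.

Lemma psub_sum (I : Type) (r : seq I) (P : pred I) (c : I -> R) l n
    (g : I -> pseries n R) (h : 'I_n -> pseries l R) m :
  psub (fun a => \sum_(i <- r | P i) c i * g i a) h m =
  \sum_(i <- r | P i) c i * psub (g i) h m.
Proof.
elim: r => [|i r ih].
  have -> : (fun a => \sum_(i <- [::] | P i) c i * g i a) = pzero n R.
    by apply: functional_extensionality => a; rewrite big_nil.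
  by rewrite psub_const0 big_nil.
rewrite big_cons -ih -psubZ -psubD; case: ifP => hi; congr (psub _ _ m);
  by apply: functional_extensionality => a; rewrite big_cons hi.
Qed.

Lemma cf_sub1_scT f z d : cf (sub1 f (scT z)) d = cf f d * z ^+ d.
Proof.
have az : approx d.+1 (scT z) (z *: 'X_0 : {mpoly R[1]}).
  have aT : approx d.+1 (pT R) ('X_0 : {mpoly R[1]}) by apply: approx_pvar.
  by move=> m hm; rewrite mcoeffZ /scT aT.
rewrite -{1}[f]ser_cf /cf (approx_sub1 _ (scT0 z) az) ?mdegMn ?mdeg1 ?mul1n //.
rewrite mcoeff_sum (@sum_ord_single _ _ (fun i => (cf f i *: (z *: 'X_0) ^+ i)@_ (U_(0%R) *+ d)%MM) d) //.
  by rewrite mcoeffZ exprZn mcoeffZ mcoeffXn1 mdegMn mdeg1 mul1n eqxx mulr1.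
move=> s hs sd; rewrite mcoeffZ exprZn mcoeffZ mcoeffXn1 mdegMn mdeg1 mul1n.
by case: eqP => [ds|]; [case: sd|rewrite !mulr0].
Qed.

Lemma coef_xy j a b :
  ((('X_0 + 'X_1) ^+ j : {mpoly R[2]}))@_(mnm2 a b) = (j == a + b)%N%:R * 'C(j, a)%:R.
Proof.
rewrite addrC exprDn mcoeff_sum.
transitivity (\sum_(i < j.+1) (((nat_of_ord i == a) && (j - i == b))%N)%:R * 'C(j, i)%:R : R).
  apply: eq_bigr => i _; rewrite mcoeffMn ['X_1 ^+ _ * _]mulrC -mpolyX_mnm2 mcoeffX.
  rewrite mulr_natr; congr (_%:R *+ _); congr nat_of_bool.
  apply/eqP/andP => [e|[/eqP -> /eqP -> //]].
  have h0 := congr1 (fun m : 'X_{1..2} => m 0) e.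
  have h1 := congr1 (@mdeg 2) e.
  by move: h0 h1; rewrite !mnm2_0 !mdeg_mnm2 => -> /addnI ->.
have [sij|sij] := eqVneq j (a + b)%N.
  have hi : (a < j.+1)%N by rewrite ltnS sij leq_addr.
  rewrite (@sum_ord_single _ _ (fun i => ((i == a) && (j - i == b))%N%:R * 'C(j, i)%:R) a) //.
    by rewrite eqxx sij addKn eqxx.
  by move=> s _ /eqP/negbTE ->; rewrite mul0r.
rewrite mul0r big1 // => i _; have := ltn_ord i => hi.
by rewrite (_ : _ && _ = false) ?mul0r //; lia.
Qed.

End ScaleVariable.

Section LinearAdditive.
Variables (R : comNzRingType) (p e : nat) (k : finFieldType) (t : {rmorphism k -> R}).
Hypotheses (pR : p \in [pchar R]) (hk : #|k| = (p ^ e)%N).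
Let q := (p ^ e)%N.
Let p_pr : prime p := pcharf_prime pR.

Lemma card_exponent_gt0 : (0 < e)%N.
Proof. by case: e hk => // h; have := card_finNzRing_gt1 k; rewrite h. Qed.

Lemma bin_pX a j : ('C(p ^ j * a, p ^ j))%:R = a%:R :> R.
Proof.
elim: j => [|j ih]; first by rewrite expn0 mul1n bin1.
rewrite expnS -mulnA (bin_pmul pR) dvdn_mulr // mulKn //.
exact: prime_gt0.
Qed.

(** If d = p^j m with m > 1 prime to p, then (X+Y)^d contains the term
    m X^(p^j) Y^(d-p^j), which the additivity of f excludes. *)
Lemma additive_coef f d : is_group_hom (gadd R) (gadd R) f ->
  (forall j, d <> p ^ j)%N -> cf f d = 0.
Proof.
case/group_homE => f0 hf hd.
case: (posnP d) => [->|d0]; first by rewrite cf0.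
have [m pm dE] := pfactor_coprime p_pr d0; set j := logn p d in dE.
have pm' : ~~ (p %| m)%N by rewrite -prime_coprime // coprime_sym.
have pj0 : (0 < p ^ j)%N by rewrite expn_gt0 prime_gt0.
have m1 : (1 < m)%N.
  case: m {pm pm'} dE => [|[|//]] dE; first by rewrite dE in d0.
  by case: (hd j); rewrite dE mul1n.
have pd : (p ^ j <= d)%N by rewrite dE leq_pmull // ltnW.
have hm : mdeg (mnm2 (p ^ j) (d - p ^ j)) = d by rewrite mdeg_mnm2 subnKC.
have := congr1 (fun g => g (mnm2 (p ^ j) (d - p ^ j))) hf.
have agadd : approx d.+1 (gadd R) ('X_0 + 'X_1) by apply: approxD; apply: approx_pvar.
have ax : approx d.+1 (varx R) 'X_0 by apply: approx_pvar.
have ay : approx d.+1 (vary R) 'X_1 by apply: approx_pvar.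
rewrite app2_gadd ?sub1_0 ?varx0 ?vary0 // -{1 2 3}[f]ser_cf.
have hlt : (mdeg (mnm2 (p ^ j) (d - p ^ j)) < d.+1)%N by rewrite hm.
rewrite (approx_sub1 (cf f) (gadd0 R) agadd hlt) (approx_sub1 (cf f) (varx0 R) ax hlt).
rewrite (approx_sub1 (cf f) (vary0 R) ay hlt) !mcoeff_sum.
pose g i := (cf f i *: ('X_0 + 'X_1) ^+ i : {mpoly R[2]})@_(mnm2 (p ^ j) (d - p ^ j)).
have gE : \sum_(i < d.+1) g i = g d.
  apply: sum_ord_single => // s _ sd; rewrite /g mcoeffZ coef_xy subnKC //.
  by case: eqP => // _; rewrite mul0r mulr0.
have binE : 'C(d, p ^ j)%:R = m%:R :> R by rewrite dE mulnC bin_pX.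
rewrite gE /g mcoeffZ coef_xy subnKC // eqxx mul1r binE => h.
apply: (natr_cancel pR pm'); rewrite mulr0 mulrC h.
rewrite !big1 ?addr0 // => i _; rewrite mcoeffZ.
  rewrite -['X_1 ^+ i]mul1r -(expr0 'X_0) -mpolyX_mnm2 mcoeffX.
  case: eqP => [em|]; rewrite ?mulr0 //.
  by have := congr1 (fun m : 'X_{1..2} => m 0) em; rewrite !mnm2_0; lia.
rewrite -['X_0 ^+ i]mulr1 -(expr0 'X_1) -mpolyX_mnm2 mcoeffX.
case: eqP => [em|]; rewrite ?mulr0 //.
have h0 := congr1 (fun m : 'X_{1..2} => m 0) em.
have h1 := congr1 (@mdeg 2) em; move: h0 h1.
rewrite !mnm2_0 !mdeg_mnm2 subnKC // addn0 => -> h1.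
by case: (hd j).
Qed.

(** The polynomial T^(p^r) - T has fewer than q roots. *)
Lemma exists_moved r : (0 < r < e)%N -> exists z : k, z ^+ (p ^ r) != z.
Proof.
case/andP => r0 re; apply/existsP; rewrite -[[exists _, _]]negbK; apply/negP.
rewrite negb_exists => /forallP h.
pose P : {poly k} := 'X^(p ^ r) - 'X.
have pr1 : (1 < p ^ r)%N by rewrite -(expn0 p) ltn_exp2l // prime_gt1.
have sP : size P = (p ^ r).+1.
  by rewrite size_polyDl ?size_polyXn // size_polyN size_polyX.
have P0 : P != 0 by rewrite -size_poly_eq0 sP.
have rP : all (root P) (enum k).
  apply/allP => z _; have := h z; rewrite negbK => /eqP hz.
  by rewrite /root !hornerE hz subrr.
have := max_poly_roots P0 rP (enum_uniq k).
rewrite sP -cardE hk ltnS leqNgt ltn_exp2l ?re //; exact: prime_gt1.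
Qed.

(** Additivity leaves only the exponents that are powers of p; commutation with
    the scalars of a field with q elements leaves only the powers of q. *)
Lemma additive_linear_series f : is_group_hom (gadd R) (gadd R) f ->
  (forall z : k, sub1 f (scT (t z)) = sub1 (scT (t z)) f) ->
  f = aser q (fun i => cf f (q ^ i)).
Proof.
move=> hf hz; have e0 := card_exponent_gt0; have f0 := hf.1.
apply: (aser_ext pR e0) => // d hd.
case: (classic (exists j, d = p ^ j)%N) => [[j dj]|h]; last first.
  by apply: additive_coef => // j dj; apply: h; exists j.
have hr : (0 < j %% e < e)%N.
  rewrite ltn_mod e0 andbT lt0n; apply/eqP => /eqP/dvdnP[i ji].
  by apply: (hd i); rewrite dj ji mulnC expnM.
have [z hz'] := exists_moved hr.
have zd : z ^+ d = z ^+ (p ^ (j %% e)).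
  rewrite dj {1}(divn_eq j e) expnD exprM; congr (_ ^+ _).
  elim: (j %/ e)%N => [|i ih]; first by rewrite expr1.
  by rewrite mulSn expnD exprM -hk expf_card.
have := congr1 (fun g => cf g d) (hz z).
rewrite cf_sub1_scT sub1_scT // {2}/cf -/(cf f d) -rmorphXn /= zd mulrC => /eqP.
rewrite -subr_eq0 -mulrBl -rmorphB /=; set w := _ - z => /eqP hw.
have w0 : w != 0 by rewrite subr_eq0.
by rewrite -[cf f d]mul1r -(rmorph1 t) -(mulVf w0) rmorphM -mulrA hw mulr0.
Qed.

End LinearAdditive.

Section TwistedForm.
Variables (A R : comNzRingType) (p e : nat) (k : finFieldType).
Variables (t : {rmorphism k -> A}) (s : {rmorphism A -> R}).
Hypotheses (pA : p \in [pchar A]) (hk : #|k| = (p ^ e)%N).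
Let q := (p ^ e)%N.
Let pR : p \in [pchar R] := pchar_rmorph s pA.
Let e0 : (0 < e)%N := card_exponent_gt0 hk.

Variable X : formal_module A R.
Hypothesis hX : is_formal_module s X.
Let F := fm_add X.
Let FGL : is_formal_group_law F := hX.1.

Lemma act0 a : fm_act X a 0%MM = 0. Proof. by have [_ [h _ _ _ _]] := hX; case: (h a). Qed.

Lemma act_hom a : is_group_hom F F (fm_act X a).
Proof. by have [_ [h _ _ _ _]] := hX. Qed.

Lemma actD a b : fm_act X (a + b) = app2 F (fm_act X a) (fm_act X b).
Proof. by have [_ [_ h _ _ _]] := hX; rewrite -app2E; exact: functional_extensionality (h a b). Qed.

Lemma actM a b : fm_act X (a * b) = sub1 (fm_act X a) (fm_act X b).
Proof. by have [_ [_ _ h _ _]] := hX; rewrite -sub1E; exact: functional_extensionality (h a b). Qed.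

Lemma act1 : fm_act X 1 = pT R.
Proof. by have [_ [_ _ _ h _]] := hX; exact: functional_extensionality h. Qed.

Lemma act_cf1 a : cf (fm_act X a) 1 = s a.
Proof. by have [_ [_ _ _ _ h]] := hX; rewrite -h /cf mulm1n. Qed.

(** Averaging the logarithm over the units of the field of constants makes it
    equivariant; the average has leading coefficient -(q-1) = 1. *)
Lemma linear_coordinate : exists f,
  [/\ cf f 1 = 1, is_group_hom F (gadd R) f &
      forall z, sub1 f (fm_act X (t z)) = sub1 (scT (s (t z))) f].
Proof.
have F0 := fgl0 FGL; have G0 := gadd0 R.
have [||||g [g1 hg]] := @additive_coordinate R p pR F FGL (fun m => fm_act X m%:R).
- by move=> m; apply: act0.
- by move=> m; rewrite act_cf1 rmorph_nat.
- by move=> m; rewrite -[m.+1]addn1 natrD actD act1.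
- by rewrite (pcharf0 pA).
have g0 := hg.1.
pose f : pseries 1 R := fun m =>
  \sum_(z : k | z != 0) - s (t z^-1) * sub1 g (fm_act X (t z)) m.
have fE l (u : pseries l R) m : u 0%MM = 0 ->
    sub1 f u m = \sum_(z : k | z != 0) - s (t z^-1) * sub1 g (sub1 (fm_act X (t z)) u) m.
  move=> u0; rewrite sub1_psub psub_sum; apply: eq_bigr => z _.
  by rewrite -sub1_psub sub1_sub1 ?act0.
have f1 : cf f 1 = 1.
  rewrite /cf /f; transitivity (\sum_(z : k | z != 0) (- 1 : R)).
    apply: eq_bigr => z z0; rewrite -/(cf _ 1) cf1_sub1 ?act0 // g1 mul1r act_cf1.
    by rewrite mulNr -!rmorphM mulVf // !rmorph1.
  rewrite sumr_const; have := cardC1 (0 : k).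
  rewrite hk => ->; apply/eqP; rewrite -(inj_eq (addIr (- 1))) subrr -mulrSr.
  rewrite prednK; last by rewrite expn_gt0 prime_gt0 // (pcharf_prime pA).
  by rewrite mulNrn natrX (pcharf0 pR) expr0n gtn_eqF // oppr0.
have f0 : f 0%MM = 0.
  by rewrite /f big1 // => z _; rewrite sub1_0 ?act0 // mulr0.
have hf : is_group_hom F (gadd R) f.
  apply/group_homE; split=> //; apply: functional_extensionality => m.
  rewrite app2_gadd ?sub1_0 ?varx0 ?vary0 // !fE ?varx0 ?vary0 // -big_split /=.
  apply: eq_bigr => z _; rewrite -mulrDr; congr (_ * _).
  have [_ ->] := (group_homE _ _ _).1 (act_hom (t z)).
  have ax : sub1 (fm_act X (t z)) (varx R) 0%MM = 0 by apply: sub1_0; [apply: act0|apply: varx0].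
  have ay : sub1 (fm_act X (t z)) (vary R) 0%MM = 0 by apply: sub1_0; [apply: act0|apply: vary0].
  rewrite (group_hom_app F0 G0 hg) // app2_gadd //; exact: sub1_0.
exists f; split=> // z; apply: functional_extensionality => m.
rewrite sub1_scT // fE ?act0 //.
have [->|z0] := eqVneq z 0.
  have e00 : sub1 f (fm_act X 0) = fun _ => 0.
    apply: functional_extensionality => a.
    have := congr1 (fun h => h a) (group_hom_app F0 G0 hf (act0 0) (act0 0)).
    rewrite -actD addr0 app2_gadd ?sub1_0 ?act0 // => /eqP.
    by rewrite -subr_eq0 opprD addrA subrr sub0r oppr_eq0 => /eqP.
  by rewrite -fE ?act0 // !rmorph0 mul0r e00.
rewrite /f mulr_sumr (reindex_onto (fun y => y / z) (fun y => y * z)) /=; last first.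
  by move=> y _; rewrite mulfK.
apply: eq_big => [y|y /andP[_ _]].
  by rewrite mulf_eq0 invr_eq0 (negbTE z0) orbF divfK // eqxx andbT.
rewrite -actM -rmorphM divfK // mulrA mulrN -!rmorphM; congr (- s (t _) * _).
by rewrite invfM invrK mulrC.
Qed.

(** In an equivariant logarithm every element of A acts by an additive series
    that commutes with the constants. *)
Theorem twisted_form : exists f (alpha : A -> nat -> R),
  [/\ cf f 1 = 1, is_group_hom F (gadd R) f &
      forall a, sub1 f (fm_act X a) = sub1 (aser q (alpha a)) f] /\
  [/\ forall a, alpha a 0%N = s a,
      forall a b, alpha (a + b) = fun i => alpha a i + alpha b i,
      forall a b, alpha (a * b) = tmul q (alpha a) (alpha b) &
      forall z, alpha (t z) = tconst (s (t z))].
Proof.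
have F0 := fgl0 FGL; have G0 := gadd0 R.
have [f [f1 hf fz]] := linear_coordinate; have f0 := hf.1.
have [||g [g0 _ gf fg]] := @inverse_series R f 1; rewrite ?f1 ?mulr1 //.
have hg := group_hom_inv F0 G0 hf g0 gf fg.
have [B BD] : exists B : A -> pseries 1 R, forall a, B a = sub1 (sub1 f (fm_act X a)) g.
  by exists (fun a => sub1 (sub1 f (fm_act X a)) g).
have fa0 a : sub1 f (fm_act X a) 0%MM = 0 by apply: sub1_0; rewrite ?act0.
have B0 a : B a 0%MM = 0 by rewrite BD; apply: sub1_0.
have BE a : sub1 (B a) f = sub1 f (fm_act X a).
  by rewrite BD sub1_sub1 // gf sub1_id.
have hB a : is_group_hom (gadd R) (gadd R) (B a).
  rewrite BD; exact: (group_hom_comp G0 F0 G0 hg (group_hom_comp F0 F0 G0 (act_hom a) hf)).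
have cancel u v : sub1 u f = sub1 v f -> u = v.
  move=> /(congr1 (fun h => sub1 h g)).
  by rewrite !sub1_sub1 // fg !sub1_id.
have Bz z : B (t z) = scT (s (t z)).
  by apply: cancel; rewrite BE fz.
have BM a b : B (a * b) = sub1 (B a) (B b).
  apply: cancel; rewrite BE actM -sub1_sub1 ?act0 // -[sub1 f (fm_act X a)]BE.
  by rewrite !sub1_sub1 ?act0 // BE.
have BA a : B a = aser q (fun i => cf (B a) (q ^ i)).
  pose st : {rmorphism k -> R} := s \o t.
  apply: (@additive_linear_series R p e k st pR hk (B a) (hB a)) => z.
  by rewrite -[st z]/(s (t z)) -Bz -!BM mulrC.
exists f, (fun a i => cf (B a) (q ^ i)); split; split=> //.
- by move=> a; rewrite -BA BE.
- move=> a; rewrite expn0 BD cf1_sub1 // cf1_sub1 ?act0 // f1 act_cf1 mul1r.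
  suff -> : cf g 1 = 1 by rewrite mulr1.
  have := cf1_sub1 g0 f0; rewrite gf f1 mulr1 => <-.
  by rewrite /cf mulm1n pTE eqxx.
- move=> a b; have -> : B (a + b) = fun m => B a m + B b m.
    apply: cancel; rewrite BE actD (group_hom_app F0 G0 hf) ?act0 //.
    rewrite app2_gadd // -!BE; apply: functional_extensionality => m.
    by rewrite !sub1_psub psubD.
  by [].
- by move=> a b; apply: (aser_inj pR e0); rewrite -(sub1_aser pR e0) -!BA BM.
- move=> z; apply: (aser_inj pR e0); rewrite -BA Bz.
  apply: functional_extensionality => m; rewrite /scT.
  have -> : tconst (s (t z)) = tmul q (tconst (s (t z))) (tconst 1) :> (nat -> R).
    by rewrite (tmul1r e pR).
  rewrite tmul_constl -(aser_const1 pR e0); rewrite [in RHS](mnm_one m) [in LHS](mnm_one m).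
  rewrite -!/(cf _ _) !aser_coef // mulr_sumr; apply: eq_bigr => i _.
  by rewrite mulrnAr.
Qed.

End TwistedForm.

(** * Complete discrete valuation rings and Teichmuller representatives *)

(** Morphism structures can only be attached to a function inside a proof by
    packing them explicitly. *)
Lemma rmorphism_of_laws (A B : nzRingType) (f : A -> B) :
  zmod_morphism f -> monoid_morphism f -> exists g : {rmorphism A -> B}, g =1 f.
Proof.
move=> hz hm.
pose mz := GRing.isZmodMorphism.Build A B f hz.
pose mm := GRing.isMonoidMorphism.Build A B f hm.
pose g : {rmorphism A -> B} := HB.pack f mz mm.
by exists g.
Qed.

Definition pdiv (O : comNzRingType) (pi : O) n (x : O) := exists y, x = pi ^+ n * y.

Section PowerDivisibility.
Variables (O : comNzRingType) (pi : O).

Lemma pdivD n x y : pdiv pi n x -> pdiv pi n y -> pdiv pi n (x + y).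
Proof. by move=> [a ->] [b ->]; exists (a + b); rewrite mulrDr. Qed.

Lemma pdivN n x : pdiv pi n x -> pdiv pi n (- x).
Proof. by move=> [a ->]; exists (- a); rewrite mulrN. Qed.

Lemma pdivB n x y : pdiv pi n x -> pdiv pi n y -> pdiv pi n (x - y).
Proof. by move=> hx hy; apply: pdivD => //; apply: pdivN. Qed.

Lemma pdivW n m x : (m <= n)%N -> pdiv pi n x -> pdiv pi m x.
Proof.
by move=> /subnKC <- [a ->]; exists (pi ^+ (n - m) * a); rewrite exprD mulrA.
Qed.

Lemma pdivMl n x y : pdiv pi n y -> pdiv pi n (x * y).
Proof. by move=> [b ->]; exists (x * b); rewrite mulrCA. Qed.

Lemma pdiv_exp n x : pdiv pi 1 x -> pdiv pi n (x ^+ n).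
Proof. by move=> [a ->]; exists (a ^+ n); rewrite expr1 exprMn. Qed.

End PowerDivisibility.

Section Teichmuller.
Variables (O : comNzRingType) (k : fieldType) (pi : O) (r : {rmorphism O -> k}) (p : nat).
Hypothesis pO : p \in [pchar O].
Hypothesis sep : forall x, (forall n, pdiv pi n x) -> x = 0.
Hypothesis complete : forall x : nat -> O, (forall n, pdiv pi n (x n.+1 - x n)) ->
  exists l, forall n, pdiv pi n (l - x n).
Hypothesis r_surj : forall y, exists x, r x = y.
Hypothesis r_ker : forall x, r x = 0 <-> pdiv pi 1 x.
Hypothesis k_finite : forall y : k, exists2 m, (0 < m)%N & y ^+ (p ^ m) = y.

(** A Teichmuller representative is fixed by some power of the Frobenius. *)
Definition teich_rep (x : O) := exists2 m, (0 < m)%N & x ^+ (p ^ m) = x.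

Lemma iter_fixed (x : O) m n : x ^+ (p ^ m) = x -> x ^+ (p ^ (m * n)) = x.
Proof.
move=> h; elim: n => [|n ih]; first by rewrite muln0 expn0 expr1.
by rewrite mulnS expnD exprM h.
Qed.

Lemma teich_common x y : teich_rep x -> teich_rep y ->
  exists2 m, (0 < m)%N & x ^+ (p ^ m) = x /\ y ^+ (p ^ m) = y.
Proof.
move=> [m m0 hm] [n n0 hn]; exists (m * n)%N; first by rewrite muln_gt0 m0.
by split; [apply: iter_fixed|rewrite mulnC; apply: iter_fixed].
Qed.

Lemma teichB x y : teich_rep x -> teich_rep y -> teich_rep (x - y).
Proof.
move=> hx hy; have [m m0 [ex ey]] := teich_common hx hy.
by exists m => //; rewrite (frobeniusB _ pO) ex ey.
Qed.

Lemma teichM x y : teich_rep x -> teich_rep y -> teich_rep (x * y).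
Proof.
move=> hx hy; have [m m0 [ex ey]] := teich_common hx hy.
by exists m => //; rewrite exprMn ex ey.
Qed.

(** If x is divisible by pi, its Frobenius powers are divisible by every power
    of pi, but some of them are equal to x. *)
Lemma teich_eq0 x : teich_rep x -> r x = 0 -> x = 0.
Proof.
move=> [m m0 hm] /r_ker hx; apply: sep => n.
rewrite -(iter_fixed n hm); apply: pdivW (pdiv_exp _ hx).
have p1 : (1 < p ^ m)%N.
  by rewrite -(expn0 p) ltn_exp2l // (prime_gt1 (pcharf_prime pO)).
by rewrite expnM ltnW // ltn_expl.
Qed.

(** The powers y^(p^(mn)) of a lift y converge when y^(p^m) - y is divisible by
    pi. *)
Lemma teich_exists y : exists2 x, teich_rep x & r x = y.
Proof.
have [m m0 hm] := k_finite y; have [x0 hx0] := r_surj y.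
have p1 : (1 < p ^ m)%N.
  by rewrite -(expn0 p) ltn_exp2l // (prime_gt1 (pcharf_prime pO)).
have hd : pdiv pi 1 (x0 ^+ (p ^ m) - x0).
  by apply/r_ker; rewrite rmorphB rmorphXn /= hx0 hm subrr.
have [n|l hl] := complete (x := fun n => x0 ^+ (p ^ (m * n))).
  rewrite mulnS expnD exprM -(frobeniusB _ pO).
  by apply: pdivW (pdiv_exp _ hd); rewrite expnM ltnW // ltn_expl.
exists l.
  exists m => //; apply/eqP; rewrite -subr_eq0; apply/eqP; apply: sep => n.
  have -> : l ^+ (p ^ m) - l =
      (l - x0 ^+ (p ^ (m * n))) ^+ (p ^ m) - (l - x0 ^+ (p ^ (m * n.+1))).
    rewrite (frobeniusB _ pO) -exprM -expnD addnC -mulnS.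
    by move: (_ ^+ _) (_ ^+ _) => a b; ring.
  apply: pdivB; last by apply: pdivW (hl n.+1).
  by rewrite -(prednK (ltnW p1)) exprS mulrC; apply: pdivMl.
have /r_ker := hl 1%N; rewrite rmorphB rmorphXn /= hx0 muln1 hm => /eqP.
by rewrite subr_eq0 => /eqP.
Qed.

(** In characteristic p the Teichmuller representatives are closed under
    addition as well, hence form a field of representatives. *)
Theorem teichmuller : exists t : {rmorphism k -> O}, forall y, r (t y) = y.
Proof.
have ex y : exists x, teich_rep x /\ r x = y.
  by have [x hx rx] := teich_exists y; exists x.
pose t y := proj1_sig (constructive_indefinite_description _ (ex y)).
have tP y : teich_rep (t y) /\ r (t y) = y.
  exact: (proj2_sig (constructive_indefinite_description _ (ex y))).
have tE x y : teich_rep x -> r x = y -> t y = x.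
  move=> hx rx; apply/eqP; rewrite -subr_eq0; apply/eqP; apply: teich_eq0.
    by apply: teichB => //; case: (tP y).
  by rewrite rmorphB rx (tP y).2 subrr.
have [||g hg] := @rmorphism_of_laws k O t.
- move=> x y; apply: tE; first by apply: teichB; [case: (tP x)|case: (tP y)].
  by rewrite rmorphB !(tP _).2.
- split; first by apply: tE; [exists 1%N; rewrite ?expr1n|rewrite rmorph1].
  move=> x y; apply: tE; first by apply: teichM; [case: (tP x)|case: (tP y)].
  by rewrite rmorphM !(tP _).2.
by exists g => y; rewrite hg (tP y).2.
Qed.

End Teichmuller.

(** The elements of an algebraic extension of a finite field are permuted
    periodically by the Frobenius: only finitely many remainders are available
    for the powers of such an element. *)
Lemma algebraic_frobenius_periodic (k : finFieldType) (K : fieldType)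
    (j : {rmorphism k -> K}) p (y : K) : p \in [pchar K] -> algebraicOver j y ->
  exists2 m, (0 < m)%N & y ^+ (p ^ m) = y.
Proof.
move=> pK [P P0 rP]; pose d := size P.
have red N : y ^+ N = (map_poly j ('X^N %% P)).[y].
  have := congr1 (fun Q => (map_poly j Q).[y]) (divp_eq 'X^N P).
  rewrite rmorphD rmorphM /= map_polyXn hornerD hornerM hornerXn (eqP rP).
  by rewrite mulr0 add0r.
pose f (i : nat) : {ffun 'I_d -> k} := [ffun l : 'I_d => ('X^(p ^ i) %% P)`_l].
have [i1 [i2 [i12 fi]]] : exists i1 i2, (i1 < i2)%N /\ f i1 = f i2.
  pose g (i : 'I_(#|{ffun 'I_d -> k}|).+1) := f i.
  case: (boolP (injectiveb g)) => [/injectiveP/leq_card|].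
    by rewrite card_ord ltnn.
  case/injectivePn => x [x' xx' gx].
  case: (ltngtP x x') => h; first by exists x, x'.
    by exists x', x; split.
  by case/eqP: xx'; apply: val_inj.
have ee : 'X^(p ^ i1) %% P = 'X^(p ^ i2) %% P.
  apply/polyP => l; have [ld|ld] := ltnP l d.
    by have := congr1 (fun h : {ffun 'I_d -> k} => h (Ordinal ld)) fi; rewrite !ffunE.
  by rewrite !nth_default // (leq_trans _ ld) // ltnW // ltn_modp.
exists (i2 - i1)%N; first by rewrite subn_gt0.
have h : (y ^+ (p ^ (i2 - i1)) - y) ^+ (p ^ i1) = 0.
  rewrite (frobeniusB _ pK) -exprM -expnD subnK ?(ltnW i12) //.
  by rewrite !red ee subrr.
by move/eqP: h; rewrite expf_eq0 subr_eq0 => /andP[_ /eqP].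
Qed.

Section IntegerRing.
Variables (K : fieldType) (v : dvaluation K).
Local Notation O := (ring_of_integers v).
Variables (pi : O) (hpi : uniformizer pi).

Lemma int_val_inj : injective (@int_val K v).
Proof. exact: val_inj. Qed.

Lemma int_valM (x y : O) : int_val (x * y) = int_val x * int_val y.
Proof. exact: (rmorphM (val : {rmorphism O -> K})). Qed.

Lemma int_valB (x y : O) : int_val (x - y) = int_val x - int_val y.
Proof. exact: (rmorphB (val : {rmorphism O -> K})). Qed.

Lemma int_valX (x : O) n : int_val (x ^+ n) = int_val x ^+ n.
Proof. exact: (rmorphXn (val : {rmorphism O -> K})). Qed.

Lemma int_val0 : int_val (0 : O) = 0.
Proof. exact: (rmorph0 (val : {rmorphism O -> K})). Qed.

Lemma int_val1 : int_val (1 : O) = 1.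
Proof. exact: (rmorph1 (val : {rmorphism O -> K})). Qed.

Lemma int_dom (x y : O) : x * y = 0 -> x = 0 \/ y = 0.
Proof.
move=> /(congr1 (@int_val K v)); rewrite int_valM int_val0 => /eqP.
rewrite mulf_eq0 => /orP[] /eqP h; [left|right]; apply: int_val_inj;
  by rewrite h int_val0.
Qed.

Lemma dvX x n : x != 0 -> v (x ^+ n) = v x *+ n.
Proof.
move=> x0; elim: n => [|n ih]; first by rewrite expr0 mulr0n dv1.
by rewrite exprS dvM ?expf_neq0 // ih mulrS.
Qed.

Lemma dvV x : x != 0 -> v (x^-1) = - v x.
Proof.
move=> x0; apply/eqP; rewrite -subr_eq0 opprK addrC -dvM ?invr_eq0 //.
by rewrite divff // dv1.
Qed.

Lemma int_dv_ge0 (x : O) : int_val x != 0 -> (0 <= v (int_val x))%R.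
Proof. by move=> x0; have := int_valP x; rewrite /in_mem /= /dvint (negbTE x0). Qed.

Lemma pdiv_val n (x : O) : pdiv pi n x <-> int_val x = 0 \/ (n%:Z <= v (int_val x))%R.
Proof.
have [pi0 vpi] := hpi; split.
  case=> y ->; rewrite int_valM int_valX.
  have [->|y0] := eqVneq (int_val y) 0; first by left; rewrite mulr0.
  right; rewrite dvM ?expf_neq0 // dvX // vpi.
  rewrite (_ : 1 *+ n = n%:Z); last by rewrite -natz.
  by rewrite lerDl int_dv_ge0.
have [x0 _|x0 [/eqP|h]] := eqVneq (int_val x) 0.
- by exists 0; rewrite mulr0; apply: int_val_inj; rewrite int_val0.
- by rewrite (negbTE x0).
have h2 : int_val x / int_val pi ^+ n \in dvint v.
  rewrite /in_mem /= /dvint dvM ?invr_eq0 ?expf_neq0 // dvV ?expf_neq0 //.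
  by rewrite dvX // vpi -[1 *+ n]/(n%:R : int) natz subr_ge0 h orbT.
exists (RingOfIntegers h2); apply: int_val_inj.
by rewrite int_valM int_valX /= mulrC divfK // expf_neq0.
Qed.

Lemma pdiv_sep x : (forall n, pdiv pi n x) -> x = 0.
Proof.
move=> h; apply/eqP; apply/negPn/negP => x0.
have x0' : int_val x != 0.
  by apply: contra x0 => /eqP x0; apply/eqP/int_val_inj; rewrite x0 int_val0.
have /pdiv_val[/eqP|] := h (`|v (int_val x)|%N).+1; first by rewrite (negbTE x0').
by have := int_dv_ge0 x0'; lia.
Qed.

Lemma pdiv_complete : vcomplete v ->
  forall x : nat -> O, (forall n, pdiv pi n (x n.+1 - x n)) ->
  exists l, forall n, pdiv pi n (l - x n).
Proof.
move=> hv x hx.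
have cauchy m n : (m <= n)%N -> pdiv pi m (x n - x m).
  move/subnKC <-; elim: (n - m)%N => [|i ih].
    by rewrite addn0 subrr; exists 0; rewrite mulr0.
  rewrite addnS -[X in X - _](subrK (x (m + i)%N)) -addrA; apply: pdivD => //.
  by apply: pdivW (hx _); rewrite leq_addr.
have [|l hl] := hv (fun n => int_val (x n)).
  move=> N; exists `|N|%N => i j hi hj.
  have /pdiv_val : pdiv pi `|N| (x i - x j).
    rewrite -[x i](subrK (x `|N|%N)) -addrA; apply: pdivD; first exact: cauchy.
    by rewrite -opprB; apply: pdivN; apply: cauchy.
  rewrite int_valB => -[/eqP|h]; first by rewrite subr_eq0 => /eqP; left.
  by right; apply: le_trans h; lia.
have lO : l \in dvint v.
  have [M hM] := hl 0; case: (hM M (leqnn M)) => [<-|]; first exact: int_valP.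
  move=> h; rewrite -[l](subKr (int_val (x M))); apply: rpredB; first exact: int_valP.
  by rewrite /in_mem /= /dvint h orbT.
exists (RingOfIntegers lO) => n; have [M hM] := hl n%:Z.
have -> : RingOfIntegers lO - x n =
    - (x (maxn M n) - RingOfIntegers lO) + (x (maxn M n) - x n) by ring.
apply: pdivD; last by apply: cauchy; rewrite leq_maxr.
apply/pdivN/pdiv_val; rewrite int_valB /=.
case: (hM (maxn M n) (leq_maxl _ _)) => [->|h]; first by left; rewrite subrr.
by right.
Qed.

Variables (k : fieldType) (r : {rmorphism O -> k}).
Hypothesis hr : residue_map r.

Lemma residue_surj y : exists x, r x = y.
Proof. exact: hr.1. Qed.

Lemma residue_ker x : r x = 0 <-> pdiv pi 1 x.
Proof.
rewrite hr.2 pdiv_val; split=> -[->|h]; by [left|right; move: h; lia].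
Qed.

Lemma residue_unit x : r x != 0 -> exists y, x * y = 1.
Proof.
move=> rx; have x0 : int_val x != 0.
  by apply: contra rx => /eqP h; apply/eqP; rewrite hr.2; left.
have vx : v (int_val x) = 0.
  have := int_dv_ge0 x0; rewrite le0r => /orP[/eqP //|h].
  by case/eqP: rx; rewrite hr.2; right.
have h2 : (int_val x)^-1 \in dvint v.
  by rewrite /in_mem /= /dvint dvV // vx oppr0 lexx orbT.
exists (RingOfIntegers h2); apply: int_val_inj.
by rewrite int_valM int_val1 /= divff.
Qed.

End IntegerRing.

(** * Powers of an ideal and successive approximation *)

Section IdealPowers.
Variables (R : comNzRingType) (I : {pred R}).
Hypothesis I0 : 0 \in I.
Hypothesis Ilin : forall a x y, x \in I -> y \in I -> a * x + y \in I.

Local Notation ipow := (ideal_pow I).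

Lemma ipow_full x : ipow 0 x.
Proof.
exists 1%N, (fun=> x), (fun _ _ => 0); split; first by move=> i [m m0]; case: (notF m0).
by rewrite big_ord1 big_ord0 mulr1.
Qed.

Lemma ipow0 k : ipow k 0.
Proof.
by exists 0%N, (fun=> 0), (fun _ _ => 0); split; [move=> [m m0]; case: (notF m0)|rewrite big_ord0].
Qed.

Lemma ipowD k x y : ipow k x -> ipow k y -> ipow k (x + y).
Proof.
move=> [N [a [b [hb ->]]]] [M [c [d [hd ->]]]].
exists (N + M)%N, (fun i => match split i with inl i => a i | inr i => c i end).
exists (fun i j => match split i with inl i => b i j | inr i => d i j end); split.
  by move=> i j; case: (split i) => ?.
rewrite big_split_ord /=; congr (_ + _); apply: eq_bigr => i _.
  by rewrite (unsplitK (inl _ i)).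
by rewrite (unsplitK (inr _ i)).
Qed.

Lemma ipowMl k c x : ipow k x -> ipow k (c * x).
Proof.
move=> [N [a [b [hb ->]]]]; exists N, (fun i => c * a i), b; split=> //.
by rewrite mulr_sumr; apply: eq_bigr => i _; rewrite mulrA.
Qed.

Lemma ipowN k x : ipow k x -> ipow k (- x).
Proof. by rewrite -mulN1r; apply: ipowMl. Qed.

Lemma ipowB k x y : ipow k x -> ipow k y -> ipow k (x - y).
Proof. by move=> hx hy; apply: ipowD => //; apply: ipowN. Qed.

Lemma ipow_sum k (T : Type) (s : seq T) (P : pred T) (F : T -> R) :
  (forall i, P i -> ipow k (F i)) -> ipow k (\sum_(i <- s | P i) F i).
Proof.
move=> h; elim/big_ind: _ => //; first exact: ipow0.
by move=> x y; apply: ipowD.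
Qed.

Lemma ipow_prod k (b : 'I_k -> R) : (forall j, b j \in I) -> ipow k (\prod_j b j).
Proof.
move=> hb; exists 1%N, (fun=> 1), (fun=> b); split=> //.
by rewrite big_ord1 mul1r.
Qed.

Lemma ipowM k l x y : ipow k x -> ipow l y -> ipow (k + l) (x * y).
Proof.
move=> [N [a [b [hb ->]]]] [M [c [d [hd ->]]]].
rewrite mulr_suml; apply: ipow_sum => i _; rewrite -mulrA; apply: ipowMl.
rewrite mulr_sumr; apply: ipow_sum => j _; rewrite mulrCA; apply: ipowMl.
have := @ipow_prod (k + l) (fun h => match split h with inl h => b i h | inr h => d j h end).
rewrite big_split_ord /=.
under eq_bigr => h _ do rewrite (unsplitK (inl _ h)).
under [X in _ * X]eq_bigr => h _ do rewrite (unsplitK (inr _ h)).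
by apply=> h; case: (split h).
Qed.

Lemma ipowMr k c x : ipow k x -> ipow k (x * c).
Proof. by rewrite mulrC; apply: ipowMl. Qed.

Lemma ipow1P x : ipow 1 x <-> x \in I.
Proof.
split; last first.
  by move=> hx; have := @ipow_prod 1 (fun=> x) (fun=> hx); rewrite big_ord1.
move=> [N [a [b [hb ->]]]]; elim/big_ind: _ => //.
  by move=> y z hy hz; rewrite -[y]mul1r; apply: Ilin.
by move=> i _; rewrite big_ord1 -[_ * _]addr0; apply: Ilin.
Qed.

Lemma ipowW k l x : (l <= k)%N -> ipow k x -> ipow l x.
Proof.
move/subnKC <-; move=> [N [a [b [hb ->]]]]; apply: ipow_sum => i _.
rewrite big_split_ord mulrA mulrAC; apply: ipowMl.
by apply: ipow_prod => j.
Qed.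

Lemma ipowX k n x : ipow k x -> ipow (k * n) (x ^+ n).
Proof.
move=> hx; elim: n => [|n ih]; first by rewrite muln0; apply: ipow_full.
by rewrite mulnS exprS; apply: ipowM.
Qed.

Lemma ipowX1 k n x : (0 < n)%N -> ipow k x -> ipow k (x ^+ n).
Proof. by move=> n0 hx; apply: ipowW (ipowX n hx); rewrite leq_pmulr. Qed.

End IdealPowers.

Section NormalForm.
Variables (R : comNzRingType) (I : {pred R}) (p e n : nat).
Hypothesis I0 : 0 \in I.
Hypothesis complete : adic_complete I.
Hypotheses (pR : p \in [pchar R]) (e0 : (0 < e)%N) (n0 : (0 < n)%N).
Let q := (p ^ e)%N.
Let q1 : (1 < q)%N := q_gt1 pR e0.

Local Notation ipow := (ideal_pow I).

(** The twisted polynomial u_0 + u_1 t + .. + u_(n-1) t^(n-1) + t^n. *)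
Definition monic_tw (u : nat -> R) : nat -> R :=
  fun j => if (j < n)%N then u j else (j == n)%:R.

Definition tw_defect (P v u : nat -> R) : nat -> R :=
  fun j => tmul q v P j - tmul q (monic_tw u) v j.

Lemma qX_gt0 i : (0 < q ^ i)%N.
Proof. by rewrite expn_gt0 (ltn_trans _ q1). Qed.

Lemma ipow_frob k i x y : ipow k (x - y) -> ipow k (x ^+ (q ^ i) - y ^+ (q ^ i)).
Proof.
move=> h; rewrite (qX p e i) -(frobeniusB _ pR) -(qX p e i).
by apply: ipowX1; rewrite ?qX_gt0.
Qed.

Section Linearisation.
Variable P : nat -> R.
Hypothesis P_mod : forall j, ipow 1 (P j - (j == n)%:R).

(** To first order, changing v by w and u by d changes the defect by
    w t^n - d: the lower coefficients of both polynomials are small, and the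
    Frobenius makes t^n w negligible. *)
Lemma tw_defect_linear k v u w d : (0 < k)%N ->
  (forall j, ipow 1 (v j - (j == 0%N)%:R)) -> (forall j, (j < n)%N -> ipow 1 (u j)) ->
  (forall j, ipow k (w j)) -> (forall j, ipow k (d j)) ->
  forall j, ipow k.+1 (tw_defect P (fun i => v i + w i) (fun i => u i + d i) j
    - tw_defect P v u j - (if (j < n)%N then - d j else w (j - n)%N)).
Proof.
move=> k0 hv hu hw hd j; pose dd i := if (i < n)%N then d i else 0.
have hdd i : ipow k (dd i) by rewrite /dd; case: ifP => // _; apply: ipow0.
pose Q := monic_tw (fun i => u i + d i).
have QE : Q = fun i => monic_tw u i + dd i.
  by apply: functional_extensionality => i; rewrite /Q /monic_tw /dd; case: ifP; rewrite ?addr0.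
have E : tw_defect P (fun i => v i + w i) (fun i => u i + d i) j - tw_defect P v u j =
    tmul q w P j - tmul q Q w j - tmul q dd v j.
  rewrite /tw_defect -/Q tmulDl (tmulDr e pR) {1}QE tmulDl.
  by move: (tmul q v P j) (tmul q w P j) (tmul q (monic_tw u) v j) => *; ring.
have E1 : ipow k.+1 (tmul q w P j - (if (j < n)%N then 0 else w (j - n)%N)).
  have -> : (if (j < n)%N then 0 else w (j - n)%N) =
      \sum_(i < j.+1) w i * (j - i == n)%N%:R ^+ (q ^ i).
    case: ltnP => hj.
      rewrite big1 // => i _; rewrite (_ : _ == n = false) ?expr0n; last by lia.
      by rewrite gtn_eqF ?qX_gt0 // mulr0.
    rewrite (@sum_ord_single _ _ (fun i => w i * (j - i == n)%N%:R ^+ (q ^ i)) (j - n)%N).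
    - by rewrite subKn // eqxx expr1n mulr1.
    - by rewrite ltnS leq_subr.
    - move=> i ij ine; rewrite (_ : _ == n = false) ?expr0n; last by lia.
      by rewrite gtn_eqF ?qX_gt0 // mulr0.
  rewrite -sumrB; apply: ipow_sum => i _; rewrite -mulrBr -addn1.
  by apply: ipowM => //; apply: ipow_frob.
have E2 : ipow k.+1 (tmul q Q w j).
  apply: ipow_sum => -[[|i] hi] _ /=.
    rewrite expn0 expr1 -add1n; apply: ipowM => //.
    rewrite /Q /monic_tw n0; apply: ipowD; first exact: hu.
    by apply: ipowW (hd _).
  apply: ipowMl; apply: ipowW (ipowX _ (hw _)).
  have : (1 < q ^ i.+1)%N by rewrite (leq_trans q1) // -{1}[q]expn1 leq_exp2l.
  by move: (q ^ i.+1)%N => Q' Q1; rewrite -(prednK k0); nia.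
have E3 : ipow k.+1 (tmul q dd v j - dd j).
  have -> : tmul q dd v j - dd j =
      \sum_(i < j.+1) dd i * (v (j - i)%N ^+ (q ^ i) - (j - i == 0%N)%N%:R ^+ (q ^ i)).
    under eq_bigr => i _ do rewrite mulrBr.
    rewrite sumrB; congr (_ - _).
    rewrite (@sum_ord_single _ _ (fun i => dd i * (j - i == 0%N)%N%:R ^+ (q ^ i)) j) //.
      by rewrite subnn eqxx expr1n mulr1.
    move=> i ij ine; rewrite (_ : _ == 0%N = false) ?expr0n; last by lia.
    by rewrite gtn_eqF ?qX_gt0 // mulr0.
  apply: ipow_sum => i _; rewrite -addn1; apply: ipowM => //.
  exact: ipow_frob.
rewrite E; set t1 := tmul q w P j in E1 *; set t2 := tmul q Q w j in E2 *.
set t3 := tmul q dd v j in E3 *.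
have -> : t1 - t2 - t3 - (if (j < n)%N then - d j else w (j - n)%N) =
   (t1 - (if (j < n)%N then 0 else w (j - n)%N)) - t2 - (t3 - dd j).
  by rewrite /dd; case: ifP => _; ring.
by apply: ipowB => //; apply: ipowB.
Qed.

(** Weierstrass preparation for twisted series. The linearised defect
    w t^n - d is bijective in (w, d), so that Newton's iteration converges from
    v = 1 and u = 0. *)
Theorem normal_form_exists : exists v u : nat -> R,
  [/\ forall j, ipow 1 (v j - (j == 0%N)%:R), forall j, (j < n)%N -> ipow 1 (u j) &
      tmul q v P = tmul q (monic_tw u) v].
Proof.
pose next (s : (nat -> R) * (nat -> R)) : (nat -> R) * (nat -> R) :=
  (fun j => s.1 j + - tw_defect P s.1 s.2 (n + j)%N,
   fun j => s.2 j + (if (j < n)%N then tw_defect P s.1 s.2 j else 0)).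
pose st k := iter k next (fun j : nat => (j == 0%N)%:R, fun _ => 0).
have inv k : [/\ forall j, ipow 1 ((st k).1 j - (j == 0%N)%:R),
    forall j, (j < n)%N -> ipow 1 ((st k).2 j) &
    forall j, ipow k.+1 (tw_defect P (st k).1 (st k).2 j)].
  elim: k => [|k [h1 h2 h3]].
    split=> /=; first by move=> j; rewrite subrr; apply: ipow0.
      by move=> j _; apply: ipow0.
    move=> j; rewrite /tw_defect.
    have -> : (fun j : nat => (j == 0%N)%:R) = tconst (1 : R).
      by apply: functional_extensionality => i; rewrite /tconst.
    rewrite tmul1l (tmul1r e pR) /monic_tw; case: ltnP => hj //.
    by have := P_mod j; rewrite (_ : j == n = false) //; lia.
  have h4 j : ipow k.+1 (- tw_defect P (st k).1 (st k).2 j) by apply: ipowN.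
  have h5 j : ipow k.+1 (if (j < n)%N then tw_defect P (st k).1 (st k).2 j else 0).
    by case: ifP => // _; apply: ipow0.
  split=> [j|j hj|j] /=.
  - by rewrite addrAC; apply: ipowD => //; apply: ipowW (h4 _).
  - by apply: ipowD; [apply: h2|apply: ipowW (h5 _)].
  - have := tw_defect_linear (isT : (0 < k.+1)%N) h1 h2 (fun j => h4 (n + j)%N) h5 j.
    case: ltnP => hj; last by rewrite subnKC // opprK subrK.
    by rewrite opprK subrK.
have stS k : st k.+1 = next (st k) by [].
have [sep lim] := complete.
have [v hv] : exists v : nat -> R, forall j k, ipow k (v j - (st k).1 j).
  apply: (choice (fun j l => forall k, ipow k (l - (st k).1 j))) => j.
  apply: lim => k; rewrite stS /= addrAC subrr add0r; apply: ipowN.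
  by have [_ _ h] := inv k; apply: ipowW (h _).
have [u hu] : exists u : nat -> R, forall j k, ipow k (u j - (st k).2 j).
  apply: (choice (fun j l => forall k, ipow k (l - (st k).2 j))) => j.
  apply: lim => k; rewrite stS /= addrAC subrr add0r.
  have [_ _ h] := inv k; case: ifP => _; last exact: ipow0.
  by apply: ipowW (h _).
exists v, u; split.
- move=> j; rewrite -(subrK ((st 1).1 j) (v j)) -addrA; apply: ipowD => //.
  by have [h _ _] := inv 1%N.
- move=> j hj; rewrite -(subrK ((st 1).2 j) (u j)); apply: ipowD => //.
  by have [_ h _] := inv 1%N; apply: h.
apply: functional_extensionality => j; apply/eqP; rewrite -subr_eq0; apply/eqP.
apply: sep => k; apply: (@ipowW _ _ k.+1); first by [].
have [h1 h2 h3] := inv k.+1.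
have := tw_defect_linear (isT : (0 < k.+1)%N) h1 h2 (hv^~ k.+1) (hu^~ k.+1) j.
have ev : (fun i => (st k.+1).1 i + (v i - (st k.+1).1 i)) = v.
  by apply: functional_extensionality => i; rewrite addrC subrK.
have eu : (fun i => (st k.+1).2 i + (u i - (st k.+1).2 i)) = u.
  by apply: functional_extensionality => i; rewrite addrC subrK.
rewrite ev eu -/(tw_defect P v u j) => h.
set D := tw_defect P v u j in h *.
set D' := tw_defect P _ _ j in h; set c := (if _ then _ else _) in h.
have -> : D = (D - D' - c) + D' + c by ring.
apply: ipowD; first apply: ipowD.
- by apply: ipowW h.
- by apply: ipowW (h3 j).
- by rewrite /c; case: ifP => _ //; apply: ipowN.
Qed.

(** The linearised defect is injective: two solutions that agree modulo I^k
    agree modulo I^(k+1). *)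
Theorem normal_form_unique (v u v' u' : nat -> R) :
  (forall j, ipow 1 (v j - (j == 0%N)%:R)) -> (forall j, (j < n)%N -> ipow 1 (u j)) ->
  (forall j, ipow 1 (v' j - (j == 0%N)%:R)) -> (forall j, (j < n)%N -> ipow 1 (u' j)) ->
  tmul q v P = tmul q (monic_tw u) v -> tmul q v' P = tmul q (monic_tw u') v' ->
  v = v' /\ (forall j, (j < n)%N -> u j = u' j).
Proof.
move=> hv hu hv' hu' E E'; have [sep _] := complete.
pose d j := if (j < n)%N then u' j - u j else 0.
have key k : (forall j, ipow k.+1 (v' j - v j)) /\ (forall j, ipow k.+1 (d j)).
  elim: k => [|k [ih1 ih2]].
    split=> j.
      have -> : v' j - v j = (v' j - (j == 0%N)%:R) - (v j - (j == 0%N)%:R) by ring.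
      exact: ipowB.
    by rewrite /d; case: ifP => hj; [apply: ipowB; auto|apply: ipow0].
  have := tw_defect_linear (isT : (0 < k.+1)%N) hv hu ih1 ih2.
  have ev : (fun i => v i + (v' i - v i)) = v'.
    by apply: functional_extensionality => i; rewrite addrC subrK.
  have eu : monic_tw (fun i => u i + d i) = monic_tw u'.
    apply: functional_extensionality => i; rewrite /monic_tw /d.
    by case: (i < n)%N; rewrite // addrC subrK.
  have E0 j : tw_defect P v u j = 0 by rewrite /tw_defect E subrr.
  have E0' j : tw_defect P (fun i => v i + (v' i - v i)) (fun i => u i + d i) j = 0.
    by rewrite /tw_defect ev eu E' subrr.
  move=> h; split=> j.
    have := h (n + j)%N; rewrite E0 E0' subrr sub0r ltnNge leq_addr /= addKn.
    by move/ipowN; rewrite opprK.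
  have := h j; rewrite E0 E0' subrr sub0r; case: ltnP => hj; first by rewrite opprK.
  by move=> _; rewrite /d ltnNge hj; apply: ipow0.
split=> [|j hj].
  apply: functional_extensionality => j; apply/eqP; rewrite eq_sym -subr_eq0; apply/eqP.
  by apply: sep => k; apply: ipowW (leqnSn k) ((key k).1 j).
apply/eqP; rewrite eq_sym -subr_eq0; apply/eqP; apply: sep => k.
by apply: ipowW (leqnSn k) _; have := (key k).2 j; rewrite /d hj.
Qed.

End Linearisation.

Section Continuity.
Variables (A : comNzRingType) (k : finFieldType) (t : {rmorphism k -> A}) (pi : A).
Variable (s : {rmorphism A -> R}).
Hypothesis hk : #|k| = q.
Hypothesis digits : forall a, exists z b, a = t z + pi * b.
Variables (alpha beta : A -> nat -> R) (v : nat -> R).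
Hypothesis alphaD : forall a b, alpha (a + b) = fun i => alpha a i + alpha b i.
Hypothesis alphaM : forall a b, alpha (a * b) = tmul q (alpha a) (alpha b).
Hypothesis alphat : forall z, alpha (t z) = tconst (s (t z)).
Hypothesis betaD : forall a b, beta (a + b) = fun i => beta a i + beta b i.
Hypothesis betaM : forall a b, beta (a * b) = tmul q (beta a) (beta b).
Hypothesis betat : forall z, beta (t z) = tconst (s (t z)).
Hypothesis beta_pi : ipow 1 (beta pi 0%N).
Hypothesis inter_pi : tmul q v (alpha pi) = tmul q (beta pi) v.

(** Continuity of the action: an intertwiner for the uniformizer is one for all
    scalars. For a = z + pi b the failure at a is beta(pi) times the failure at b;
    hence it is divisible by all powers of beta(pi), and these tend to zero, as
    the constant term of beta(pi) is in I. *)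
Theorem intertwiner a : tmul q v (alpha a) = tmul q (beta a) v.
Proof.
clear n0; pose D a i := tmul q v (alpha a) i - tmul q (beta a) v i.
have step z b : D (t z + pi * b) = tmul q (beta pi) (D b).
  rewrite /D (tmulBr e pR) (tmulA pR e0) -inter_pi -(tmulA pR e0).
  apply: functional_extensionality => i.
  rewrite alphaD betaD (tmulDr e pR) tmulDl alphaM betaM alphat betat.
  rewrite tmul_constr // tmul_constl // -[tmul q (tmul q (beta pi) _) v](tmulA pR e0).
  have zq : s (t z) ^+ (q ^ i) = s (t z).
    rewrite -!rmorphXn /=; congr (s (t _)).
    elim: i => [|i ih]; first by rewrite expn0 expr1.
    have zq1 : z ^+ q = z by rewrite -hk expf_card.
    by rewrite expnS exprM zq1.
  rewrite zq.
  by move: (tmul q v _ i) (tmul q (beta pi) _ i) => x y; ring.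
have small m j : forall a, ipow (m - j) (D a j).
  elim: m j => [|m ih] j {}a; first by rewrite sub0n; apply: ipow_full.
  have [z [b ->]] := digits a; rewrite step; apply: ipow_sum => -[[|i] hi] _ /=.
    rewrite expn0 expr1 subn0; have [jm|jm] := leqP j m.
      by rewrite subSn // -add1n; apply: ipowM.
    by rewrite (_ : _ - _ = 0)%N; [apply: ipow_full|lia].
  apply: ipowMl; apply: ipowX1; first exact: qX_gt0.
  by apply: ipowW (ih _ b); lia.
apply: functional_extensionality => j; apply/eqP; rewrite -subr_eq0; apply/eqP.
apply: (complete.1) => m; have := small (m + j)%N j a.
by rewrite addnK.
Qed.

End Continuity.

End NormalForm.

(** * The action commuting with a given multiplication by the uniformizer *)

Section CommutingFamily.
Variables (A B : comNzRingType) (p e : nat) (k : finFieldType).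
Variables (t : {rmorphism k -> A}) (s : {rmorphism A -> B}) (pi : A).
Hypotheses (pB : p \in [pchar B]) (hk : #|k| = (p ^ e)%N).
Let q := (p ^ e)%N.
Let e0 : (0 < e)%N := card_exponent_gt0 hk.
Hypothesis digits : forall a, exists z b, a = t z + pi * b.
Hypothesis pi_regular : forall x, s pi * x = 0 -> x = 0.
Hypothesis pi_unit : forall m, (0 < m)%N -> exists y, (s pi ^+ m - 1) * y = 1.
Variable U : nat -> B.
Hypothesis U0 : U 0%N = s pi.

Definition commutator (b : nat -> B) : nat -> B := fun i => tmul q b U i - tmul q U b i.

Lemma commutatorB a b :
  commutator (fun i => a i - b i) = fun i => commutator a i - commutator b i.
Proof.
apply: functional_extensionality => i; rewrite /commutator tmulBl (tmulBr e pB).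
by ring.
Qed.

Lemma commutatorD a b :
  commutator (fun i => a i + b i) = fun i => commutator a i + commutator b i.
Proof.
apply: functional_extensionality => i; rewrite /commutator tmulDl (tmulDr e pB).
by ring.
Qed.

Lemma eq_commutator a b j : (forall i, (i <= j)%N -> a i = b i) ->
  commutator a j = commutator b j.
Proof.
move=> h; rewrite /commutator /tmul; congr (_ - _); apply: eq_bigr => i _.
  by rewrite h // -ltnS.
by rewrite h // leq_subr.
Qed.

Lemma tmul_lead_l (a b : nat -> B) j : (forall i, (i < j)%N -> b i = 0) -> tmul q a b j = a 0%N * b j.
Proof.
move=> h; rewrite /tmul big_ord_recl big1 ?addr0 ?expn0 ?expr1 ?subn0 //= => i _.
rewrite h; last by rewrite /bump /=; have := ltn_ord i; lia.
by rewrite (qX p e) (frobenius0 _ pB) mulr0.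
Qed.

Lemma tmul_lead_r (a b : nat -> B) j : (forall i, (i < j)%N -> a i = 0) ->
  tmul q a b j = a j * b 0%N ^+ (q ^ j).
Proof.
move=> h; rewrite /tmul big_ord_recr big1 /= ?add0r ?subnn // => i _.
by rewrite h ?mul0r.
Qed.

Lemma commutator_lead b j : (forall i, (i < j)%N -> b i = 0) ->
  commutator b j = b j * (s pi ^+ (q ^ j) - s pi).
Proof.
by move=> h; rewrite /commutator tmul_lead_r // tmul_lead_l // U0; ring.
Qed.

Lemma lead_factor j : (0 < j)%N -> exists y, (s pi ^+ (q ^ j) - s pi) * y = s pi.
Proof.
move=> j0; have [|y hy] := pi_unit (m := (q ^ j).-1).
  by rewrite -subn1 subn_gt0 -(expn0 q) ltn_exp2l // (q_gt1 pB e0).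
exists y; have -> : s pi ^+ (q ^ j) = s pi * s pi ^+ (q ^ j).-1.
  by rewrite -exprS prednK // expn_gt0 (ltn_trans _ (q_gt1 pB e0)).
by rewrite -[in RHS](mulr1 (s pi)) -hy; ring.
Qed.

(** A series commuting with U below degree j is determined below degree j by
    its constant term, because s pi ^ (q ^ i) - s pi is not a zero divisor. *)
Lemma commuting_unique b j : b 0%N = 0 -> (forall i, (i < j)%N -> commutator b i = 0) ->
  forall i, (i < j)%N -> b i = 0.
Proof.
move=> b0 hb; elim/ltn_ind => -[//|i] ih ij.
have := hb _ ij; rewrite commutator_lead; last first.
  by move=> l li; apply: ih => //; apply: ltn_trans li ij.
move=> h; have [y hy] := lead_factor (ltn0Sn i).
by apply: pi_regular; rewrite -hy mulrC mulrA h mul0r.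
Qed.

Lemma commuting_eq a b : a 0%N = b 0%N -> commutator a =1 (fun=> 0) ->
  commutator b =1 (fun=> 0) -> a = b.
Proof.
move=> h0 ha hb; apply: functional_extensionality => i; apply/eqP; rewrite -subr_eq0.
apply/eqP; apply: (@commuting_unique (fun i => a i - b i) i.+1) => //.
  by rewrite h0 subrr.
by move=> l _; rewrite commutatorB ha hb subrr.
Qed.

Lemma commutator_const z : commutator (tconst (s (t z))) = fun=> 0.
Proof.
apply: functional_extensionality => i.
rewrite /commutator tmul_constl (tmul_constr e pB).
have -> : s (t z) ^+ (q ^ i) = s (t z).
  rewrite -!rmorphXn /=; congr (s (t _)).
  elim: i => [|i ih]; first by rewrite expn0 expr1.
  have zq1 : z ^+ q = z by rewrite /q -hk expf_card.
  by rewrite expnS exprM zq1.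
by rewrite mulrC subrr.
Qed.

Lemma commutator_mulU b : commutator (tmul q U b) = tmul q U (commutator b).
Proof.
apply: functional_extensionality => i.
by rewrite /commutator (tmulBr e pB) !(tmulA pB e0).
Qed.

(** The coefficient in degree j of the series attached to a must be the quotient
    of a commutator by s pi ^ (q ^ j) - s pi; the division is possible since,
    writing a = z + pi b, the commutator attached to b is known below j. *)
Lemma commuting_family_exists : exists c : A -> nat -> B,
  forall a, c a 0%N = s a /\ commutator (c a) =1 (fun=> 0).
Proof.
pose P j (c : nat -> A -> B) := (j = 0%N -> forall a, c 0%N a = s a) /\
  forall a, commutator (fun i => c i a) j = 0.
have Pext n c c' : (forall i, (i <= n)%N -> c i = c' i) -> P n c -> P n c'.
  move=> h [h0 h1]; split=> [n0 a|a]; first by rewrite -h ?h0.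
  by rewrite -(h1 a); apply: eq_commutator => i /h ->.
have com0 b : commutator b 0 = 0.
  by rewrite /commutator !tmul_head mulrC subrr.
have step j c : (forall m, (m < j)%N -> P m c) ->
    exists x, P j (fun i => if i == j then x else c i).
  case: j => [|j] hc; first by exists s.
  pose C a i := if (i < j.+1)%N then c i a else 0.
  have C0 a : C a 0%N = s a by rewrite /C /=; apply: (hc 0%N isT).1.
  have comC a i : (i < j.+1)%N -> commutator (C a) i = 0.
    move=> ij; rewrite -((hc i ij).2 a); apply: eq_commutator => l li.
    by rewrite /C (leq_ltn_trans li ij).
  have dv a : exists y, commutator (C a) j.+1 = s pi * y.
    have [z [b aE]] := digits a.
    pose D i := tconst (s (t z)) i + tmul q U (C b) i.
    have comD : commutator D = tmul q U (commutator (C b)).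
      rewrite /D commutatorD commutator_const commutator_mulU.
      by apply: functional_extensionality => i; rewrite add0r.
    have comD0 i : (i < j.+1)%N -> commutator D i = 0.
      move=> ij; rewrite comD tmul_lead_l ?comC ?mulr0 // => l li.
      by rewrite comC // (ltn_trans li).
    have DC i : (i < j.+1)%N -> D i - C a i = 0.
      apply: (@commuting_unique (fun i => D i - C a i)).
        by rewrite /D tmul_head !C0 U0 aE rmorphD rmorphM /tconst eqxx subrr.
      by move=> l lj; rewrite commutatorB comD0 // comC // subrr.
    have comDj : commutator D j.+1 = s pi * commutator (C b) j.+1.
      by rewrite comD tmul_lead_l ?U0 // => i; apply: comC.
    have comDC : commutator (fun i => D i - C a i) j.+1 =
        (D j.+1 - C a j.+1) * (s pi ^+ (q ^ j.+1) - s pi).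
      exact: commutator_lead.
    have -> : commutator (C a) j.+1 =
        s pi * commutator (C b) j.+1 - commutator (fun i => D i - C a i) j.+1.
      by rewrite commutatorB comDj; ring.
    rewrite comDC; exists (commutator (C b) j.+1 -
      (D j.+1 - C a j.+1) * (s pi ^+ (q ^ j.+1).-1 - 1)).
    have -> : s pi ^+ (q ^ j.+1) = s pi * s pi ^+ (q ^ j.+1).-1.
      by rewrite -exprS prednK // expn_gt0 (ltn_trans _ (q_gt1 pB e0)).
    by ring.
  have [y0 hy0] := lead_factor (ltn0Sn j).
  have [y hy] : exists y : A -> B, forall a, commutator (C a) j.+1 = s pi * y a.
    exact: (choice (fun a y => commutator (C a) j.+1 = s pi * y)).
  exists (fun a => - (y0 * y a)); split=> // a.
  pose x i := if i == j.+1 then - (y0 * y a) else 0.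
  rewrite (@eq_commutator _ (fun i => C a i + x i)); last first.
    move=> i; rewrite leq_eqVlt /C /x => /orP[/eqP ->|ij].
      by rewrite eqxx ltnn add0r.
    by rewrite ij ltn_eqF // addr0.
  rewrite commutatorD hy commutator_lead; last by move=> i ij; rewrite /x ltn_eqF.
  rewrite /x eqxx -[X in X * y a]hy0.
  by move: (s pi ^+ _) => Q; ring.
have [c hc] := sequence_choice (fun _ => 0) Pext step.
exists (fun a i => c i a) => a; split; first by apply: (hc 0%N).1.
by move=> j; apply: (hc j).2.
Qed.

(** The laws hold because both sides commute with U and have the same constant
    term. *)
Theorem commuting_family : exists alpha : A -> nat -> B,
  [/\ forall a, alpha a 0%N = s a,
      forall a b, alpha (a + b) = fun i => alpha a i + alpha b i,
      forall a b, alpha (a * b) = tmul q (alpha a) (alpha b),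
      forall z, alpha (t z) = tconst (s (t z)) & alpha pi = U].
Proof.
have [c hc] := commuting_family_exists.
have c0 a : c a 0%N = s a by case: (hc a).
have comc a : commutator (c a) =1 (fun=> 0) by case: (hc a).
exists c; split=> //.
- move=> a b; apply: commuting_eq => //; first by rewrite !c0 rmorphD.
  by move=> i; rewrite commutatorD !comc addr0.
- move=> a b; apply: commuting_eq => //; first by rewrite tmul_head !c0 rmorphM.
  have cU x : tmul q (c x) U = tmul q U (c x).
    apply: functional_extensionality => i; apply/eqP; rewrite -subr_eq0; apply/eqP.
    exact: comc.
  move=> i; rewrite /commutator -(tmulA pB e0) cU (tmulA pB e0) cU.
  by rewrite -(tmulA pB e0) subrr.
- move=> z; apply: commuting_eq => //.
  by move=> i; rewrite commutator_const.
- apply: commuting_eq => //; first by rewrite c0 U0.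
  by move=> i; rewrite /commutator subrr.
Qed.

End CommutingFamily.

(** * Formal modules in additive form *)

Definition tw_module (A R : comNzRingType) q (alpha : A -> nat -> R) : formal_module A R :=
  FormalModule (gadd R) (fun a => aser q (alpha a)).

Section AdditiveModules.
Variables (A R : comNzRingType) (p e : nat).
Hypotheses (pR : p \in [pchar R]) (e0 : (0 < e)%N).
Let q := (p ^ e)%N.

Lemma gadd_fgl : is_formal_group_law (gadd R).
Proof.
have z0 l : pzero l R 0%MM = 0 by [].
split; first exact: gadd0.
- by split; rewrite app2E app2_gadd ?pT0 // => m; rewrite ?addr0 ?add0r.
- rewrite !app2E => m; rewrite !app2_gadd ?pvar0 ?addrA ?addr0 //.
- by rewrite app2E app2_gadd ?pvar0 // => m; rewrite addrC.
Qed.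

Lemma tw_module_formal (s : {rmorphism A -> R}) (alpha : A -> nat -> R) :
  (forall a, alpha a 0%N = s a) ->
  (forall a b, alpha (a + b) = fun i => alpha a i + alpha b i) ->
  (forall a b, alpha (a * b) = tmul q (alpha a) (alpha b)) ->
  alpha 1 = tconst 1 -> is_formal_module s (tw_module q alpha).
Proof.
move=> h0 hD hM h1; split; first exact: gadd_fgl.
split=> /=.
- by move=> a; apply: aser_hom.
- move=> a b; rewrite app2E app2_gadd ?(aser0 pR e0) // => m.
  rewrite (mnm_one m) -!/(cf _ _) !aser_coef // -big_split /= hD.
  by apply: eq_bigr => i _; rewrite mulrnDl.
- by move=> a b; rewrite sub1E (sub1_aser pR e0) hM.
- by rewrite h1 (aser_const1 pR e0).
- by move=> a; rewrite -h0 -(aser1 pR e0) /cf mulm1n.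
Qed.

Lemma tw_module_map (S : comNzRingType) (phi : {rmorphism R -> S}) (alpha : A -> nat -> R) :
  fm_map phi (tw_module q alpha) = tw_module q (fun a i => phi (alpha a i)).
Proof.
rewrite /fm_map /tw_module /=; congr FormalModule.
  apply: functional_extensionality => m; rewrite /pmap /gadd rmorphD.
  by congr (_ + _); rewrite -[LHS]/(pmap phi _ m) pmap_pvar.
apply: functional_extensionality => a; apply: functional_extensionality => m.
rewrite /pmap /aser /ser rmorph_sum; apply: eq_bigr => i _.
exact: rmorphMn.
Qed.

Lemma pmap_aser (S : comNzRingType) (phi : {rmorphism R -> S}) (c : nat -> R) :
  pmap phi (aser q c) = aser q (fun i => phi (c i)).
Proof.
apply: functional_extensionality => m.
rewrite /pmap /aser /ser rmorph_sum; apply: eq_bigr => i _.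
exact: rmorphMn.
Qed.

Lemma tw_module_hom (alpha beta : A -> nat -> R) v :
  (forall a, tmul q v (alpha a) = tmul q (beta a) v) ->
  is_fm_hom (tw_module q alpha) (tw_module q beta) (aser q v).
Proof.
move=> h; split; first exact: aser_hom.
by move=> a; rewrite !sub1E !(sub1_aser pR e0) h.
Qed.

End AdditiveModules.

Section FormalModuleHom.
Variables (A R : comNzRingType) (s : A -> R).
Implicit Types X Y Z : formal_module A R.

Lemma fm_homE X Y f : is_fm_hom X Y f <-> is_group_hom (fm_add X) (fm_add Y) f /\
  forall a, sub1 f (fm_act X a) = sub1 (fm_act Y a) f.
Proof.
split=> -[h1 h2]; split=> // a; last by rewrite !sub1E h2.
by have := h2 a; rewrite !sub1E => /functional_extensionality.
Qed.

Lemma fm_act0 X a : is_formal_module s X -> fm_act X a 0%MM = 0.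
Proof. by move=> [_ [h _ _ _ _]]; case: (h a). Qed.

Lemma fm_add0 X : is_formal_module s X -> fm_add X 0%MM = 0.
Proof. by case=> [[]]. Qed.

Lemma fm_hom_comp X Y Z f g : is_formal_module s X -> is_formal_module s Y ->
  is_formal_module s Z -> is_fm_hom X Y f -> is_fm_hom Y Z g -> is_fm_hom X Z (sub1 g f).
Proof.
move=> hX hY hZ /fm_homE[f1 f2] /fm_homE[g1 g2]; apply/fm_homE; split.
  exact: (group_hom_comp (fm_add0 hX) (fm_add0 hY) (fm_add0 hZ) f1 g1).
have f0 := f1.1; have g0 := g1.1.
move=> a; have a0 := fm_act0 a hX; have b0 := fm_act0 a hY; have c0 := fm_act0 a hZ.
by rewrite sub1_sub1 // f2 -sub1_sub1 // g2 sub1_sub1.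
Qed.

(** The inverse series of a homomorphism is a homomorphism. *)
Lemma fm_isoP X Y f : is_formal_module s X -> is_formal_module s Y ->
  is_fm_iso X Y f <-> is_fm_hom X Y f /\ exists c, c * cf f 1 = 1.
Proof.
move=> hX hY; split.
  move=> [hf [g [hg fg gf]]]; split=> //; exists (cf g 1).
  have f0 := hf.1.1; have g0 := hg.1.1.
  rewrite -cf1_sub1 // -sub1E (functional_extensionality _ _ gf).
  by rewrite /cf mulm1n pTE eqxx.
move=> [hf [c hc]]; split=> //; have [f1 f2] := (fm_homE _ _ _).1 hf; have f0 := f1.1.
have [g [g0 _ gf fg]] := inverse_series f0 hc.
exists g; split; [apply/fm_homE|by rewrite sub1E fg|by rewrite sub1E gf]; split.
  exact: (group_hom_inv (fm_add0 hX) (fm_add0 hY) f1 g0 gf fg).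
move=> a; have a0 := fm_act0 a hX; have b0 := fm_act0 a hY.
have e1 : sub1 g (sub1 f (sub1 (fm_act X a) g)) = sub1 (fm_act X a) g.
  by rewrite -sub1_sub1 ?sub1_0 // gf sub1T ?sub1_0.
by rewrite -e1 -[sub1 f (sub1 _ g)]sub1_sub1 // f2 sub1_sub1 // fg sub1_id.
Qed.

Lemma fm_iso_comp X Y Z f g : is_formal_module s X -> is_formal_module s Y ->
  is_formal_module s Z -> is_fm_iso X Y f -> is_fm_iso Y Z g -> is_fm_iso X Z (sub1 g f).
Proof.
move=> hX hY hZ /(fm_isoP _ hX hY)[f1 [c hc]] /(fm_isoP _ hY hZ)[g1 [d hd]].
apply/(fm_isoP _ hX hZ); split; first exact: fm_hom_comp f1 g1.
exists (c * d); rewrite cf1_sub1 ?f1.1.1 ?g1.1.1 //.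
have -> : c * d * (cf g 1 * cf f 1) = (c * cf f 1) * (d * cf g 1) by ring.
by rewrite hc hd mulr1.
Qed.

End FormalModuleHom.

(** * The special fibre *)

Section Height.
Variable k : fieldType.

Lemma ptrunc_serpoly (f : pseries 1 k) n : ptrunc f n = serpoly (cf f) n.
Proof.
apply/mpolyP => m; rewrite ptruncE /serpoly mcoeff_sum.
under eq_bigr => i _ do rewrite mcoeffZ mcoeffXn1.
case: ltnP => hm.
  rewrite (@sum_ord_single _ _ (fun i => cf f i * (mdeg m == i)%:R) (mdeg m)) //.
    by rewrite eqxx mulr1 /cf -mnm_one.
  by move=> s _ sm; case: eqP => [e|]; [case: sm|rewrite mulr0].
rewrite big1 // => i _; case: eqP => [e|]; last by rewrite mulr0.
by have := ltn_ord i; rewrite -e ltnNge hm.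
Qed.

Lemma cf_pmul (h g : pseries 1 k) d :
  cf (pmul h g) d = \sum_(i < d.+1) cf h i * cf g (d - i).
Proof.
rewrite {1}/cf /pmul mdegMn mdeg1 mul1n !ptrunc_serpoly {1}/serpoly mulr_suml mcoeff_sum.
apply: eq_bigr => i _; rewrite -scalerAl mcoeffZ; congr (_ * _).
rewrite /serpoly mulr_sumr mcoeff_sum.
under eq_bigr => j _ do rewrite -scalerAr mcoeffZ -exprD mcoeffXn1 mdegMn mdeg1 mul1n.
rewrite (@sum_ord_single _ _ (fun j => cf g j * (d == i + j)%N%:R) (d - i)%N).
- by rewrite subnKC ?eqxx ?mulr1 // -ltnS.
- by rewrite ltnS leq_subr.
- move=> s _ sd; rewrite (_ : _ == _ = false) ?mulr0 //; apply/eqP => e; apply: sd.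
  by move: e; move: (nat_of_ord i) => i'; lia.
Qed.

Lemma pmul_low (h g : pseries 1 k) D d : (forall i, (i < D)%N -> cf g i = 0) -> (d < D)%N ->
  cf (pmul h g) d = 0.
Proof.
move=> hg dD; rewrite cf_pmul big1 // => i _.
by rewrite hg ?mulr0 // (leq_ltn_trans (leq_subr _ _)).
Qed.

(** Division by a series of order D; its coefficient at D is invertible. *)
Lemma pmul_div (f g : pseries 1 k) D : (forall i, (i < D)%N -> cf g i = 0) -> cf g D != 0 ->
  (forall i, (i < D)%N -> cf f i = 0) -> exists h, f = pmul h g.
Proof.
move=> hg gD hf.
pose P d (c : nat -> k) := \sum_(i < d.+1) c i * cf g (D + d - i) = cf f (D + d).
have [||c hc] := @sequence_choice k 0 P.
- move=> n c c' e; rewrite /P => <-; apply: eq_bigr => i _.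
  by rewrite e // -ltnS.
- move=> n c _; pose S := \sum_(i < n) c i * cf g (D + n - i).
  exists ((cf f (D + n) - S) / cf g D).
  rewrite /P big_ord_recr /= eqxx addnK divfK //.
  have -> : \sum_(i < n) (if nat_of_ord i == n then (cf f (D + n) - S) / cf g D else c i) *
      cf g (D + n - i) = S.
    by apply: eq_bigr => i _; rewrite ltn_eqF.
  by rewrite addrC subrK.
exists (ser c); apply: cf_inj => d; have [dD|Dd] := ltnP d D.
  by rewrite hf // (pmul_low _ hg).
rewrite cf_pmul cf_ser -{1}(subnKC Dd) -hc subnKC //.
rewrite (big_ord_widen d.+1 (fun i => c i * cf g (d - i))); last by rewrite ltnS leq_subr.
rewrite [RHS](bigID (fun i : 'I_d.+1 => (i < (d - D).+1)%N)) /= [X in _ = _ + X]big1 ?addr0 //.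
by move=> i; rewrite -leqNgt => hi; rewrite hg ?mulr0 //; have := ltn_ord i; lia.
Qed.

(** The quotient k[[T]]/(g) is compared with k[[T]]/(T^D) by looking at the
    coefficients below D. *)
Lemma quotient_rank_ge (g : pseries 1 k) N D : quotient_rank g N ->
  (forall i, (i < D)%N -> cf g i = 0) -> (D <= N)%N.
Proof.
move=> [b hb] hg.
pose M : 'M[k]_(N, D) := \matrix_(i, j) cf (b i) j.
suff /row_fullP[B BM] : row_full M.
  have : (1%:M <= M)%MS by apply/submxP; exists B; rewrite BM.
  by move/mxrankS; rewrite mxrank1 => /leq_trans; apply; apply: rank_leq_row.
rewrite -sub1mx; apply/row_subP => j.
pose f : pseries 1 k := ser (fun d => (d == j)%:R).
have [c [[h fE] _]] := hb f; apply/submxP; exists (\row_i c i).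
apply/rowP => l; rewrite !mxE.
transitivity (cf f l); first by rewrite /f cf_ser eq_sym.
rewrite {1}/cf fE -/(cf _ _) (pmul_low _ hg) ?ltn_ord // addr0.
by apply: eq_bigr => i _; rewrite !mxE.
Qed.

Lemma quotient_rank_le (g : pseries 1 k) N D : quotient_rank g N ->
  (forall i, (i < D)%N -> cf g i = 0) -> cf g D != 0 -> (N <= D)%N.
Proof.
move=> [b hb] hg gD.
pose M : 'M[k]_(N, D) := \matrix_(i, j) cf (b i) j.
suff hM : row_free M by rewrite -(eqP hM) rank_leq_col.
rewrite -kermx_eq0; apply/eqP/row_matrixP => i0; rewrite row0.
have : row i0 (kermx M) *m M = 0 by apply/sub_kermxP; rewrite row_sub.
move: (row i0 _) => c cM.
have [c0 [_ uniq_c]] := hb (pzero 1 k).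
have pm0 (u : pseries 1 k) m : pmul (pzero 1 k) u m = 0.
  rewrite /pmul (_ : ptrunc _ _ = 0) ?mul0r ?mcoeff0 //.
  by apply/mpolyP => a; rewrite ptruncE mcoeff0; case: ifP.
have z1 : c0 = [ffun => 0].
  apply: uniq_c; exists (pzero 1 k) => m; rewrite pm0 addr0 big1 // => i _.
  by rewrite ffunE mul0r.
have [|h hE] := @pmul_div (fun m => - \sum_(i < N) c 0 i * b i m) g D hg gD.
  move=> j jD; have := congr1 (fun r : 'rV_D => r 0 (Ordinal jD)) cM; rewrite !mxE => h0.
  apply/eqP; rewrite /cf oppr_eq0; apply/eqP; rewrite -[RHS]h0.
  by apply: eq_bigr => i _; rewrite [in RHS]mxE.
have z2 : c0 = [ffun i => c 0 i].
  apply: uniq_c; exists h => m; rewrite -hE.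
  by under eq_bigr => i _ do rewrite ffunE; rewrite subrr.
apply/rowP => i; rewrite mxE; have := congr1 (fun f : {ffun 'I_N -> k} => f i) z2.
by rewrite z1 !ffunE.
Qed.

(** The leading term of a composition. *)
Lemma cf_sub1_low (f h : pseries 1 k) D : (0 < D)%N -> f 0%MM = 0 ->
  (forall i, (i < D)%N -> cf h i = 0) ->
  (forall i, (i < D)%N -> cf (sub1 f h) i = 0) /\ cf (sub1 f h) D = cf f 1 * cf h D.
Proof.
move=> D0 f0 hh; have h0 : h 0%MM = 0 by rewrite -cf0 hh.
have lo : lowdeg D (ptrunc h D.+1).
  by move=> m hm; rewrite ptruncE (mnm_one m) -/(cf _ _) hh ?if_same.
have E i : (i <= D)%N -> cf (sub1 f h) i = cf f 1 * cf h i.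
  move=> iD; rewrite -{1}[f]ser_cf {1}/cf.
  have lt1 : (mdeg (U_(0%R) *+ i : 'X_{1..1})%MM < D.+1)%N by rewrite mdegMn mdeg1 mul1n.
  rewrite (approx_sub1 (cf f) h0 (@approx_ptrunc _ _ D.+1 h) lt1) mcoeff_sum.
  rewrite (@sum_ord_single _ _ (fun j => (cf f j *: ptrunc h D.+1 ^+ j)@_(U_(0%R) *+ i)%MM) 1).
  - by rewrite mcoeffZ expr1 ptruncE lt1.
  - by rewrite ltnS.
  - case=> [|[|s]] _ // _; rewrite mcoeffZ; first by rewrite cf0 f0 mul0r.
    rewrite (lowdeg_exp (e := s.+2) lo) ?mulr0 // mdegMn mdeg1 mul1n.
    by rewrite (leq_ltn_trans iD) // -{1}[D]muln1 ltn_pmul2l.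
by split=> [i iD|]; rewrite E ?(ltnW iD) // hh // mulr0.
Qed.

Lemma cf_aser_low p e (P : nat -> k) (f : pseries 1 k) m : p \in [pchar k] -> (0 < e)%N ->
  f 0%MM = 0 -> cf f 1 = 1 -> (forall i, (i < m)%N -> P i = 0) ->
  (forall i, (i < (p ^ e) ^ m)%N -> cf (sub1 (aser (p ^ e) P) f) i = 0) /\
  cf (sub1 (aser (p ^ e) P) f) ((p ^ e) ^ m) = P m.
Proof.
move=> pk e0 f0 f1 hP; set q := (p ^ e)%N; have q1 := q_gt1 pk e0.
pose D := (q ^ m)%N.
have lo : lowdeg 1 (ptrunc f D.+1) by apply: lowdeg1_ptrunc.
have ap := approx_sub1_aser pk e0 P f0 (@approx_ptrunc _ _ D.+1 f).
have mD : (m < D.+1)%N by rewrite ltnS ltnW // (ltn_qX pk e0).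
have lt1 i : (i <= D)%N -> (mdeg (U_(0%R) *+ i : 'X_{1..1})%MM < D.+1)%N.
  by move=> iD; rewrite mdegMn mdeg1 mul1n.
have E i : (i <= D)%N -> cf (sub1 (aser q P) f) i =
    P m * (ptrunc f D.+1 ^+ D)@_(U_(0%R) *+ i)%MM.
  move=> iD; rewrite {1}/cf ap ?lt1 // /aserpoly mcoeff_sum.
  rewrite (@sum_ord_single _ _ (fun j => (P j *: ptrunc f D.+1 ^+ (q ^ j))@_(U_(0%R) *+ i)%MM) m) //.
    by rewrite mcoeffZ.
  move=> s sD sm; rewrite mcoeffZ; have [ms|ms] := ltnP s m; first by rewrite hP // mul0r.
  rewrite (lowdeg_exp (e := (q ^ s)%N) lo) ?mulr0 // mdegMn mdeg1 !mul1n.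
  by rewrite (leq_ltn_trans iD) // ltn_exp2l // ltn_neqAle ms andbT eq_sym; apply/eqP.
split=> [i iD|].
  rewrite E ?(ltnW iD) // (lowdeg_exp (e := D) lo) ?mulr0 //.
  by rewrite mdegMn mdeg1 !mul1n.
by rewrite E // lead_exp // ptruncE mdeg1 ltnS expn_gt0 (ltn_trans _ q1) //= -/(U_(0%R)%MM)
  -[f _]/(f (U_(0%R))%MM) -(mulm1n U_(0%R)%MM) -/(cf f 1) f1 expr1n mulr1.
Qed.

End Height.

(** The coefficients of g are found in turn: g_0 is a root of T^(q^n-1) - P_n,
    and g_j one of T^(q^n) - P_n^(q^j) T - s with s depending on the previous
    ones. *)
Lemma conjugate_to_power (k : closedFieldType) q n (P : nat -> k) : (1 < q)%N -> (0 < n)%N ->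
  (forall i, (i < n)%N -> P i = 0) -> P n != 0 ->
  exists g : nat -> k, g 0%N != 0 /\ tmul q g P = tmul q (fun j => (j == n)%:R) g.
Proof.
move=> q1 n0 hP Pn.
have Q1 : (1 < q ^ n)%N by rewrite -(expn0 q) ltn_exp2l.
pose T j (g : nat -> k) := (j = 0%N -> g 0%N != 0) /\
  \sum_(i < j.+1) g i * P (n + j - i)%N ^+ (q ^ i) = g j ^+ (q ^ n).
have [||g hg] := @sequence_choice k 0 T.
- move=> j c c' h [h0 h1]; split; first by move=> j0; rewrite -h // h0.
  by rewrite -h // -h1; apply: eq_bigr => i _; rewrite h // -ltnS.
- move=> j c _; case: j => [|j].
    have Q0 : (0 < (q ^ n).-1)%N by case: (q ^ n)%N Q1 => [|[]].
    have [x hx] := solve_monicpoly (fun i => if i == 0%N then P n else 0) Q0.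
    have {}hx : x ^+ (q ^ n).-1 = P n.
      rewrite hx; case: (q ^ n).-1 Q0 => // N _.
      by rewrite big_ord_recl big1 ?addr0 ?expr0 ?mulr1 // => i _; rewrite mul0r.
    exists x; split=> /=.
      move=> _; apply: contraNneq Pn => x0; rewrite -hx x0 expr0n.
      by case: (q ^ n)%N Q1 => [|[]].
    by rewrite big_ord1 /= addn0 subn0 expn0 expr1 -hx -exprS prednK // ltnW.
  pose s := \sum_(i < j.+1) c i * P (n + j.+1 - i)%N ^+ (q ^ i).
  pose cc i := if i == 0%N then s else if i == 1%N then P n ^+ (q ^ j.+1) else 0.
  have [x hx] := solve_monicpoly cc (ltnW Q1).
  have {}hx : x ^+ (q ^ n) = s + P n ^+ (q ^ j.+1) * x.
    rewrite hx; case: (q ^ n)%N Q1 => [|[|N]] // _.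
    rewrite !big_ord_recl big1 ?addr0 /cc /= ?expr0 ?mulr1 ?expr1 // => i _.
    by rewrite mul0r.
  exists x; split=> //; rewrite eqxx hx big_ord_recr /= eqxx addnK mulrC.
  by congr (_ + _); apply: eq_bigr => i _; rewrite ltn_eqF.
exists g; split; first by apply: (hg 0%N).1.
have qx0 i : (0 : k) ^+ (q ^ i) = 0.
  by rewrite expr0n expn_eq0 gtn_eqF // ltnW.
apply: functional_extensionality => m; rewrite /tmul; have [mn|nm] := ltnP m n.
  rewrite !big1 // => i _; last by rewrite hP ?qx0 ?mulr0 // (leq_ltn_trans (leq_subr _ _)).
  by rewrite (_ : _ == n = false) ?mul0r //; have := ltn_ord i; lia.
rewrite [RHS](@sum_ord_single _ _ (fun i => (i == n)%:R * g (m - i)%N ^+ (q ^ i)) n) //; last first.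
  by move=> s _ /eqP/negbTE ->; rewrite mul0r.
rewrite eqxx mul1r -(hg (m - n)%N).2 subnKC //.
rewrite [RHS](big_ord_widen m.+1 (fun i => g i * P (m - i)%N ^+ (q ^ i))); last by rewrite ltnS leq_subr.
rewrite [LHS](bigID (fun i : 'I_m.+1 => (i < (m - n).+1)%N)) /= [X in _ + X = _]big1 ?addr0 //.
by move=> i; rewrite -leqNgt => hi; rewrite hP ?qx0 ?mulr0 //; have := ltn_ord i; lia.
Qed.

(** * Classification of deformations *)

Section TwistedHom.
Variables (A R : comNzRingType) (p e : nat) (k : finFieldType).
Variables (t : {rmorphism k -> A}) (s : {rmorphism A -> R}).
Hypotheses (pR : p \in [pchar R]) (hk : #|k| = (p ^ e)%N).
Let q := (p ^ e)%N.
Let e0 : (0 < e)%N := card_exponent_gt0 hk.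

Lemma aser_tconst (z : R) : aser q (tconst z) = scT z.
Proof.
apply: functional_extensionality => m; rewrite /scT -(aser_const1 pR e0).
rewrite (mnm_one m) -!/(cf _ _) !aser_coef // mulr_sumr; apply: eq_bigr => i _.
rewrite mulrnAr; congr (_ *+ _); rewrite /tconst.
by case: eqP => _; rewrite ?mulr1n ?mulr0n ?mulr1 ?mulr0.
Qed.

(** A homomorphism commutes with the constants, which act linearly on both
    sides. *)
Lemma tw_hom_aser (alpha beta : A -> nat -> R) f :
  (forall z, alpha (t z) = tconst (s (t z))) ->
  (forall z, beta (t z) = tconst (s (t z))) ->
  is_fm_hom (tw_module q alpha) (tw_module q beta) f ->
  exists c, f = aser q c /\ forall a, tmul q c (alpha a) = tmul q (beta a) c.
Proof.
move=> ha hb /fm_homE[/= h1 h2].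
pose st : {rmorphism k -> R} := s \o t.
have fE : f = aser q (fun i => cf f (q ^ i)).
  apply: (@additive_linear_series R p e k st pR hk f h1) => z.
  by rewrite -[st z]/(s (t z)) -!aser_tconst -ha h2 hb ha.
exists (fun i => cf f (q ^ i)); split=> // a; apply: (aser_inj pR e0).
by rewrite -!(sub1_aser pR e0) -fE h2.
Qed.

Lemma tw_inverse (G : nat -> R) c : c * G 0%N = 1 ->
  exists H, tmul q H G = tconst 1 /\ tmul q G H = tconst 1.
Proof.
move=> cG; have [|g [g0 _ gf fg]] := inverse_series (aser0 pR e0 G) (c := c).
  by rewrite (aser1 pR e0).
have hG : is_group_hom (gadd R) (gadd R) (aser q G) by apply: aser_hom.
have hg := group_hom_inv (gadd0 R) (gadd0 R) hG g0 gf fg.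
have gE : g = aser q (fun i => cf g (q ^ i)).
  pose st : {rmorphism k -> R} := s \o t.
  apply: (@additive_linear_series R p e k st pR hk g hg) => z.
  rewrite -[st z]/(s (t z)); set y := s (t z).
  have yq i : y ^+ (q ^ i) = y.
    rewrite /y -!rmorphXn /=; congr (s (t _)).
    elim: i => [|i ih]; first by rewrite expn0 expr1.
    have zq1 : z ^+ q = z by rewrite /q -hk expf_card.
    by rewrite expnS exprM zq1.
  have comm : sub1 (aser q G) (scT y) = sub1 (scT y) (aser q G).
    rewrite -!aser_tconst !(sub1_aser pR e0) tmul_constl (tmul_constr e pR).
    congr (aser _ _); apply: functional_extensionality => i.
    by rewrite yq mulrC.
  have y0 := scT0 y; have gy0 := sub1_0 g0 y0; have G0 := aser0 pR e0 G.
  rewrite -[LHS]sub1_id -fg -sub1_sub1 // [sub1 (sub1 g (scT y)) _]sub1_sub1 //.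
  by rewrite -comm -sub1_sub1 // gf sub1T // sub1_sub1.
exists (fun i => cf g (q ^ i)); split; apply: (aser_inj pR e0);
  by rewrite -(sub1_aser pR e0) -gE (aser_const1 pR e0).
Qed.

End TwistedHom.

Section Equivalence.
Variables (A O : comNzRingType) (sA : {rmorphism A -> O}) (k : fieldType).
Variables (red : {rmorphism O -> k}) (X0 : formal_module A k).

Section OneBase.
Variable R : cln_alg red.
Let sR : {rmorphism A -> R} := cln_str R \o sA.

Lemma res_str a : cln_res R (sR a) = red (sA a).
Proof. exact: cln_res_str. Qed.

Lemma fm_map_formal (S T : comNzRingType) (s : A -> S) (phi : {rmorphism S -> T})
    (X : formal_module A S) :
  is_formal_module s X -> is_formal_module (phi \o s) (fm_map phi X).
Proof.
case=> -[F0 [hT1 hT2] hA hC] [h1 h2 h3 h4 h5].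
have pmT : pmap phi (pT S) = pT T by apply: pmap_pvar.
have pm0 l : pmap phi (pzero l S) = pzero l T.
  by apply: functional_extensionality => m; rewrite /pmap rmorph0.
have pmv l (i : 'I_l) : pmap phi (pvar S i) = pvar T i by apply: pmap_pvar.
have pms l f (g : pseries l S) : g 0%MM = 0 ->
    pmap phi (psubst f [tuple g]) = psubst (pmap phi f) [tuple pmap phi g].
  move=> g0; rewrite !sub1E !sub1_psub pmap_psub //.
have pma l F (a b : pseries l S) : a 0%MM = 0 -> b 0%MM = 0 ->
    pmap phi (psubst F [tuple a; b]) = psubst (pmap phi F) [tuple pmap phi a; pmap phi b].
  move=> a0 b0; rewrite !app2E !app2_psub pmap_psub //; last exact: ord2_cases.
  by apply: eq_psub; apply: ord2_cases.
have act0 a : fm_act X a 0%MM = 0 by case: (h1 a).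
have tr l (f g : pseries l S) : f =1 g -> pmap phi f =1 pmap phi g.
  by move=> h m; rewrite /pmap h.
have z0 l : pzero l S 0%MM = 0 by [].
have e00 l (a b : pseries l S) : a 0%MM = 0 -> b 0%MM = 0 ->
    psubst (fm_add X) [tuple a; b] 0%MM = 0.
  by move=> a0 b0; rewrite app2E; apply: app2_0.
have s00 l (g : pseries l S) a : g 0%MM = 0 -> psubst (fm_act X a) [tuple g] 0%MM = 0.
  by move=> g0; rewrite sub1E; apply: sub1_0.
split.
  split=> /=.
  - by rewrite /pmap F0 rmorph0.
  - split; rewrite -pmT -pm0 -pma ?pT0 //; exact: tr.
  - rewrite -!pmv -!pma ?pvar0 ?e00 ?pvar0 //; exact: tr.
  - rewrite -!pmv -!pma ?pvar0 //; exact: tr.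
split=> /=.
- move=> a; split; first by rewrite /pmap act0 rmorph0.
  rewrite -!pmv -!pms ?pvar0 // -pma ?s00 ?pvar0 //.
  by apply: tr; case: (h1 a).
- by move=> a b; rewrite -pma ?act0 //; apply: tr.
- by move=> a b; rewrite -pms ?act0 //; apply: tr.
- by rewrite -pmT; apply: tr.
- by move=> a; rewrite /pmap h5.
Qed.

Lemma fm_map_hom (S T : comNzRingType) (phi : {rmorphism S -> T}) (s : A -> S)
    (X Y : formal_module A S) f :
  is_formal_module s X -> is_formal_module s Y ->
  is_fm_hom X Y f -> is_fm_hom (fm_map phi X) (fm_map phi Y) (pmap phi f).
Proof.
move=> hX hY /fm_homE[h1 h2]; have f0 := h1.1.
have [_ h] := (group_homE _ _ _).1 h1.
have F0 := fm_add0 hX.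
have fx0 := sub1_0 f0 (varx0 S); have fy0 := sub1_0 f0 (vary0 S).
apply/fm_homE; split=> /=.
  apply/group_homE; split; first by rewrite /pmap f0 rmorph0.
  have := congr1 (pmap phi) h; rewrite sub1_psub pmap_psub // -sub1_psub => ->.
  rewrite app2_psub pmap_psub; last exact: ord2_cases.
  rewrite app2_psub; apply: eq_psub; apply: ord2_cases => /=.
    by rewrite !sub1_psub pmap_psub ?varx0 // pmap_pvar.
  by rewrite !sub1_psub pmap_psub ?vary0 // pmap_pvar.
move=> a; have a0 := fm_act0 a hX.
have := congr1 (pmap phi) (h2 a).
by rewrite !sub1_psub !pmap_psub.
Qed.

Lemma fm_map_iso (S T : comNzRingType) (phi : {rmorphism S -> T}) (s : A -> S)
    (X Y : formal_module A S) f :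
  is_formal_module s X -> is_formal_module s Y ->
  is_fm_iso X Y f -> is_fm_iso (fm_map phi X) (fm_map phi Y) (pmap phi f).
Proof.
move=> hX hY /(fm_isoP _ hX hY)[hf [c hc]].
apply/(fm_isoP _ (fm_map_formal phi hX) (fm_map_formal phi hY)).
split; first exact: (fm_map_hom _ hX hY).
by exists (phi c); rewrite /cf /pmap -rmorphM -/(cf f 1) hc rmorph1.
Qed.

Lemma pmap_sub1 (S T : comNzRingType) (phi : {rmorphism S -> T}) f (g : pseries 1 S) :
  g 0%MM = 0 -> pmap phi (sub1 f g) = sub1 (pmap phi f) (pmap phi g).
Proof. by move=> g0; rewrite !sub1_psub pmap_psub. Qed.

(** The same equivalence of deformations, with substitution in locked form. *)
Lemma def_equivE (D D' : deformation A R k) : def_equiv D D' <->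
  exists f, is_fm_iso (def_fm D) (def_fm D') f /\
    sub1 (pmap (cln_res R) f) (def_iota D) = def_iota D'.
Proof.
split=> -[f [h1 h2]]; exists f; split=> //; last by rewrite sub1E h2.
by rewrite -sub1E; apply: functional_extensionality.
Qed.

Lemma def_equiv_trans (D1 D2 D3 : deformation A R k) :
  is_deformation sA X0 D1 -> is_deformation sA X0 D2 -> is_deformation sA X0 D3 ->
  def_equiv D1 D2 -> def_equiv D2 D3 -> def_equiv D1 D3.
Proof.
move=> [h1 i1] [h2 i2] [h3 i3] /def_equivE[f [hf ef]] /def_equivE[g [hg eg]].
apply/def_equivE; exists (sub1 g f); split; first exact: (fm_iso_comp h1 h2 h3).
have f0 : f 0%MM = 0 by case: hf => -[[]].
have i0 : def_iota D1 0%MM = 0 by case: i1 => -[[]].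
by rewrite pmap_sub1 // sub1_sub1 ?ef ?eg // /pmap f0 rmorph0.
Qed.

Lemma def_equiv_sym (D1 D2 : deformation A R k) :
  is_deformation sA X0 D1 -> is_deformation sA X0 D2 -> def_equiv D1 D2 -> def_equiv D2 D1.
Proof.
move=> [h1 i1] [h2 i2] /def_equivE[f [[hf [g [hg fg gf]]] ef]].
apply/def_equivE; exists g.
move: fg gf; rewrite !sub1E => /functional_extensionality fg /functional_extensionality gf.
have f0 := hf.1.1; have g0 := hg.1.1.
split.
  split=> //; exists f; rewrite !sub1E fg gf; split; [exact: hf|by []|by []].
have i0 : def_iota D1 0%MM = 0 by case: i1 => -[[]].
have pf0 : pmap (cln_res R) f 0%MM = 0 by rewrite /pmap f0 rmorph0.
rewrite -ef -sub1_sub1 // -pmap_sub1 // gf.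
by rewrite /pT pmap_pvar -/(pT k) sub1T.
Qed.

End OneBase.

Lemma def_map_deformation (R S : cln_alg red) (phi : cln_hom R S) (D : deformation A R k) :
  is_deformation sA X0 D -> is_deformation sA X0 (def_map phi D).
Proof.
move=> [h1 h2]; split=> /=.
  have := fm_map_formal phi h1.
  have -> : phi \o (cln_str R \o sA) = cln_str S \o sA.
    by apply: functional_extensionality => a; rewrite /= cln_hom_str.
  by [].
have -> : fm_map (cln_res S) (fm_map phi (def_fm D)) = fm_map (cln_res R) (def_fm D).
  rewrite /fm_map /=; congr FormalModule.
    by apply: functional_extensionality => m; rewrite /pmap cln_hom_res.
  apply: functional_extensionality => a; apply: functional_extensionality => m.
  by rewrite /pmap cln_hom_res.
exact: h2.
Qed.

Lemma def_map_equiv (R S : cln_alg red) (phi : cln_hom R S) (D D' : deformation A R k) :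
  is_deformation sA X0 D -> is_deformation sA X0 D' ->
  def_equiv D D' -> def_equiv (def_map phi D) (def_map phi D').
Proof.
move=> [h1 _] [h2 _] /def_equivE[f [hf ef]]; apply/def_equivE.
exists (pmap phi f); split; first exact: (fm_map_iso phi h1 h2 hf).
rewrite /= -ef; congr (sub1 _ _); apply: functional_extensionality => m.
by rewrite /pmap cln_hom_res.
Qed.

End Equivalence.

Section Classification.
Variables (A O : comNzRingType) (FF : closedFieldType) (k : finFieldType).
Variables (sA : {rmorphism A -> O}) (red : {rmorphism O -> FF}).
Variables (t : {rmorphism k -> A}) (pi : A) (p e n : nat).
Hypotheses (pA : p \in [pchar A]) (hk : #|k| = (p ^ e)%N) (n0 : (0 < n)%N).
Let q := (p ^ e)%N.
Let e0 : (0 < e)%N := card_exponent_gt0 hk.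
Hypothesis digits : forall a, exists z b, a = t z + pi * b.
Hypothesis red_pi : red (sA pi) = 0.
Hypothesis pi_regular : forall x, sA pi * x = 0 -> x = 0.
Hypothesis pi_unit : forall m, (0 < m)%N -> exists y, (sA pi ^+ m - 1) * y = 1.

Local Notation B := {mpoly O[n.-1]}.

Let pO : p \in [pchar O] := pchar_rmorph sA pA.
Let pB : p \in [pchar B] := pchar_mpoly n.-1 pO.
Let pFF : p \in [pchar FF] := pchar_rmorph red pO.

(** Coefficients of the generic multiplication by pi: pi, u_1, .., u_(n-1). *)
Definition gen_coef (S : comNzRingType) (a : S) (w : 'I_n.-1 -> S) : nat -> S :=
  fun j => if j is i.+1 then (if insub i is Some l then w l else 0) else a.

Lemma gen_coef_map (S T : comNzRingType) (phi : {rmorphism S -> T}) a w i :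
  phi (monic_tw n (gen_coef a w) i) = monic_tw n (gen_coef (phi a) (phi \o w)) i.
Proof.
rewrite /monic_tw; case: ifP => _; last by rewrite rmorph_nat.
by case: i => [//|i] /=; case: insubP => [l _ _ //|_]; rewrite rmorph0.
Qed.

Definition strB : {rmorphism A -> B} := @mpolyC n.-1 O \o sA.

Definition genU : nat -> B := monic_tw n (gen_coef (strB pi) (fun i => 'X_i)).

Lemma genU0 : genU 0%N = strB pi.
Proof. by rewrite /genU /monic_tw n0. Qed.

(** The generic module: multiplication by pi is prescribed, and the action of
    the other scalars is then forced. *)
Lemma generic_family : exists alpha : A -> nat -> B,
  [/\ forall a, alpha a 0%N = strB a,
      forall a b, alpha (a + b) = fun i => alpha a i + alpha b i,
      forall a b, alpha (a * b) = tmul q (alpha a) (alpha b),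
      forall z, alpha (t z) = tconst (strB (t z)) & alpha pi = genU].
Proof.
apply: (commuting_family pB hk digits _ _ genU0).
  move=> x hx; apply/mpolyP => m; rewrite mcoeff0; apply: pi_regular.
  by have := congr1 (fun P : B => P@_m) hx; rewrite mcoeffCM mcoeff0.
move=> m m0; have [y hy] := pi_unit m0; exists (y%:MP).
rewrite -[1]mpolyC1 -[strB pi]/((sA pi)%:MP) -rmorphXn -rmorphB -rmorphM /=.
by rewrite hy.
Qed.

Variable alpha : A -> nat -> B.
Hypothesis alpha0 : forall a, alpha a 0%N = strB a.
Hypothesis alphaD : forall a b, alpha (a + b) = fun i => alpha a i + alpha b i.
Hypothesis alphaM : forall a b, alpha (a * b) = tmul q (alpha a) (alpha b).
Hypothesis alphat : forall z, alpha (t z) = tconst (strB (t z)).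
Hypothesis alpha_pi : alpha pi = genU.

(** Specialisations of the generic family along the points of the parameter space. *)
Section Specialise.
Variables (S : comNzRingType) (phi : {rmorphism B -> S}) (s : {rmorphism A -> S}).
Hypothesis phi_s : forall a, phi (strB a) = s a.

Definition spec (a : A) (i : nat) : S := phi (alpha a i).

Lemma spec0 a : spec a 0%N = s a. Proof. by rewrite /spec alpha0 phi_s. Qed.

Lemma specD a b : spec (a + b) = fun i => spec a i + spec b i.
Proof. by apply: functional_extensionality => i; rewrite /spec alphaD rmorphD. Qed.

Lemma specM a b : spec (a * b) = tmul q (spec a) (spec b).
Proof.
apply: functional_extensionality => i; rewrite /spec alphaM /tmul rmorph_sum.
by apply: eq_bigr => j _; rewrite rmorphM rmorphXn.
Qed.

Lemma spect z : spec (t z) = tconst (s (t z)).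
Proof.
by apply: functional_extensionality => i; rewrite /spec alphat /tconst rmorphMn phi_s.
Qed.

Lemma spec1 : spec 1 = tconst 1.
Proof. by rewrite -(rmorph1 t) spect !rmorph1. Qed.

Lemma spec_formal : is_formal_module s (tw_module q spec).
Proof.
apply: (tw_module_formal (pchar_rmorph s pA) e0 spec0 specD specM spec1).
Qed.

Lemma spec_pi : spec pi = monic_tw n (gen_coef (s pi) (fun i => phi 'X_i)).
Proof.
apply: functional_extensionality => i.
by rewrite /spec alpha_pi gen_coef_map phi_s.
Qed.

End Specialise.

Definition point0 : {rmorphism B -> FF} := mmap red (fun _ => 0).

Lemma point0_str a : point0 (strB a) = (red \o sA) a.
Proof. exact: mmapC. Qed.

Definition special : formal_module A FF := tw_module q (spec point0).

Let sF : {rmorphism A -> FF} := red \o sA.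

Lemma special_formal : is_formal_module sF special.
Proof. by apply: spec_formal; exact: point0_str. Qed.

Lemma special_pi : spec point0 pi = fun j => (j == n)%:R.
Proof.
rewrite (spec_pi (s := sF) point0_str); apply: functional_extensionality => j.
rewrite /monic_tw; case: ltnP => jn.
  rewrite (_ : j == n = false); last by lia.
  case: j jn => [|j] jn; first exact: red_pi.
  rewrite /=; case: insubP => // l _ _.
  by rewrite /point0 mmapX mmap1U.
by [].
Qed.

(** The ideal {0} of a field, for which completeness is void. *)
Lemma field_complete : adic_complete [pred x : FF | x == 0].
Proof.
have z0 (x : FF) j : ideal_pow [pred x : FF | x == 0] j.+1 x -> x = 0.
  move=> [N [a [b [hb ->]]]]; rewrite big1 // => i _.
  rewrite (bigD1 ord0) //=; have /eqP -> := hb i ord0.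
  by rewrite mul0r mulr0.
split=> [x h|x h]; first exact: z0 (h 1%N).
exists (x 1%N) => -[|j].
  exists 1%N, (fun=> x 1%N - x 0%N), (fun _ _ => 0).
  by split; [move=> _ [m m0]; case: (notF m0)|rewrite big_ord1 big_ord0 mulr1].
have xE i : x i.+1 = x 1%N.
  elim: i => [//|i <-]; apply/eqP; rewrite -subr_eq0; apply/eqP.
  exact: z0 (h i.+1).
rewrite xE subrr; exists 0%N, (fun=> 0), (fun _ _ => 0).
by split; [move=> [m m0]; case: (notF m0)|rewrite big_ord0].
Qed.

Variable XX : formal_module A FF.
Hypothesis hXX : is_formal_module sF XX.

(** The height says that the series of pi has order exactly q^n. Over an
    algebraically closed field it can be conjugated to t^n, and by continuity the
    same series conjugates the whole action. *)
Theorem special_fibre : has_height XX pi q n ->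
  exists iota, is_fm_iso XX special iota.
Proof.
move=> hn; have [f [al [[f1 hf fal] [al0 alD alM alt]]]] := twisted_form t pA hk hXX.
have f0 := hf.1; set P := al pi in fal *; have F0 := fm_add0 hXX.
have pi0 : fm_act XX pi 0%MM = 0 := fm_act0 pi hXX.
have [|g [g0 g1 gf fg]] := @inverse_series FF f 1 f0; first by rewrite f1 mulr1.
have aP0 := aser0 pFF e0 P; have aPf0 := sub1_0 aP0 f0.
have piE : fm_act XX pi = sub1 g (sub1 (aser q P) f).
  by rewrite -fal -sub1_sub1 // gf sub1T.
have ord m : (forall i, (i < m)%N -> P i = 0) ->
    (forall i, (i < q ^ m)%N -> cf (fm_act XX pi) i = 0) /\
    cf (fm_act XX pi) (q ^ m) = P m.
  move=> hm; have [h1 h2] := cf_aser_low pFF e0 f0 f1 hm.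
  rewrite piE -h2 -[cf (sub1 (aser _ _) f) _]mul1r -g1.
  apply: cf_sub1_low => //; rewrite expn_gt0.
  by rewrite /q (ltn_trans _ (q_gt1 pFF e0)).
have q1 : (1 < q)%N := q_gt1 pFF e0.
have Plow : forall i, (i < n)%N -> P i = 0.
  move=> i; elim/ltn_ind: i => i ih iN; apply/eqP/negPn/negP => Pi.
  have [h1 h2] := ord i (fun j ji => ih j ji (ltn_trans ji iN)).
  have := quotient_rank_le hn h1; rewrite h2 => /(_ Pi).
  by rewrite leq_exp2l // leqNgt iN.
have Pn : P n != 0.
  apply/eqP => Pn.
  have [|h1 _] := ord n.+1.
    by move=> i; rewrite ltnS leq_eqVlt => /orP[/eqP ->|/Plow].
  have := quotient_rank_ge hn h1.
  by rewrite leq_exp2l // ltnn.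
have [G [G0 hG]] := conjugate_to_power q1 n0 Plow Pn.
have z0 (x : FF) : ideal_pow [pred x : FF | x == 0] 1 x <-> x = 0.
  rewrite ipow1P ?inE ?eqxx //; first by split=> /eqP.
  by move=> a x' y; rewrite !inE => /eqP -> /eqP ->; rewrite mulr0 addr0.
have inter a : tmul q G (al a) = tmul q (spec point0 a) G.
  apply: (intertwiner _ field_complete pFF e0 hk digits alD alM alt) => //.
  - by rewrite inE.
  - exact: specD.
  - exact: specM.
  - by apply: spect; exact: point0_str.
  - by apply/z0; rewrite special_pi (_ : 0%N == n = false) //; lia.
  - by rewrite special_pi.
have hM : is_formal_module sF (tw_module q al).
  apply: (tw_module_formal pFF e0 al0 alD alM).
  by rewrite -(rmorph1 t) alt !rmorph1.
exists (sub1 (aser q G) f); apply: (fm_iso_comp hXX hM special_formal).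
  apply/(fm_isoP _ hXX hM); split; last by exists 1; rewrite f1 mulr1.
  by apply/fm_homE; split.
apply/(fm_isoP _ hM special_formal); split; first exact: (tw_module_hom pFF e0 inter).
by exists (G 0%N)^-1; rewrite (aser1 pFF e0) mulVf.
Qed.

Variable iota0 : pseries 1 FF.
Hypothesis hiota0 : is_fm_iso XX special iota0.

Section OverBase.
Variable R : cln_alg red.
Let sR : {rmorphism A -> R} := cln_str R \o sA.
Let pR : p \in [pchar R] := pchar_rmorph sR pA.
Let m : {pred R} := [pred x | cln_res R x == 0].

Lemma max0 : 0 \in m. Proof. by rewrite inE rmorph0. Qed.

Lemma maxlin a x y : x \in m -> y \in m -> a * x + y \in m.
Proof. by rewrite !inE rmorphD rmorphM => /eqP -> /eqP ->; rewrite mulr0 addr0. Qed.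

Lemma maxP x : ideal_pow m 1 x <-> cln_res R x = 0.
Proof. by rewrite (ipow1P max0 maxlin) inE; split=> /eqP. Qed.

Definition point (w : 'I_n.-1 -> R) : {rmorphism B -> R} := mmap (cln_str R) w.

Lemma point_str w a : point w (strB a) = sR a.
Proof. exact: mmapC. Qed.

Lemma pointX w i : point w 'X_i = w i.
Proof. by rewrite /point /= mmapX mmap1U. Qed.

Lemma res_point w x : (forall i, cln_res R (w i) = 0) -> cln_res R (point w x) = point0 x.
Proof.
move=> hw; rewrite /point /point0 /= /mmap rmorph_sum; apply: eq_bigr => a _.
rewrite rmorphM /= cln_res_str; congr (_ * _).
rewrite /mmap1 rmorph_prod; apply: eq_bigr => i _.
by rewrite rmorphXn /= hw.
Qed.

Definition fibre (w : 'I_n.-1 -> R) : deformation A R FF :=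
  Deformation (tw_module q (spec (point w))) iota0.

Lemma fibre_formal w : is_formal_module sR (tw_module q (spec (point w))).
Proof. by apply: spec_formal; exact: point_str. Qed.

Lemma fibre_res w : (forall i, cln_res R (w i) = 0) ->
  fm_map (cln_res R) (tw_module q (spec (point w))) = special.
Proof.
move=> hw; rewrite tw_module_map /special; congr tw_module.
apply: functional_extensionality => a; apply: functional_extensionality => i.
exact: res_point.
Qed.

Lemma fibre_deformation w : (forall i, cln_res R (w i) = 0) ->
  is_deformation sA XX (fibre w).
Proof. by move=> hw; split; [exact: fibre_formal|rewrite /= fibre_res]. Qed.

Lemma res_aser c : pmap (cln_res R) (aser q c) = aser q (fun i => cln_res R (c i)).
Proof. exact: pmap_aser. Qed.

Lemma res_tmul a b i :
  cln_res R (tmul q a b i) = tmul q (fun j => cln_res R (a j)) (fun j => cln_res R (b j)) i.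
Proof. by rewrite /tmul rmorph_sum; apply: eq_bigr => j _; rewrite rmorphM rmorphXn. Qed.

Lemma fibre_pi w : spec (point w) pi = monic_tw n (gen_coef (sR pi) w).
Proof.
rewrite (spec_pi (s := sR) (point_str w)); congr (monic_tw n (gen_coef _ _)).
by apply: functional_extensionality => i; rewrite pointX.
Qed.

Lemma fibre_pi_mod w : (forall i, cln_res R (w i) = 0) ->
  forall j, ideal_pow m 1 (spec (point w) pi j - (j == n)%:R).
Proof.
move=> hw j; apply/maxP; rewrite rmorphB rmorph_nat.
have -> : cln_res R (spec (point w) pi j) = spec point0 pi j by apply: res_point.
by rewrite special_pi subrr.
Qed.

Lemma gen_coef_mod w : (forall i, cln_res R (w i) = 0) ->
  forall j, (j < n)%N -> ideal_pow m 1 (gen_coef (sR pi) w j).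
Proof.
move=> hw [|j] jn; apply/maxP => /=; first by rewrite cln_res_str.
by case: insubP => [l _ _|_]; rewrite ?rmorph0.
Qed.

Lemma gen_coef_inj (w w' : 'I_n.-1 -> R) :
  (forall j, (j < n)%N -> gen_coef (sR pi) w j = gen_coef (sR pi) w' j) -> w = w'.
Proof.
move=> h; apply: functional_extensionality => i.
have := h i.+1; rewrite /= valK; apply.
by have := ltn_ord i; lia.
Qed.

(** An equivalence inducing the identity on the special fibre is an additive
    series congruent to 1, and normal forms are unique. *)
Theorem fibre_unique w w' : (forall i, cln_res R (w i) = 0) ->
  (forall i, cln_res R (w' i) = 0) -> def_equiv (fibre w) (fibre w') -> w = w'.
Proof.
move=> hw hw' /def_equivE[f [hf ef]].
have [hf1 _] := (fm_isoP _ (fibre_formal w) (fibre_formal w')).1 hf.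
have i00 : iota0 0%MM = 0 by case: hiota0 => -[[]].
have fT : pmap (cln_res R) f = pT FF.
  have [_ [g [hg ig _]]] := hiota0; have g0 := hg.1.1.
  move: ig; rewrite sub1E => /functional_extensionality ig.
  have f0 : pmap (cln_res R) f 0%MM = 0 by rewrite /pmap hf1.1.1 rmorph0.
  by rewrite -[LHS]sub1_id -ig -sub1_sub1 //; move: ef => /= ->.
have [c [fc cE]] := tw_hom_aser pR hk (spect (point_str w)) (spect (point_str w')) hf1.
have c1 j : ideal_pow m 1 (c j - (j == 0%N)%:R).
  apply/maxP; rewrite rmorphB rmorph_nat.
  have := fT; rewrite fc res_aser -(aser_const1 pFF e0) => /(aser_inj pFF e0).
  by move=> /(congr1 (fun h => h j)) ->; rewrite /tconst subrr.
apply: gen_coef_inj => j jn.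
have one1 i : ideal_pow m 1 ((tconst (1 : R)) i - (i == 0%N)%:R).
  by apply/maxP; rewrite /tconst subrr rmorph0.
have E1 : tmul q (tconst 1) (spec (point w) pi) =
    tmul q (monic_tw n (gen_coef (sR pi) w)) (tconst 1).
  by rewrite tmul1l (tmul1r e pR) fibre_pi.
have E2 : tmul q c (spec (point w) pi) = tmul q (monic_tw n (gen_coef (sR pi) w')) c.
  by rewrite -fibre_pi cE.
have [_ huu] := normal_form_unique max0 (cln_complete R) pR e0 n0 (fibre_pi_mod hw)
  one1 (gen_coef_mod hw) c1 (gen_coef_mod hw') E1 E2.
exact: huu.
Qed.

Lemma unit_of_res x : cln_res R x != 0 -> exists c, c * x = 1.
Proof. by move=> /cln_local[y xy]; exists y; rewrite mulrC. Qed.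

(** Choose an additive coordinate, and lift to R the isomorphism of the special
    fibre with the standard one. The multiplication by pi is then congruent to
    t^n and can be brought into normal form, without changing the special
    fibre. *)
Theorem fibre_exists (E : deformation A R FF) : is_deformation sA XX E ->
  exists2 w, forall i, cln_res R (w i) = 0 & def_equiv E (fibre w).
Proof.
move=> [hX hi]; set X := def_fm E in hX hi; set io := def_iota E in hi.
have [f [al [[f1 hf fal] [al0 alD alM alt]]]] := twisted_form t pA hk (s := sR) hX.
have f0 := hf.1.
have hM : is_formal_module sR (tw_module q al).
  by apply: (tw_module_formal pR e0 al0 alD alM); rewrite -(rmorph1 t) alt !rmorph1.
have fiso : is_fm_iso X (tw_module q al) f.
  apply/(fm_isoP _ hX hM); split; last by exists 1; rewrite f1 mulr1.
  by apply/fm_homE; split.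
have hXr := fm_map_formal (cln_res R) hX; have hMr := fm_map_formal (cln_res R) hM.
have resE : cln_res R \o sR = sF :> (A -> FF).
  by apply: functional_extensionality => a; rewrite /= cln_res_str.
have {}hXr : is_formal_module sF (fm_map (cln_res R) X) by rewrite -resE; exact: hXr.
have {}hMr : is_formal_module sF (fm_map (cln_res R) (tw_module q al)).
  by rewrite -resE; exact: hMr.
have fr := fm_map_iso (cln_res R) hX hM fiso; set fb := pmap (cln_res R) f in fr.
pose alr a i := cln_res R (al a i).
have alrE : fm_map (cln_res R) (tw_module q al) = tw_module q alr by apply: tw_module_map.
have psi := fm_iso_comp hXX hXr hMr hi fr.
have [psi_hom [psi' [hpsi' pp' p'p]]] := psi.
have psi'iso : is_fm_iso (fm_map (cln_res R) (tw_module q al)) special (sub1 iota0 psi').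
  have psi'_iso : is_fm_iso (fm_map (cln_res R) (tw_module q al)) XX psi'.
    split; first exact: hpsi'.
    by exists (sub1 fb io); split; [exact: psi_hom|exact: p'p|exact: pp'].
  exact: (fm_iso_comp hMr hXX special_formal psi'_iso hiota0).
have [ga_hom [cg hcg]] := (fm_isoP _ hMr special_formal).1 psi'iso.
have alrt z : alr (t z) = tconst (sF (t z)).
  apply: functional_extensionality => i; rewrite /alr alt /tconst rmorphMn.
  by rewrite -resE.
have ga_hom' : is_fm_hom (tw_module q alr) special (sub1 iota0 psi').
  by rewrite -alrE.
have [ga [gaE gaI]] := tw_hom_aser pFF hk alrt (spect (s := sF) point0_str) ga_hom'.
have ga0 : ga 0%N != 0.
  apply/eqP => g00; move: hcg; rewrite gaE (aser1 pFF e0) g00 mulr0 => /eqP.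
  by rewrite eq_sym oner_eq0.
have [G hG] : exists G : nat -> R, forall j, cln_res R (G j) = ga j.
  exact: (choice (fun j x => cln_res R x = ga j) (fun j => cln_res_surj R (ga j))).
have [c cG] : exists c, c * G 0%N = 1 by apply: unit_of_res; rewrite hG.
have [H [HG GH]] := tw_inverse t sR pR hk cG.
have rG : (fun j => cln_res R (G j)) = ga by apply: functional_extensionality.
pose P := tmul q (tmul q G (al pi)) H.
have rP i : cln_res R (P i) = (i == n)%:R.
  rewrite res_tmul.
  have -> : (fun j => cln_res R (tmul q G (al pi) j)) = tmul q (spec point0 pi) ga.
    by rewrite -gaI -rG; apply: functional_extensionality => j; rewrite res_tmul.
  rewrite -(tmulA pFF e0).
  have -> : tmul q ga (fun j => cln_res R (H j)) = tconst 1.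
    rewrite -rG; apply: functional_extensionality => j; rewrite -res_tmul GH.
    by rewrite /tconst rmorphMn rmorph1.
  by rewrite (tmul1r e pFF) special_pi.
have P_mod j : ideal_pow m 1 (P j - (j == n)%:R).
  by apply/maxP; rewrite rmorphB rP rmorph_nat subrr.
have [v [u [hv hu vP]]] := normal_form_exists max0 (cln_complete R) pR e0 n0 P_mod.
have rv : (fun j => cln_res R (v j)) = tconst 1.
  apply: functional_extensionality => j; have /maxP := hv j.
  by rewrite rmorphB rmorph_nat => /eqP; rewrite subr_eq0 => /eqP.
have [d dv] : exists d, d * v 0%N = 1.
  apply: unit_of_res; rewrite -[cln_res R (v 0%N)]/((fun j => cln_res R (v j)) 0%N) rv.
  by rewrite /tconst oner_eq0.
have GH0 : G 0%N * H 0%N = 1 by rewrite -(tmul_head p e) GH.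
have u0 : u 0%N = sR pi.
  have := congr1 (fun h => h 0%N) vP; rewrite /= /P !tmul_head al0 /monic_tw n0 => h.
  have h' : v 0%N * sR pi = u 0%N * v 0%N by rewrite -h -[G 0%N * _]mulrC -mulrA GH0 mulr1.
  by rewrite -[u 0%N]mulr1 -dv [d * _]mulrC mulrA -h' mulrAC [v 0%N * d]mulrC dv mul1r.
pose w (i : 'I_n.-1) := u i.+1.
have hw i : cln_res R (w i) = 0.
  by apply/maxP/hu; have := ltn_ord i; lia.
have uE : monic_tw n u = spec (point w) pi.
  rewrite fibre_pi; apply: functional_extensionality => j; rewrite /monic_tw.
  case: ltnP => // jn; case: j jn => [//|j] jn /=.
  by rewrite insubT; [lia|move=> h; rewrite /w].
exists w => //; pose V := tmul q v G.
have VI : tmul q V (al pi) = tmul q (spec (point w) pi) V.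
  rewrite /V (tmulA pR e0) -uE -vP /P -!(tmulA pR e0) HG.
  by rewrite (tmul1r e pR).
have VA a : tmul q V (al a) = tmul q (spec (point w) a) V.
  apply: (intertwiner max0 (cln_complete R) pR e0 hk digits alD alM alt) => //.
  - exact: specD.
  - exact: specM.
  - exact: spect (point_str w).
  - by apply/maxP; rewrite (spec0 (point_str w)) cln_res_str.
apply/def_equivE; exists (sub1 (aser q V) f); split.
  apply: (fm_iso_comp hX hM (fibre_formal w) fiso).
  apply/(fm_isoP _ hM (fibre_formal w)); split; first exact: (tw_module_hom pR e0 VA).
  exists (c * d); rewrite (aser1 pR e0) /V tmul_head.
  have -> : c * d * (v 0%N * G 0%N) = (c * G 0%N) * (d * v 0%N) by ring.
  by rewrite cG dv mulr1.
rewrite /= pmap_sub1 // res_aser.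
have -> : (fun i => cln_res R (V i)) = ga.
  rewrite -[RHS](tmul1l p e) -rv -rG; apply: functional_extensionality => j.
  exact: res_tmul.
have io0 : io 0%MM = 0 by case: hi => -[[]].
have fb0 : fb 0%MM = 0 by rewrite /fb /pmap f0 rmorph0.
have psi'0 := hpsi'.1.1.
rewrite -/fb -gaE sub1_sub1 // sub1_sub1 ?sub1_0 // -/io.
rewrite [sub1 (sub1 psi' fb) io]sub1_sub1 //; move: p'p; rewrite sub1E => /functional_extensionality ->.
exact: sub1_id.
Qed.

End OverBase.

Lemma fibre_map (R S : cln_alg red) (phi : cln_hom R S) w :
  def_map phi (fibre w) = fibre (phi \o w).
Proof.
rewrite /def_map /fibre /=; congr Deformation; rewrite tw_module_map.
congr tw_module; apply: functional_extensionality => a.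
apply: functional_extensionality => i; rewrite /spec /point /= /mmap rmorph_sum.
apply: eq_bigr => b _; rewrite rmorphM /= cln_hom_str; congr (_ * _).
rewrite /mmap1 rmorph_prod; apply: eq_bigr => j _.
by rewrite rmorphXn.
Qed.

(** Deformations over R correspond to tuples in its maximal ideal, functorially
    in R; the tuple of the universal deformation is universal among tuples. *)
Theorem represented_by_parameters (R0 : cln_alg red) :
  represents_deformations sA XX R0 ->
  exists u : 'I_n.-1 -> R0,
  [/\ forall i, cln_res R0 (u i) = 0, universal_deformation sA XX (fibre u) &
      forall (R : cln_alg red) (w : 'I_n.-1 -> R), (forall i, cln_res R (w i) = 0) ->
        exists phi : cln_hom R0 R, (forall i, phi (u i) = w i) /\
          forall psi : cln_hom R0 R, (forall i, psi (u i) = w i) -> psi =1 phi].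
Proof.
move=> [D [hD univ]]; have [u hu Du] := fibre_exists hD; exists u.
have hres (R : cln_alg red) (phi : cln_hom R0 R) i : cln_res R ((phi \o u) i) = 0.
  by rewrite /= cln_hom_res.
have fdu := fibre_deformation hu.
have cls (R : cln_alg red) (phi : cln_hom R0 R) :
    def_equiv (def_map phi D) (fibre (phi \o u)).
  by rewrite -fibre_map; exact: (def_map_equiv phi hD fdu Du).
have hfm (R : cln_alg red) (phi : cln_hom R0 R) := fibre_deformation (hres R phi).
have hDm (R : cln_alg red) (phi : cln_hom R0 R) := def_map_deformation phi hD.
have main (R : cln_alg red) (w : 'I_n.-1 -> R) : (forall i, cln_res R (w i) = 0) ->
    exists phi : cln_hom R0 R, (forall i, phi (u i) = w i) /\
      forall psi : cln_hom R0 R, (forall i, psi (u i) = w i) -> psi =1 phi.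
  move=> hw; have hE := fibre_deformation hw.
  have [phi [hphi uphi]] := univ R _ hE; exists phi; split.
    move=> i; have : phi \o u = w.
      apply: (fibre_unique (hres _ _) hw).
      have cls' := def_equiv_sym (hDm R phi) (hfm R phi) (cls R phi).
      exact: (def_equiv_trans (hfm R phi) (hDm R phi) hE cls' hphi).
    by move=> <-.
  move=> psi hpsi; apply: uphi.
  have -> : w = psi \o u by apply: functional_extensionality => i; rewrite /= hpsi.
  exact: cls.
split; [exact: hu| |exact: main]; split; first exact: fdu.
move=> R E hE.
have [w hw Ew] := fibre_exists hE; have hfw := fibre_deformation hw.
have [phi [hphi uphi]] := main R w hw; exists phi; split.
  rewrite fibre_map (_ : phi \o u = w); last exact: functional_extensionality.
  exact: (def_equiv_sym hE hfw Ew).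
move=> psi; rewrite fibre_map => hpsi; apply: uphi => i.
have : psi \o u = w.
  apply: (fibre_unique (hres _ _) hw).
  exact: (def_equiv_trans (hfm R psi) hE hfw hpsi Ew).
by move=> <-.
Qed.

End Classification.

(** * Quotient rings and nilpotent test rings *)

(** Ideals are boolean predicates, whence this classical truth value. *)
Definition asb (P : Prop) : bool := if excluded_middle_informative P then true else false.

Lemma asbP P : reflect P (asb P).
Proof. by rewrite /asb; case: excluded_middle_informative => h; constructor. Qed.

Section QuotientRing.
Variables (R : comNzRingType) (J : R -> Prop).
Hypotheses (J0 : J 0) (J1 : ~ J 1) (Jlin : forall a x y, J x -> J y -> J (a * x + y)).

Definition quot_pred : {pred R} := fun x => asb (J x).

Lemma quot_pred_closed : idealr_closed quot_pred.
Proof.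
split; rewrite ?/in_mem /=; first exact/asbP.
  by apply/asbP.
by move=> a x y /asbP hx /asbP hy; apply/asbP; apply: Jlin.
Qed.

HB.instance Definition _ := isIdealr.Build R quot_pred quot_pred_closed.

Theorem quotient_ring : exists (Q : comNzRingType) (f : {rmorphism R -> Q}),
  (forall y, exists x, f x = y) /\ forall x, f x = 0 <-> J x.
Proof.
exists {ideal_quot quot_pred}, (\pi_{ideal_quot quot_pred}%qT : {rmorphism R -> _}).
split; first by move=> y; exists (repr y); exact: reprK.
move=> x; rewrite -(rmorph0 (\pi_{ideal_quot quot_pred}%qT : {rmorphism R -> _})).
split=> [/eqP|h].
  by rewrite -Quotient.idealrBE subr0 => /asbP.
by apply/eqP; rewrite -Quotient.idealrBE subr0; apply/asbP.
Qed.

End QuotientRing.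

(** A homomorphism given by its graph; being single-valued at 0 is enough. *)
Lemma graph_rmorphism (A B : nzRingType) (G : A -> B -> Prop) :
  (forall x, exists y, G x y) -> (forall y, G 0 y -> y = 0) ->
  (forall x y x' y', G x y -> G x' y' -> G (x - x') (y - y')) -> G 1 1 ->
  (forall x y x' y', G x y -> G x' y' -> G (x * x') (y * y')) ->
  exists f : {rmorphism A -> B}, forall x, G x (f x).
Proof.
move=> tot sv GB G1 GM; have [f fP] := choice G tot.
have uniq x y y' : G x y -> G x y' -> y = y'.
  by move=> h h'; apply/eqP; rewrite -subr_eq0; apply/eqP/sv; rewrite -(subrr x); apply: GB.
have [||g gE] := @rmorphism_of_laws A B f.
- by move=> x y; apply: (uniq (x - y)) => //; apply: GB.
- by split; [exact: (uniq 1)|move=> x y; apply: (uniq (x * y)) => //; apply: GM].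
by exists g => x; rewrite gE.
Qed.

Lemma factor_rmorphism (R Q S : nzRingType) (f : {rmorphism R -> Q}) (g : {rmorphism R -> S}) :
  (forall y, exists x, f x = y) -> (forall x, f x = 0 -> g x = 0) ->
  exists h : {rmorphism Q -> S}, forall x, h (f x) = g x.
Proof.
move=> surj fg.
have [|||||h hP] := @graph_rmorphism Q S (fun y z => exists2 x, f x = y & g x = z).
- by move=> y; have [x xy] := surj y; exists (g x), x.
- by move=> z [x fx <-]; apply: fg.
- by move=> _ _ _ _ [x <- <-] [y <- <-]; exists (x - y); rewrite rmorphB.
- by exists 1; rewrite rmorph1.
- by move=> _ _ _ _ [x <- <-] [y <- <-]; exists (x * y); rewrite rmorphM.
exists h => x; have [y fy <-] := hP (f x); apply/eqP.
by rewrite -subr_eq0 -rmorphB fg // rmorphB fy subrr.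
Qed.

Section NilpotentAlgebra.
Variables (O Q : comNzRingType) (k : fieldType) (red : O -> k).
Variables (str : {rmorphism O -> Q}) (res : {rmorphism Q -> k}) (K : nat).
Let m : {pred Q} := [pred x | res x == 0].
Hypothesis res_str : forall a, res (str a) = red a.
Hypothesis res_surj : forall y, exists x, res x = y.
Hypothesis noeth : noetherian Q.
Hypothesis nil : forall x, ideal_pow m K x -> x = 0.

Let m0 : 0 \in m. Proof. by rewrite inE rmorph0. Qed.
Let mlin a x y : x \in m -> y \in m -> a * x + y \in m.
Proof. by rewrite !inE rmorphD rmorphM => /eqP -> /eqP ->; rewrite mulr0 addr0. Qed.

(** The geometric series. *)
Lemma nil_local x : res x != 0 -> exists y, x * y = 1.
Proof.
move=> hx; have [c hc] := res_surj (res x)^-1.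
pose z := 1 - x * c.
have hz : z \in m by rewrite inE rmorphB rmorph1 rmorphM hc divff // subrr.
have zK : z ^+ K = 0.
  by apply: nil; rewrite -[K in ideal_pow _ K]mul1n; apply: ipowX => //; apply/ipow1P.
exists (c * \sum_(i < K) z ^+ i).
rewrite mulrA (_ : x * c = 1 - z); last by rewrite /z; ring.
by rewrite -opprB mulNr -subrX1 zK sub0r opprK.
Qed.

Lemma nil_complete : adic_complete m.
Proof.
split=> [x h|x h]; first exact/nil.
have tele i j : (i <= j)%N -> ideal_pow m i (x j - x i).
  move=> /subnKC <-; elim: (j - i)%N => [|d ih]; first by rewrite addn0 subrr; apply: ipow0.
  rewrite addnS -(subrKA (x (i + d)%N)); apply: ipowD => //.
  by apply: ipowW (h _) => //; rewrite leq_addr.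
exists (x K) => i; have [iK|/ltnW Ki] := leqP i K; first exact: tele.
by rewrite -opprB (nil (tele _ _ Ki)) oppr0; apply: ipow0.
Qed.

Definition nil_cln : cln_alg red :=
  ClnAlg res_str res_surj nil_local noeth nil_complete.

End NilpotentAlgebra.

Lemma noetherian_image (R Q : comNzRingType) (f : {rmorphism R -> Q}) :
  (forall y, exists x, f x = y) -> noetherian R -> noetherian Q.
Proof.
move=> surj noeth I [I0 I1 Ilin].
have [|N [g hg]] := noeth [pred x | f x \in I].
  split; rewrite ?inE ?rmorph0 ?rmorph1 //.
  by move=> a x y; rewrite !inE rmorphD rmorphM; apply: Ilin.
exists N, (map_tuple f g) => y; split.
  have [x <-] := surj y; move=> hx; have [c xE] := (hg x).1 hx.
  exists (f \o c); rewrite xE rmorph_sum; apply: eq_bigr => i _.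
  by rewrite rmorphM tnth_map.
move=> [c ->]; have Isum : forall x y, x \in I -> y \in I -> x + y \in I.
  by move=> x z hx hz; rewrite -[x]mul1r; apply: Ilin.
apply: (big_ind (fun z => z \in I)) => // i _.
rewrite tnth_map -[_ * _]addr0; apply: Ilin => //.
have : tnth g i \in [pred x | f x \in I]; last by rewrite inE.
apply/hg; exists (fun j => (j == i)%:R).
by rewrite (bigD1 i) //= eqxx mul1r big1 ?addr0 // => j /negbTE ->; rewrite mul0r.
Qed.

(** A subspace of a finite-dimensional space is the row space of a matrix of
    maximal rank among those with rows in it. *)
Lemma subspace_row_space (K : fieldType) N (V : 'rV[K]_N -> Prop) :
  V 0 -> (forall a u v, V u -> V v -> V (a *: u + v)) ->
  exists M : 'M[K]_N, forall v, V v <-> (v <= M)%MS.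
Proof.
move=> V0 Vlin.
pose S r := asb (exists2 M : 'M[K]_N, forall v, (v <= M)%MS -> V v & \rank M = r).
have S0 : exists r, S r.
  exists 0%N; apply/asbP; exists 0; last exact: mxrank0.
  by move=> v; rewrite submx0 => /eqP ->.
have Sle r : S r -> (r <= N)%N by move=> /asbP[M _ <-]; exact: rank_leq_row.
have [r /asbP[M MV rM] rmax] := ex_maxnP S0 Sle.
exists M => v; split; last exact: MV.
move=> Vv; have /rmax : S (\rank (M + v)%MS).
  apply/asbP; exists (M + v)%MS => // w /sub_addsmxP[[w1 w2] /= ->].
  rewrite addrC (_ : w2 *m v = w2 0 0 *: v); last first.
    by rewrite [w2 in LHS]mx11_scalar mul_scalar_mx.
  by apply: Vlin => //; apply/MV/submxMl.
rewrite -rM => hle; apply: submx_trans (addsmxSr M v) _.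
by rewrite -(geq_leqif (mxrank_leqif_sup (addsmxSl M v))).
Qed.

(** An ideal is in particular a subspace. *)
Lemma noetherian_finite_dim (K : fieldType) (Q : comNzRingType) (c : {rmorphism K -> Q})
    N (e : 'I_N -> Q) :
  (forall x, exists a : 'I_N -> K, x = \sum_i c (a i) * e i) -> noetherian Q.
Proof.
move=> span I [I0 _ Ilin].
pose ev (a : 'rV[K]_N) := \sum_i c (a 0 i) * e i.
have evL a u v : ev (a *: u + v) = c a * ev u + ev v.
  rewrite /ev mulr_sumr -big_split; apply: eq_bigr => i _.
  by rewrite !mxE rmorphD rmorphM mulrDl mulrA.
have [||M MP] := @subspace_row_space K N (fun a => ev a \in I).
- by rewrite /ev big1 // => i _; rewrite mxE rmorph0 mul0r.
- by move=> a u v hu hv; rewrite evL; apply: Ilin.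
exists N, [tuple ev (row i M) | i < N] => x; split.
  have [a xE] := span x; have {}xE : x = ev (\row_i a i).
    by rewrite xE; apply: eq_bigr => i _; rewrite mxE.
  rewrite xE => /MP/submxP[D DE]; exists (fun i => c (D 0 i)).
  rewrite DE /ev; under [RHS]eq_bigr => i _ do rewrite tnth_mktuple mulr_sumr.
  rewrite exchange_big /=; apply: eq_bigr => j _.
  rewrite mxE rmorph_sum mulr_suml; apply: eq_bigr => i _.
  by rewrite rmorphM mxE mulrA.
move=> [d ->]; apply: (big_ind (fun z => z \in I)) => //.
  by move=> y z hy hz; rewrite -[y]mul1r; apply: Ilin.
move=> i _; rewrite tnth_mktuple -[_ * _]addr0; apply: Ilin => //.
exact/MP/row_sub.
Qed.

(** Cramer's rule: multiplying a linear system by the adjugate matrix solves it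
    up to the determinant. *)
Lemma det_ideal (R : comNzRingType) N (D : 'M[R]_N) (g : 'I_N -> R) (J : R -> Prop) :
  J 0 -> (forall a x y, J x -> J y -> J (a * x + y)) ->
  (forall i, J (\sum_j D i j * g j)) -> forall i, J (\det D * g i).
Proof.
move=> J0 Jlin hD i.
have -> : \det D * g i = ((\adj D *m D) *m (\col_j g j)) i 0.
  by rewrite mul_adj_mx mul_scalar_mx !mxE.
rewrite -mulmxA mxE; elim/big_ind: _ => //.
  by move=> x y hx hy; rewrite -[x]mul1r; apply: Jlin.
move=> j _; rewrite -[_ * _]addr0; apply: Jlin => //.
rewrite mxE; under eq_bigr => l _ do rewrite mxE; exact: hD.
Qed.

Section MaximalIdeal.
Variables (O : comNzRingType) (FF : fieldType) (red : {rmorphism O -> FF}).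
Variable R : cln_alg red.
Local Notation res := (cln_res R).
Local Notation m := [pred x | res x == 0].

Lemma max_proper : idealr_closed m.
Proof.
split; rewrite ?inE ?rmorph0 ?rmorph1 ?oner_eq0 //.
by move=> a x y; rewrite !inE rmorphD rmorphM => /eqP -> /eqP ->; rewrite mulr0 addr0.
Qed.

(** Nakayama's lemma: the matrix 1 - C is invertible modulo m, hence invertible. *)
Lemma nakayama N (g : 'I_N -> R) (C : 'M[R]_N) (J : R -> Prop) :
  J 0 -> (forall a x y, J x -> J y -> J (a * x + y)) ->
  (forall i j, res (C i j) = 0) -> (forall i, J (g i - \sum_j C i j * g j)) ->
  forall i, J (g i).
Proof.
move=> J0 Jlin hC hg i; pose D := 1%:M - C.
have dJ : J (\det D * g i).
  apply: (det_ideal J0 Jlin) => j; have := hg j; congr J.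
  rewrite (bigD1 j) //= [RHS](bigD1 j) //= /D !mxE eqxx mulr1n opprD addrA.
  rewrite -{1}[g j]mul1r -mulrBl; congr (_ + _); rewrite -sumrN.
  by apply: eq_bigr => l lj; rewrite !mxE eq_sym (negbTE lj) sub0r mulNr.
have : res (\det D) != 0.
  rewrite -det_map_mx (_ : map_mx res D = 1%:M) ?det1 ?oner_eq0 //.
  apply/matrixP => a b; rewrite !mxE rmorphB rmorph_nat hC subr0 //.
move=> /cln_local[y Dy].
by rewrite -[g i]mul1r -Dy [_ * y]mulrC -mulrA -[_ * _]addr0; apply: Jlin.
Qed.

Lemma ipow2_coords N (g : 'I_N -> R) :
  (forall x, res x = 0 -> exists c, x = \sum_(i < N) c i * g i) ->
  forall x, ideal_pow m 2 x -> exists2 C : 'I_N -> R,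
    forall j, res (C j) = 0 & x = \sum_j C j * g j.
Proof.
move=> hg x [K [a [b [hb ->]]]].
have [c hc] := choice (fun i c => b i ord_max = \sum_(j < N) c j * g j)
  (fun i => hg _ (eqP (hb i ord_max))).
exists (fun j => \sum_i a i * b i ord0 * c i j).
  move=> j; rewrite rmorph_sum big1 // => i _; rewrite !rmorphM.
  by have := hb i ord0; rewrite inE => /eqP ->; rewrite mulr0 mul0r.
under [RHS]eq_bigr => j _ do rewrite mulr_suml.
rewrite exchange_big; apply: eq_bigr => i _ /=.
rewrite big_ord_recl big_ord1 (_ : lift ord0 ord0 = ord_max); last exact: val_inj.
rewrite hc mulrA mulr_sumr; apply: eq_bigr => j _; ring.
Qed.

Variables (tau : {rmorphism FF -> O}) (pi : O) (d : nat) (u : 'I_d -> R).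
Hypothesis digits : forall a, exists b, a = tau (red a) + pi * b.
Hypothesis tauK : cancel tau red.
Hypothesis red_pi : red pi = 0.
Hypothesis u_max : forall i, res (u i) = 0.
Hypothesis rigid : forall (S : cln_alg red) (phi psi : cln_hom R S),
  (forall i, phi (u i) = psi (u i)) -> phi =1 psi.

(** The expected regular system of parameters pi, u_1, .., u_d. *)
Definition params : 'I_d.+1 -> R :=
  fun i => if unlift ord0 i is Some j then u j else cln_str R pi.

Lemma params_max i : res (params i) = 0.
Proof. by rewrite /params; case: unliftP => [j|] _; rewrite ?u_max ?cln_res_str. Qed.

Definition param_span (x : R) := exists c : 'I_d.+1 -> R, x = \sum_i c i * params i.

Lemma param_span0 : param_span 0.
Proof. by exists (fun=> 0); rewrite big1 // => i _; rewrite mul0r. Qed.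

Lemma param_span_lin a x y : param_span x -> param_span y -> param_span (a * x + y).
Proof.
move=> [c ->] [c' ->]; exists (fun i => a * c i + c' i).
by rewrite mulr_sumr -big_split; apply: eq_bigr => i _; rewrite mulrDl mulrA.
Qed.

Lemma param_span_params i : param_span (params i).
Proof.
exists (fun j => (j == i)%:R).
by rewrite (bigD1 i) //= eqxx mul1r big1 ?addr0 // => j /negbTE ->; rewrite mul0r.
Qed.

(** Modulo m^2 and the parameters, the identity and the homomorphism
    x |-> tau (x mod m) both kill the u_i; as a homomorphism is determined by
    the images of the u_i, they agree, so that m maps to 0. *)
Lemma max_params_square x : res x = 0 ->
  exists2 y, ideal_pow m 2 y & param_span (x - y).
Proof.
have [m0 m1 mlin] := max_proper.
pose J x := exists2 y, ideal_pow m 2 y & param_span (x - y).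
have span_res y : param_span y -> res y = 0.
  by move=> [c ->]; rewrite rmorph_sum big1 // => i _; rewrite rmorphM params_max mulr0.
have J_res y : J y -> res y = 0.
  move=> [z hz /span_res]; rewrite rmorphB.
  have /eqP -> : z \in m by apply/(ipow1P m0 mlin); apply: ipowW hz.
  by rewrite subr0.
have J0 : J 0 by exists 0; [exact: ipow0|rewrite subr0; exact: param_span0].
have J1 : ~ J 1 by move/J_res/eqP; rewrite rmorph1 oner_eq0.
have Jlin a y z : J y -> J z -> J (a * y + z).
  move=> [y' hy sy] [z' hz sz]; exists (a * y' + z').
    by apply: ipowD => //; apply: ipowMl.
  rewrite (_ : a * y + z - _ = a * (y - y') + (z - z')); last by ring.
  exact: param_span_lin.
have [Q [f [fsurj fker]]] := quotient_ring J0 J1 Jlin.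
have [resQ resQE] := @factor_rmorphism R Q FF f res fsurj (fun y h => J_res y ((fker y).1 h)).
pose strQ : {rmorphism O -> Q} := f \o cln_str R.
have res_strQ a : resQ (strQ a) = red a by rewrite /strQ /= resQE cln_res_str.
have resQ_surj y : exists z, resQ z = y.
  by have [z <-] := cln_res_surj R y; exists (f z).
have fJ2 y : ideal_pow m 2 y -> f y = 0.
  move=> hy; apply/fker; exists y => //; rewrite subrr; exact: param_span0.
have nilQ y : ideal_pow [pred z | resQ z == 0] 2 y -> y = 0.
  move=> [N [a [b [hb ->]]]]; rewrite big1 // => i _.
  have [a0 a0E] := fsurj (a i).
  have [b0 b0E] := fsurj (b i ord0); have [b1 b1E] := fsurj (b i (lift ord0 ord0)).
  rewrite big_ord_recl big_ord1 -a0E -b0E -b1E -!rmorphM; apply: fJ2; apply: ipowMl.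
  have memm z j : f z = b i j -> ideal_pow m 1 z.
    by move=> zE; apply/(ipow1P m0 mlin); rewrite inE -resQE zE; apply: hb.
  by apply: (@ipowM R m 1 1); [apply: memm b0E|apply: memm b1E].
pose S := nil_cln res_strQ resQ_surj (noetherian_image fsurj (@cln_noetherian _ _ _ R)) nilQ.
have phi_str a : f (cln_str R a) = cln_str S a by [].
have phi_res y : cln_res S (f y) = res y by exact: resQE.
pose phi : cln_hom R S := @ClnHom _ _ _ R S f phi_str phi_res.
pose h : {rmorphism R -> Q} := f \o (cln_str R \o (tau \o res)).
have spanQ y : param_span y -> f y = 0.
  by move=> hy; apply/fker; exists 0; [exact: ipow0|rewrite subr0].
have psi_str a : h (cln_str R a) = cln_str S a.
  rewrite /h /= cln_res_str -[RHS]/(f (cln_str R a)); have [b ab] := digits a.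
  rewrite [in RHS]ab.
  rewrite !rmorphD !rmorphM /= (spanQ (cln_str R pi)) ?mul0r ?addr0 //.
  have := param_span_params ord0; rewrite /params unlift_none; exact.
have psi_res y : cln_res S (h y) = res y.
  by rewrite /h -[LHS]/(resQ (f _)) resQE /= cln_res_str tauK.
pose psi : cln_hom R S := @ClnHom _ _ _ R S h psi_str psi_res.
have spanu i : f (u i) = 0.
  by apply: spanQ; have := param_span_params (lift ord0 i); rewrite /params liftK.
move=> hx; apply/(fker x).
have -> : f x = h x.
  apply: (rigid (phi := phi) (psi := psi)) => i.
  by rewrite [LHS]spanu /psi /= u_max !rmorph0.
by rewrite /h /= hx !rmorph0.
Qed.

(** By Nakayama's lemma, as m is the sum of m^2 and the span of the
    parameters. *)
Theorem max_params x : res x = 0 <-> param_span x.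
Proof.
split; last by move=> [c ->]; rewrite rmorph_sum big1 // => i _; rewrite rmorphM params_max mulr0.
have [N [g hg]] := cln_noetherian max_proper.
have g_max i : res (tnth g i) = 0.
  have /eqP // : tnth g i \in m; apply/hg; exists (fun j => (j == i)%:R).
  by rewrite (bigD1 i) //= eqxx mul1r big1 ?addr0 // => j /negbTE ->; rewrite mul0r.
have gen z : res z = 0 -> exists c, z = \sum_(i < N) c i * tnth g i.
  by move=> hz; apply/hg; rewrite inE hz.
have step i : exists C : 'I_N -> R, (forall j, res (C j) = 0) /\
    param_span (tnth g i - \sum_j C j * tnth g j).
  have [y hy sy] := max_params_square (g_max i).
  have [C hC yE] := ipow2_coords gen hy; exists C; split=> //.
  by rewrite -yE.
have [C hC] := choice _ step.
move=> /gen[c ->]; elim/big_ind: _ => //; first exact: param_span0.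
  by move=> y z hy hz; rewrite -[y]mul1r; apply: param_span_lin.
move=> i _; rewrite -[_ * _]addr0; apply: param_span_lin; last exact: param_span0.
apply: (@nakayama N (tnth g) (\matrix_(i, j) C i j) param_span param_span0 param_span_lin).
  by move=> a b; rewrite mxE (hC a).1.
move=> a; have [_] := hC a.
by congr (param_span (_ - _)); apply: eq_bigr => j _; rewrite mxE.
Qed.

End MaximalIdeal.

(** * The expansion of elements in the parameters *)

Section Expansion.
Variables (O : comNzRingType) (FF : fieldType) (red : {rmorphism O -> FF}).
Variables (tau : {rmorphism FF -> O}) (pi : O).
Hypothesis digits : forall a, exists b, a = tau (red a) + pi * b.
Hypothesis tauK : cancel tau red.
Hypothesis red_pi : red pi = 0.
Hypothesis pi_regular : forall x, pi * x = 0 -> x = 0.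

Definition pi_eval : {rmorphism {poly FF} -> O} := horner_eval pi \o map_poly tau.

Lemma pi_evalC c : pi_eval c%:P = tau c.
Proof. by rewrite /pi_eval /= map_polyC /horner_eval hornerC. Qed.

Lemma pi_evalX : pi_eval 'X = pi.
Proof. by rewrite /pi_eval /= map_polyX /horner_eval hornerX. Qed.

Lemma red_pi_eval g : red (pi_eval g) = g`_0.
Proof.
rewrite /pi_eval /= /horner_eval -horner_map red_pi horner_coef0 -map_poly_comp coef_map /=.
by rewrite tauK.
Qed.

Lemma pi_expansion k a : exists g b, a = pi_eval g + pi ^+ k * b.
Proof.
elim: k a => [|k ih] a; first by exists 0, a; rewrite rmorph0 add0r mul1r.
have [b ab] := digits a; have [g [c bc]] := ih b.
exists ((red a)%:P + 'X * g), c.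
by rewrite {1}ab bc rmorphD rmorphM pi_evalC pi_evalX exprS; ring.
Qed.

(** A polynomial whose value at pi vanishes modulo pi^k is divisible by X^k:
    its coefficients vanish one by one, by reduction and division by pi. *)
Lemma pi_expansion_unique k g b : pi_eval g + pi ^+ k * b = 0 -> exists h, g = 'X^k * h.
Proof.
elim: k g => [|k ih] g h; first by exists g; rewrite expr0 mul1r.
have g0 : g`_0 = 0.
  have := congr1 red h; rewrite rmorphD red_pi_eval rmorphM rmorphXn red_pi rmorph0.
  by rewrite expr0n /= mul0r addr0.
have gE : g = 'X * drop_poly 1 g.
  by rewrite -{1}(poly_take_drop 1 g) expr1 mulrC (_ : take_poly 1 g = 0) ?add0r //;
    apply/polyP => -[|i]; rewrite coef_take_poly coef0.
have [|h' hE] := ih (drop_poly 1 g).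
  apply: pi_regular; rewrite -h [in RHS]gE rmorphM pi_evalX exprS; ring.
by exists h'; rewrite gE hE exprS mulrA.
Qed.

Variable d : nat.
Local Notation M := {mpoly FF[d.+1]}.
Local Notation X0 := ('X_(ord0 : 'I_d.+1) : M).

Definition X0_eval : {rmorphism {poly FF} -> M} := horner_eval X0 \o map_poly (@mpolyC d.+1 FF).

Lemma X0_evalC c : X0_eval c%:P = c%:MP.
Proof. by rewrite /X0_eval /= map_polyC /horner_eval hornerC. Qed.

Lemma X0_evalX : X0_eval 'X = X0.
Proof. by rewrite /X0_eval /= map_polyX /horner_eval hornerX. Qed.

Lemma X0_eval0 g : (X0_eval g)@_0%MM = g`_0.
Proof.
rewrite /X0_eval /= /horner_eval -(horner_map (mcoeff 0%MM : {rmorphism M -> FF})) /= mcoeffX.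
rewrite (_ : (_ == 0%MM) = false); last by apply/negbTE; rewrite -mdeg_eq0 mdeg1.
by rewrite horner_coef0 -map_poly_comp coef_map /= mcoeffC eqxx mulr1.
Qed.

(** The truncated polynomial ring FF[X_0,..,X_d]/(X)^k.+1, with pi acting as
    X_0, is a local algebra to which the deformation functor can be applied. *)
Definition truncation k (T : cln_alg red) (pr : {rmorphism M -> T}) :=
  [/\ forall y, exists f, pr f = y, forall f, pr f = 0 <-> lowdeg k.+1 f,
      forall a g b, a = pi_eval g + pi ^+ k.+1 * b -> cln_str T a = pr (X0_eval g)
    & forall f, cln_res T (pr f) = f@_0%MM].

Lemma truncation_exists k : exists (T : cln_alg red) (pr : {rmorphism M -> T}), truncation k pr.
Proof.
have J1 : ~ lowdeg k.+1 (1 : M).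
  by move/(_ 0%MM); rewrite mdeg0 mcoeff1 eqxx => /(_ isT)/eqP; rewrite oner_eq0.
have Jlin (a x y : M) : lowdeg k.+1 x -> lowdeg k.+1 y -> lowdeg k.+1 (a * x + y).
  by move=> hx hy; apply: lowdegD => //; apply: lowdegMl.
have [Q [f [fsurj fker]]] := quotient_ring (@lowdeg_zero FF d.+1 k.+1) J1 Jlin.
have [res resE] := @factor_rmorphism M Q FF f (mcoeff 0%MM : {rmorphism M -> FF}) fsurj
  (fun x h => (fker x).1 h 0%MM (ltac:(by rewrite mdeg0))).
pose G x y := exists g b, x = pi_eval g + pi ^+ k.+1 * b /\ y = f (X0_eval g).
have Gsv y : G 0 y -> y = 0.
  move=> [g [b [/esym h ->]]]; have [h' ->] := pi_expansion_unique h.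
  apply/fker; rewrite rmorphM rmorphXn X0_evalX; apply: lowdegMr.
  by have := @lowdeg_exp FF _ X0 1 k.+1 (@lowdeg1_var _ _ _); rewrite mul1n.
have [|||||str strG] := @graph_rmorphism O Q G.
- by move=> x; have [g [b xE]] := pi_expansion k.+1 x; exists (f (X0_eval g)), g, b.
- exact: Gsv.
- move=> _ _ _ _ [g [b [-> ->]]] [g' [b' [-> ->]]]; exists (g - g'), (b - b').
  by rewrite !rmorphB; split=> //; ring.
- by exists 1, 0; rewrite !rmorph1 mulr0 addr0.
- move=> _ _ _ _ [g [b [-> ->]]] [g' [b' [-> ->]]].
  exists (g * g'), (pi_eval g * b' + b * pi_eval g' + pi ^+ k.+1 * b * b').
  by rewrite !rmorphM; split=> //; ring.
have strE a g b : a = pi_eval g + pi ^+ k.+1 * b -> str a = f (X0_eval g).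
  move=> aE; apply/eqP; rewrite -subr_eq0; apply/eqP/Gsv.
  have [g' [b' [aE' ->]]] := strG a; exists (g' - g), (b' - b); rewrite !rmorphB; split=> //.
  by rewrite -(subrr a) {1}aE' aE; ring.
have res_str a : res (str a) = red a.
  have [g [b aE]] := pi_expansion k.+1 a; rewrite (strE _ _ _ aE) resE /= X0_eval0 aE.
  by rewrite rmorphD red_pi_eval rmorphM rmorphXn red_pi expr0n /= mul0r addr0.
have res_surj y : exists x, res x = y.
  by exists (f y%:MP); rewrite resE /= mcoeffC eqxx mulr1.
have noethQ : noetherian Q.
  pose e (i : 'I_#|{: 'X_{1..d.+1 < k.+1}}|) := f 'X_[enum_val i].
  apply: (@noetherian_finite_dim FF Q (f \o @mpolyC d.+1 FF) _ e) => y.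
  have [g <-] := fsurj y; exists (fun i : 'I_#|{: 'X_{1..d.+1 < k.+1}}| => g@_(enum_val i)).
  have -> : f g = f (ptrunc (series_of_mpoly g) k.+1).
    apply/eqP; rewrite -subr_eq0 -rmorphB; apply/eqP/fker => m hm.
    by rewrite mcoeffB -(approx_ptrunc (series_of_mpoly g) hm) subrr.
  rewrite /ptrunc rmorph_sum (reindex (@enum_val _ {: 'X_{1..d.+1 < k.+1}})) /=; last first.
    exact/onW_bij/enum_val_bij.
  by apply: eq_bigr => i _; rewrite -mul_mpolyC rmorphM.
have nil y : ideal_pow [pred x | res x == 0] k.+1 y -> y = 0.
  move=> [N [a [b [hb ->]]]]; rewrite big1 // => i _.
  have [a' a'E] := fsurj (a i); have [b' b'E] := choice _ (fun j => fsurj (b i j)).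
  rewrite -a'E; under eq_bigr => j _ do rewrite -b'E.
  rewrite -rmorph_prod -rmorphM; apply/fker; apply: lowdegMl.
  have hb' j : lowdeg 1 (b' j).
    have := hb i j; rewrite inE -b'E resE /= => /eqP b0 m; rewrite ltnS leqn0 mdeg_eq0.
    by move/eqP ->.
  have : lowdeg (\sum_(j < k.+1) 1)%N (\prod_(j < k.+1) b' j).
    elim/big_rec2: _ => [|j z1 z2 _ ih]; first exact: lowdeg0.
    by apply: lowdegM.
  by rewrite sum1_card card_ord.
exists (nil_cln res_str res_surj noethQ nil), f; split=> // x; exact: resE.
Qed.

Variables (R : cln_alg red) (u : 'I_d -> R).
Hypothesis rigid : forall (S : cln_alg red) (phi psi : cln_hom R S),
  (forall i, phi (u i) = psi (u i)) -> phi =1 psi.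
Hypothesis extend : forall (S : cln_alg red) (w : 'I_d -> S), (forall i, cln_res S (w i) = 0) ->
  exists phi : cln_hom R S, forall i, phi (u i) = w i.

(** A homomorphism from R to the power series ring FF[[X_0,..,X_d]]. *)
Definition series_morphism (Phi : R -> pseries d.+1 FF) :=
  [/\ forall x y m, Phi (x - y) m = Phi x m - Phi y m,
      forall k x y f g, approx k (Phi x) f -> approx k (Phi y) g ->
        approx k (Phi (x * y)) (f * g),
      forall i, Phi (params pi u i) = pvar FF i
    & forall c m, Phi (cln_str R (tau c)) m = c * (m == 0%MM)%:R].

(** R has a unique homomorphism to each truncated polynomial ring sending u_i to
    X_i; by uniqueness these are compatible and have a limit. *)
Theorem expansion : exists Phi, series_morphism Phi.
Proof.
have ex k : exists T : cln_alg red, exists (pr : {rmorphism M -> T}) (phi : cln_hom R T),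
    truncation k pr /\ forall i, phi (u i) = pr 'X_(lift ord0 i).
  have [T [pr hpr]] := truncation_exists k; exists T, pr.
  have [|phi hphi] := @extend T (fun i => pr 'X_(lift ord0 i)); last by exists phi.
  case: hpr => _ _ _ rE i; rewrite rE mcoeffX (_ : (_ == 0%MM) = false) //.
  by apply/negbTE; rewrite -mdeg_eq0 mdeg1.
pose pick k := constructive_indefinite_description _ (ex k).
pose T k := proj1_sig (pick k).
pose pick2 k := constructive_indefinite_description _ (proj2_sig (pick k)).
pose pr k : {rmorphism M -> T k} := proj1_sig (pick2 k).
have [phi hphi] : exists phi : forall k, cln_hom R (T k), forall k,
    truncation k (pr k) /\ forall i, phi k (u i) = pr k 'X_(lift ord0 i).
  pose pick3 k := constructive_indefinite_description _ (proj2_sig (pick2 k)).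
  by exists (fun k => proj1_sig (pick3 k)) => k; exact: (proj2_sig (pick3 k)).
have [pr_surj pr_ker pr_str pr_res] : [/\ forall k y, exists f, pr k f = y,
    forall k f, pr k f = 0 <-> lowdeg k.+1 f,
    forall k a g b, a = pi_eval g + pi ^+ k.+1 * b -> cln_str (T k) a = pr k (X0_eval g)
    & forall k f, cln_res (T k) (pr k f) = f@_0%MM].
  by split=> k; case: (hphi k) => -[].
have {}hphi k i : phi k (u i) = pr k 'X_(lift ord0 i) by case: (hphi k).
have compat k j x f : (j <= k)%N -> phi k x = pr k f -> phi j x = pr j f.
  move=> jk xf.
  have [h hE] := @factor_rmorphism M (T k) (T j) (pr k) (pr j) (pr_surj k)
    (fun f hf => (pr_ker j f).2 (lowdegW (jk : (j.+1 <= k.+1)%N) ((pr_ker k f).1 hf))).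
  have h_str a : h (cln_str (T k) a) = cln_str (T j) a.
    have [g [b aE]] := pi_expansion k.+1 a; rewrite (pr_str _ _ _ _ aE) hE.
    rewrite (pr_str j a g (pi ^+ (k - j) * b)) // {1}aE mulrA -exprD.
    by rewrite (_ : (j.+1 + (k - j))%N = k.+1) //; lia.
  have h_res y : cln_res (T j) (h y) = cln_res (T k) y.
    by have [g <-] := pr_surj k y; rewrite hE !pr_res.
  pose hh : {rmorphism R -> T j} := h \o phi k.
  have hh_str a : hh (cln_str R a) = cln_str (T j) a by rewrite /hh /= cln_hom_str h_str.
  have hh_res y : cln_res (T j) (hh y) = cln_res R y by rewrite /hh /= h_res cln_hom_res.
  have E := @rigid (T j) (phi j) (@ClnHom _ _ _ R (T j) hh hh_str hh_res).
  by rewrite E /= ?xf ?hE // => i; rewrite /= !hphi hE.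
have [lft lftP] : exists lft : nat -> R -> M, forall k x, pr k (lft k x) = phi k x.
  exact: (choice (fun k l => forall x, pr k (l x) = phi k x)
    (fun k => choice _ (fun x => pr_surj k (phi k x)))).
pose Phi x m := (lft (mdeg m) x)@_m.
have PhiE k x f : phi k x = pr k f -> approx k.+1 (Phi x) f.
  move=> xf m; rewrite ltnS => mk; apply/eqP; rewrite -subr_eq0 -mcoeffB; apply/eqP.
  have /pr_ker : pr (mdeg m) (lft (mdeg m) x - f) = 0.
    by rewrite rmorphB lftP (compat _ _ _ _ mk xf) subrr.
  exact.
have Phi_of x f m : phi (mdeg m) x = pr (mdeg m) f -> Phi x m = f@_m.
  by move/PhiE; apply.
exists Phi; split.
- move=> x y m; rewrite -!mcoeffB; apply: Phi_of.
  by rewrite !rmorphB !lftP.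
- case=> [|k] x y f g hf hg; first by [].
  have red_to (z : R) h : approx k.+1 (Phi z) h -> phi k z = pr k h.
    move=> hz; apply/eqP; rewrite -lftP -subr_eq0 -rmorphB; apply/eqP/pr_ker.
    move=> m hm; have E := PhiE k z (lft k z) (esym (lftP k z)) m hm.
    by rewrite mcoeffB -hz // -E subrr.
  by apply: (PhiE k (x * y) (f * g)); rewrite !rmorphM (red_to _ _ hf) (red_to _ _ hg).
- move=> i; apply: functional_extensionality => m; rewrite (@Phi_of _ 'X_i) ?mcoeffX ?/pvar.
    by rewrite eq_sym.
  rewrite /params; case: unliftP => [j ->|->]; first exact: hphi.
  rewrite cln_hom_str (pr_str _ _ 'X 0) ?X0_evalX // pi_evalX; ring.
move=> c m; rewrite (@Phi_of _ c%:MP) ?mcoeffC 1?eq_sym //.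
rewrite cln_hom_str (pr_str _ _ c%:P 0) ?X0_evalC // pi_evalC; ring.
Qed.

End Expansion.

(** * A chain of primes, and algebraic independence of the parameters *)

Section Support.
Variables (K : fieldType) (n : nat).

Lemma least_monomial (g : pseries n K) m0 : g m0 != 0 ->
  exists2 m, g m != 0 & forall m', (m' < m)%O -> g m' = 0.
Proof.
move=> gm0; pose D := (mdeg m0).+1; have E := approx_ptrunc g (d := D).
have f0 : ptrunc g D != 0.
  by apply: contraNneq gm0 => h; rewrite E // h mcoeff0.
have deg_last : (mdeg (mlast (ptrunc g D)) < D)%N.
  by rewrite ltnS; apply/lemc_mdeg/mlast_lemc; rewrite mcoeff_msupp -E.
exists (mlast (ptrunc g D)); first by rewrite E // -mcoeff_msupp mlast_supp.
move=> m' hm'; rewrite E ?mcoeff_lt_mlast //.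
by apply: leq_ltn_trans deg_last; apply/lemc_mdeg/ltW.
Qed.

(** Least monomials multiply, for any order compatible with multiplication. *)
Lemma mcoeffM_least (f g : {mpoly K[n]}) a b :
  (forall m, (m < a)%O -> (m <= a + b)%MM -> f@_m = 0) ->
  (forall m, (m < b)%O -> (m <= a + b)%MM -> g@_m = 0) ->
  (f * g)@_(a + b) = f@_a * g@_b.
Proof.
move=> hf hg; rewrite mcoeffM.
have ha : (mdeg a < (mdeg (a + b)%MM).+1)%N by rewrite mdegD ltnS leq_addr.
have hb : (mdeg b < (mdeg (a + b)%MM).+1)%N by rewrite mdegD ltnS leq_addl.
rewrite (bigD1 (BMultinom ha, BMultinom hb)) //= big1 ?addr0 // => -[x y] /= /andP[/eqP E ne].
have [lx ly] : (x <= a + b)%MM /\ (y <= a + b)%MM.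
  by move: (bmnm x) (bmnm y) E => x' y' ->; rewrite lem_addr lem_addl.
have [xa|ax|xa] := ltgtP (x : 'X_{1..n}) a.
- by rewrite hf ?mul0r.
- have yb : ((y : 'X_{1..n}) < b)%O.
    rewrite ltNge; apply/negP => hb'.
    have : ((a + b)%MM < (x + y)%MM)%O by apply: ltmc_le_add.
    by rewrite -E ltxx.
  by rewrite hg ?mulr0.
- case/negP: ne; rewrite xpair_eqE -!val_eqE /= xa eqxx /=.
  by move: E; rewrite xa => /eqP; rewrite eqm_add2l eq_sym.
Qed.

End Support.

Section Primes.
Variables (O : comNzRingType) (FF : fieldType) (red : {rmorphism O -> FF}).
Variables (tau : {rmorphism FF -> O}) (pi : O) (d : nat).
Variables (R : cln_alg red) (u : 'I_d -> R) (Phi : R -> pseries d.+1 FF).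
Hypothesis hPhi : series_morphism tau pi u Phi.

Lemma PhiB x y m : Phi (x - y) m = Phi x m - Phi y m.
Proof. by case: hPhi. Qed.

Lemma Phi0 m : Phi 0 m = 0.
Proof. by rewrite -(subrr 0) PhiB subrr. Qed.

Lemma PhiD x y m : Phi (x + y) m = Phi x m + Phi y m.
Proof. by rewrite -{1}(opprK y) PhiB -{1}[- y]sub0r PhiB Phi0 sub0r opprK. Qed.

Lemma Phi_sum (T : Type) (r : seq T) (F : T -> R) m :
  Phi (\sum_(i <- r) F i) m = \sum_(i <- r) Phi (F i) m.
Proof. by elim/big_rec2: _ => [|i y1 y2 _ <-]; rewrite ?Phi0 ?PhiD. Qed.

Lemma approx_PhiM k x y f g :
  approx k (Phi x) f -> approx k (Phi y) g -> approx k (Phi (x * y)) (f * g).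
Proof. by case: hPhi => _ h _ _; apply: h. Qed.

Lemma Phi_param i : Phi (params pi u i) = pvar FF i.
Proof. by case: hPhi. Qed.

Lemma Phi_const c m : Phi (cln_str R (tau c)) m = c * (m == 0%MM)%:R.
Proof. by case: hPhi. Qed.

Lemma PhiM x y m D : (mdeg m < D)%N -> Phi (x * y) m = (ptrunc (Phi x) D * ptrunc (Phi y) D)@_m.
Proof. by move=> mD; apply: approx_PhiM mD; apply: approx_ptrunc. Qed.

Lemma Phi1 m : Phi 1 m = (m == 0%MM)%:R.
Proof. by rewrite -(rmorph1 (cln_str R)) -(rmorph1 tau) Phi_const mul1r. Qed.

Definition above i (m : 'X_{1..d.+1}) := [forall j : 'I_d.+1, (j < i)%N ==> (m j == 0)%N].

Lemma aboveP i (m : 'X_{1..d.+1}) : reflect (forall j : 'I_d.+1, (j < i)%N -> m j = 0%N) (above i m).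
Proof.
apply: (iffP forallP) => [h j ji|h j]; last by apply/implyP => /h ->.
by have := h j; rewrite ji => /eqP.
Qed.

Lemma above_le i m m' : (m' <= m)%MM -> above i m -> above i m'.
Proof.
move=> /mnm_lepP le /aboveP h; apply/aboveP => j ji.
by apply/eqP; rewrite -leqn0 -(h j ji).
Qed.

Lemma aboveD i m m' : above i m -> above i m' -> above i (m + m')%MM.
Proof. by move=> /aboveP h /aboveP h'; apply/aboveP => j ji; rewrite mnmDE h ?h'. Qed.

(** The kernel of R -> FF[[X_i,..,X_d]]. *)
Definition tail_prime i : {pred R} := fun x => asb (forall m, above i m -> Phi x m = 0).

Lemma tail_primeP i x : reflect (forall m, above i m -> Phi x m = 0) (x \in tail_prime i).
Proof. exact: asbP. Qed.

Lemma tail_prime_mul i a x : x \in tail_prime i -> a * x \in tail_prime i.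
Proof.
move=> /tail_primeP h; apply/tail_primeP => m hm.
rewrite (@PhiM _ _ _ (mdeg m).+1) // mcoeffM big1 // => -[k1 k2] /= /eqP E.
rewrite -[X in _ * X](approx_ptrunc (Phi x)) ?bmdeg // h ?mulr0 //.
by apply: above_le hm; move: (bmnm k1) (bmnm k2) E => a1 a2 ->; apply: lem_addl.
Qed.

(** The ring FF[[X_i,..,X_d]] is a domain: the product of two series has a
    non-zero coefficient at the product of their least monomials. *)
Lemma tail_prime_prime i : prime_ideal (tail_prime i).
Proof.
split.
  split; first by apply/tail_primeP => m _; rewrite Phi0.
    have ab0 : above i 0%MM by apply/aboveP => j _; rewrite mnm0E.
    by apply/tail_primeP => /(_ 0%MM ab0)/eqP; rewrite Phi1 eqxx oner_eq0.
  move=> a x y hx /tail_primeP hy; apply/tail_primeP => m hm; rewrite PhiD hy // addr0.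
  by move/tail_primeP: (tail_prime_mul a hx); apply.
move=> x y xy; apply: contraT; rewrite negb_or => /andP[hx hy].
have least z : z \notin tail_prime i -> exists m, [/\ above i m, Phi z m != 0 &
    forall m', (m' < m)%O -> above i m' -> Phi z m' = 0].
  move=> hz; have [m0 m0i hm0] : exists2 m0, above i m0 & Phi z m0 != 0.
    apply: NNPP => h; case/negP: hz; apply/tail_primeP => m mi; apply/eqP/negPn/negP => zm.
    by apply: h; exists m.
  pose g : pseries d.+1 FF := fun m => if above i m then Phi z m else 0.
  have [|m gm lm] := @least_monomial FF d.+1 g m0; first by rewrite /g m0i.
  exists m; move: gm; rewrite /g; case: ifP => [mi zm|]; last by rewrite eqxx.
  by split=> // m' m'm m'i; have := lm _ m'm; rewrite /g m'i.
have [a [ai xa la]] := least x hx; have [b [bi yb lb]] := least y hy.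
have abi := aboveD ai bi; pose D := (mdeg (a + b)%MM).+1.
have deg m : (m <= a + b)%MM -> (mdeg m < D)%N.
  by move=> h; rewrite /D ltnS -(submK h) mdegD leq_addl.
have := (tail_primeP i (x * y) xy) _ abi; rewrite (@PhiM _ _ _ D) // mcoeffM_least.
- rewrite -!(approx_ptrunc (Phi _)) ?deg ?lem_addr ?lem_addl // => /eqP.
  by rewrite mulf_eq0 (negbTE xa) (negbTE yb).
- by move=> m ma mab; rewrite -(approx_ptrunc (Phi x)) ?deg // la // (above_le mab).
- by move=> m mb mab; rewrite -(approx_ptrunc (Phi y)) ?deg // lb // (above_le mab).
Qed.

Lemma tail_prime_step i : {subset tail_prime i <= tail_prime i.+1}.
Proof.
move=> x /tail_primeP h; apply/tail_primeP => m /aboveP hm; apply: h; apply/aboveP => j ji.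
by apply: hm; apply: leqW.
Qed.

Lemma param_tail_prime (i : 'I_d.+1) :
  params pi u i \in tail_prime i.+1 /\ params pi u i \notin tail_prime i.
Proof.
split.
  apply/tail_primeP => m /aboveP/(_ i (ltnSn i)) mi; rewrite Phi_param /pvar.
  by case: eqP => // mE; move: mi; rewrite mE mnm1E eqxx.
have abi : above i U_(i)%MM.
  apply/aboveP => j ji; rewrite mnm1E; apply/eqP; rewrite eqb0.
  by apply: contraTneq ji => ->; rewrite ltnn.
by apply/negP => /tail_primeP/(_ _ abi)/eqP; rewrite Phi_param /pvar eqxx oner_eq0.
Qed.

Theorem parameter_prime_chain : prime_chain R d.+1.
Proof.
exists tail_prime; split=> i hi; first exact: tail_prime_prime.
split; first exact: tail_prime_step.
have [h1 h2] := param_tail_prime (Ordinal hi).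
by move=> h; case/negP: h2; apply: h.
Qed.

Definition lift_mnm (m : 'X_{1..d}) : 'X_{1..d.+1} :=
  [multinom (if unlift ord0 i is Some j then m j else 0%N) | i < d.+1].

Lemma lift_mnmE m j : lift_mnm m (lift ord0 j) = m j.
Proof. by rewrite mnmE liftK. Qed.

Lemma lift_mnm_inj : injective lift_mnm.
Proof. by move=> m m' h; apply/mnmP => j; rewrite -!lift_mnmE h. Qed.

Lemma lift_mnm_above m : above 1 (lift_mnm m).
Proof. by apply/aboveP => j; rewrite ltnS leqn0 mnmE => /eqP j0; rewrite (_ : j = ord0) ?unlift_none //; apply: val_inj. Qed.

Lemma Phi_monomial m m' : Phi (mmap1 u m) m' = (m' == lift_mnm m)%:R.
Proof.
suff h k : approx k (Phi (mmap1 u m)) 'X_[lift_mnm m].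
  by rewrite (h (mdeg m').+1) // mcoeffX eq_sym.
rewrite mpolyXE_id big_ord_recl mnmE unlift_none expr0 mul1r /mmap1.
have one : approx k (Phi 1) 1 by move=> a _; rewrite Phi1 mcoeff1.
elim/big_rec2: _ => [|i f x _ ih]; first exact: one.
apply: approx_PhiM ih; rewrite lift_mnmE.
elim: (m i) => [|j ih]; first exact: one.
rewrite !exprS; apply: approx_PhiM ih.
have -> : u i = params pi u (lift ord0 i) by rewrite /params liftK.
by rewrite Phi_param; apply: approx_pvar.
Qed.

Hypothesis digits : forall a, exists b, a = tau (red a) + pi * b.

Lemma Phi_strM c x m : above 1 m -> Phi (cln_str R c * x) m = red c * Phi x m.
Proof.
move=> m1; have [b cE] := digits c.
rewrite {1}cE rmorphD rmorphM mulrDl PhiD -mulrA (_ : Phi (cln_str R pi * _) m = 0) ?addr0.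
  rewrite (@approx_PhiM (mdeg m).+1 _ _ (red c)%:MP (ptrunc (Phi x) (mdeg m).+1)) //.
  - by rewrite mcoeffCM -(approx_ptrunc (Phi x)).
  - by move=> a _; rewrite Phi_const mcoeffC eq_sym.
  - exact: approx_ptrunc.
have [h _] := param_tail_prime ord0; move: h; rewrite /params unlift_none => h.
by have /tail_primeP := tail_prime_mul (cln_str R b * x) h; rewrite mulrC; apply.
Qed.

Lemma Phi_mmap (P : {mpoly O[d]}) m : Phi (mmap (cln_str R) u P) (lift_mnm m) = red P@_m.
Proof.
rewrite /mmap Phi_sum; under eq_bigr => a _ do rewrite Phi_strM ?lift_mnm_above // Phi_monomial.
have [hm|hm] := boolP (m \in msupp P); last first.
  rewrite memN_msupp_eq0 // rmorph0 big_seq big1 // => a ha.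
  rewrite (inj_eq lift_mnm_inj) eq_sym (_ : (a == m) = false) ?mulr0 //.
  by apply: contraNF hm => /eqP <-.
rewrite (bigD1_seq m) ?msupp_uniq //= eqxx mulr1 big1 ?addr0 // => a am.
by rewrite (inj_eq lift_mnm_inj) eq_sym (negbTE am) mulr0.
Qed.

(** If a polynomial vanishes at the parameters, its reduction is a vanishing
    power series, so it is divisible by pi; the quotient vanishes again. *)
Theorem mmap_params_inj : (forall x, (forall j, pdiv pi j x) -> x = 0) ->
  injective (mmap (cln_str R) u).
Proof.
move=> sep P Q PQ; apply/eqP; rewrite -subr_eq0; apply/eqP.
have {PQ} : mmap (cln_str R) u (P - Q) = 0 by rewrite rmorphB /= PQ subrr.
move: (P - Q) => {Q}P hP; apply/mpolyP => m; rewrite mcoeff0; apply: sep => j.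
elim: j m => [|j ih] m; first by exists P@_m; rewrite mul1r.
have [c cE] := choice _ ih.
pose P' := \sum_(m <- msupp P) c m *: 'X_[m].
have PE : P = (pi ^+ j)%:MP * P'.
  rewrite {1}[P]mpolyE mulr_sumr; apply: eq_bigr => a _.
  by rewrite mul_mpolyC scalerA -cE.
have : mmap (cln_str R) u P' \in tail_prime 0.
  have : mmap (cln_str R) u P \in tail_prime 0.
    by rewrite hP; apply/tail_primeP => a _; rewrite Phi0.
  have E1 : mmap (cln_str R) u (pi ^+ j)%:MP = cln_str R pi ^+ j.
    by rewrite -rmorphXn; apply: mmapC.
  rewrite PE rmorphM /= E1; elim: (j) => [|i ihi]; first by rewrite mul1r.
  rewrite exprS -mulrA => h; case/orP: ((tail_prime_prime 0).2 _ _ h) => // h'.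
  by have [_] := param_tail_prime ord0; rewrite /params unlift_none h'.
move=> /tail_prime_step/tail_primeP/(_ _ (lift_mnm_above m)); rewrite Phi_mmap => red0.
have [b bE] := digits P'@_m; exists b.
by rewrite {1}PE mcoeffCM bE red0 rmorph0 add0r mulrA exprSr.
Qed.

End Primes.

(** * Krull's bound on the dimension *)

Section CoefficientField.
Variables (O : comNzRingType) (FF : fieldType) (red : {rmorphism O -> FF}).
Variables (R : cln_alg red) (kap : {rmorphism FF -> R}).
Local Notation res := (cln_res R).
Hypothesis kapK : forall c, res (kap c) = c.
Let m : {pred R} := [pred x | res x == 0].
Local Notation ipow := (ideal_pow m).

Let m0 : 0 \in m := let: And3 h _ _ := max_proper R in h.
Let mlin : forall a, {in m &, forall x y, a * x + y \in m} :=
  let: And3 _ _ h := max_proper R in h.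

Lemma ipow1_res x : ipow 1 x <-> res x = 0.
Proof. by rewrite (ipow1P m0 mlin) inE; split=> /eqP. Qed.

Lemma ipow_sep x : (forall k, ipow k x) -> x = 0.
Proof. by case: (cln_complete R) => h _; apply: h. Qed.

Lemma ipow_limit (x : nat -> R) : (forall k, ipow k (x k.+1 - x k)) ->
  exists l, forall k, ipow k (l - x k).
Proof. by case: (cln_complete R) => _ h; apply: h. Qed.

Lemma ipow_split k l (S : R -> Prop) : S 0 -> (forall x y, S x -> S y -> S (x + y)) ->
  (forall x y, ipow k x -> ipow l y -> S (x * y)) -> forall z, ipow (k + l) z -> S z.
Proof.
move=> S0 SD SM z [N [a [b [hb ->]]]]; elim/big_ind: _ => // i _.
rewrite big_split_ord mulrA; apply: SM; last exact: ipow_prod.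
by apply: ipowMl; apply: ipow_prod.
Qed.

(** Residues and products of generators of m span R over FF modulo m^b. *)
Lemma finite_span b : exists (I : finType) (e : I -> R), forall x, exists c : I -> FF,
  ipow b (x - \sum_i kap (c i) * e i).
Proof.
have [L [g hg]] := cln_noetherian (max_proper R).
elim: b => [|b [I [e he]]].
  by exists 'I_0, (fun=> 0) => x; exists (fun=> 0); apply: ipow_full.
exists (unit + 'I_L * I)%type, (fun o => if o is inr il then tnth g il.1 * e il.2 else 1) => x.
have : x - kap (res x) \in m by rewrite inE rmorphB kapK subrr.
move=> /hg[y xy]; have [c hc] := choice _ (fun l => he (y l)).
exists (fun o => if o is inr il then c il.1 il.2 else res x).
rewrite big_sumType (big_pred1 tt) /= => [|[]//]; rewrite mulr1 opprD addrA xy -(pair_big xpredT xpredT (fun l i => kap (c l i) * (tnth g l * e i))) /=.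
rewrite -sumrB; apply: ipow_sum => l _.
rewrite (_ : _ - _ = tnth g l * (y l - \sum_i kap (c l i) * e i)); last first.
  rewrite mulrBr mulr_sumr [tnth g l * y l]mulrC; congr (_ - _).
  by apply: eq_bigr => i _; rewrite mulrCA.
rewrite -add1n; apply: ipowM (hc l); apply/(ipow1P m0 mlin)/hg.
exists (fun j => (j == l)%:R).
by rewrite (bigD1 l) //= eqxx mul1r big1 ?addr0 // => j /negbTE ->; rewrite mul0r.
Qed.

Section Values.
Variables (D : nat) (v : 'I_D -> R).
Hypothesis v_max : forall i, res (v i) = 0.

Definition peval : {rmorphism {mpoly FF[D]} -> R} := mmap kap v.

Lemma pevalC c : peval c%:MP = kap c. Proof. exact: mmapC. Qed.

Lemma pevalX i : peval 'X_i = v i. Proof. by rewrite /peval /= mmapX mmap1U. Qed.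

Lemma pevalZ c F : peval (c *: F) = kap c * peval F.
Proof. by rewrite -mul_mpolyC rmorphM pevalC. Qed.

Lemma peval_monomial a : peval 'X_[a] = \prod_i v i ^+ a i.
Proof. exact: mmapX. Qed.

Lemma ipow_monomial a : ipow (mdeg a) (peval 'X_[a]).
Proof.
rewrite peval_monomial mdegE; elim/big_rec2: _ => [|i k x _ ih]; first exact: ipow_full.
apply: ipowM ih; have /ipow1_res/(ipowX (a i)) := v_max i; rewrite mul1n; exact.
Qed.

Lemma lowdeg_peval k F : lowdeg k F -> ipow k (peval F).
Proof.
move=> hF; rewrite [F]mpolyE rmorph_sum big_seq_cond; apply: ipow_sum => a.
rewrite andbT mcoeff_msupp pevalZ => ha; apply: ipowMl.
apply: ipowW (ipow_monomial a); rewrite leqNgt; apply: contra ha => ha.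
by rewrite hF.
Qed.

(** x is the value at v of the power series f. *)
Definition value (f : pseries D FF) (x : R) :=
  forall k F, approx k f F -> ipow k (x - peval F).

Definition valued x := exists f, value f x.

Lemma valuedB x y : valued x -> valued y -> valued (x - y).
Proof.
move=> [f hf] [g hg]; exists (fun a => f a - g a) => k F hF.
have E : approx k (fun a => f a - g a) (ptrunc f k - ptrunc g k).
  by move=> a ha; rewrite mcoeffB -!(approx_ptrunc _ ha).
have -> : x - y - peval F = (x - peval (ptrunc f k)) - (y - peval (ptrunc g k))
    - peval (F - (ptrunc f k - ptrunc g k)) by rewrite !rmorphB; ring.
apply: ipowB; last exact/lowdeg_peval/(approx_lowdeg hF).
by apply: ipowB; [apply: hf|apply: hg]; apply: approx_ptrunc.
Qed.

Lemma valued_const c : valued (kap c).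
Proof.
exists (fun a => c%:MP@_a) => k F hF.
by rewrite -pevalC -rmorphB; apply/lowdeg_peval/(approx_lowdeg _ hF).
Qed.

Lemma valued0 : valued 0. Proof. by rewrite -(rmorph0 kap); apply: valued_const. Qed.

Lemma valued1 : valued 1. Proof. by rewrite -(rmorph1 kap); apply: valued_const. Qed.

Lemma valuedN x : valued x -> valued (- x).
Proof. by rewrite -sub0r; apply: valuedB; apply: valued0. Qed.

Lemma valuedD x y : valued x -> valued y -> valued (x + y).
Proof. by move=> hx hy; rewrite -[y]opprK; apply/valuedB/valuedN. Qed.

Lemma valuedM x y : valued x -> valued y -> valued (x * y).
Proof.
move=> [f hf] [g hg]; exists (pmul f g) => k F hF.
have E : approx k (pmul f g) (ptrunc f k * ptrunc g k).
  move=> a ha; rewrite /pmul; set i := (mdeg a).+1.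
  have lo h : lowdeg i (ptrunc h k - ptrunc h i : {mpoly FF[D]}).
    by apply: (@approx_lowdeg _ _ _ h); [apply: approxW (approx_ptrunc _)|apply: approx_ptrunc].
  apply/eqP; rewrite eq_sym -subr_eq0 -mcoeffB.
  rewrite (_ : _ - _ = (ptrunc f k - ptrunc f i) * ptrunc g k
    + ptrunc f i * (ptrunc g k - ptrunc g i)); last by ring.
  by rewrite (lowdegD (lowdegMr _ (lo f)) (lowdegMl _ (lo g))) // /i.
have -> : x * y - peval F = (x - peval (ptrunc f k)) * y
    + peval (ptrunc f k) * (y - peval (ptrunc g k))
    - peval (F - ptrunc f k * ptrunc g k) by rewrite !rmorphB rmorphM; ring.
apply: ipowB; last exact/lowdeg_peval/(approx_lowdeg hF).
by apply: ipowD; [apply: ipowMr; apply: hf|apply: ipowMl; apply: hg]; apply: approx_ptrunc.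
Qed.

Lemma valued_limit (F : nat -> {mpoly FF[D]}) : (forall k, lowdeg k (F k.+1 - F k)) ->
  exists2 x, valued x & forall k, ipow k (x - peval (F k)).
Proof.
move=> hF; have [|x hx] := @ipow_limit (fun k => peval (F k)).
  by move=> k; rewrite -rmorphB; apply: lowdeg_peval.
exists x => //; pose f : pseries D FF := fun a => (F (mdeg a).+1)@_a; exists f => k G hG.
have tele i j : (i <= j)%N -> lowdeg i (F j - F i).
  move=> /subnKC <-; elim: (j - i)%N => [|d ih]; first by rewrite addn0 subrr; exact: lowdeg_zero.
  rewrite addnS -(subrKA (F (i + d)%N)); apply: lowdegD => //.
  by apply: lowdegW (hF _); rewrite leq_addr.
have hk : approx k f (F k).
  by move=> a ha; apply/eqP; rewrite eq_sym -subr_eq0 -mcoeffB tele.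
have -> : x - peval G = (x - peval (F k)) - peval (G - F k) by rewrite rmorphB; ring.
by apply: ipowB => //; apply: lowdeg_peval; apply: approx_lowdeg hG hk.
Qed.

(** Successive approximation: a system e that generates R modulo the v_i and
    the ideal (h) generates R modulo (h), with power series in v as
    coefficients. *)
Section Finiteness.
Variables (N L : nat) (e : 'I_N -> R) (h : 'I_L -> R).
Hypothesis step : forall y, exists (c : 'I_N -> FF) (s : 'I_D -> R) (t : 'I_L -> R),
  y = \sum_j kap (c j) * e j + \sum_i v i * s i + \sum_l t l * h l.

Theorem module_finite x : exists (c : 'I_N -> R) (t : 'I_L -> R),
  (forall j, valued (c j)) /\ x = \sum_j c j * e j + \sum_l t l * h l.
Proof.
have [c hc] := choice _ step; have [s hs] := choice _ hc; have [t ht] := choice _ hs.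
pose state := (('I_N -> {mpoly FF[D]}) * ('I_L -> R) * seq (R * 'X_{1..D}))%type.
pose next (st : state) : state :=
  (fun j => st.1.1 j + \sum_(y <- st.2) c y.1 j *: 'X_[y.2],
   fun l => st.1.2 l + \sum_(y <- st.2) t y.1 l * peval 'X_[y.2],
   [seq (s y.1 i, (U_(i) + y.2)%MM) | y <- st.2, i <- enum 'I_D]).
pose st k : state := iter k next (fun=> 0, fun=> 0, [:: (x, 0%MM)]).
have degs k : all (fun y => mdeg y.2 == k) (st k).2.
  elim: k => [|k ih] /=; first by rewrite mdeg0 eqxx.
  apply/allP => z /allpairsP[[y i] /= [hy _ ->]] /=.
  by rewrite mdegD mdeg1 add1n eqSS; apply: (allP ih).
have inv k : x = \sum_j peval ((st k).1.1 j) * e j + \sum_l (st k).1.2 l * h l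
    + \sum_(y <- (st k).2) y.1 * peval 'X_[y.2].
  elim: k => [|k ih].
    rewrite /= big1 => [|j _]; last by rewrite rmorph0 mul0r.
    rewrite big1 => [|l _]; last by rewrite mul0r.
    by rewrite big_seq1 /= mpolyX0 rmorph1 mulr1 !add0r.
  rewrite {1}ih [st k.+1]/(next (st k)) /next; move: (st k) => [[F C] r].
  rewrite ![fst _]/= ![snd _]/=.
  have -> : \sum_j peval (F j + \sum_(y <- r) c y.1 j *: 'X_[y.2]) * e j =
      \sum_j peval (F j) * e j + \sum_(y <- r) \sum_j peval (c y.1 j *: 'X_[y.2]) * e j.
    rewrite [X in _ = _ + X]exchange_big -big_split; apply: eq_bigr => j _.
    rewrite rmorphD mulrDl; congr (_ + _); rewrite -mulr_suml; congr (_ * _).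
    exact: rmorph_sum.
  have -> : \sum_l (C l + \sum_(y <- r) t y.1 l * peval 'X_[y.2]) * h l =
      \sum_l C l * h l + \sum_(y <- r) \sum_l t y.1 l * peval 'X_[y.2] * h l.
    rewrite [X in _ = _ + X]exchange_big -big_split; apply: eq_bigr => l _.
    by rewrite mulrDl -mulr_suml.
  rewrite big_allpairs_dep.
  have -> : \sum_(y <- r) y.1 * peval 'X_[y.2] =
      \sum_(y <- r) \sum_j peval (c y.1 j *: 'X_[y.2]) * e j +
      \sum_(y <- r) \sum_l t y.1 l * peval 'X_[y.2] * h l +
      \sum_(y <- r) \sum_(i <- enum 'I_D) s y.1 i * peval 'X_[U_(i) + y.2].
    rewrite -!big_split; apply: eq_bigr => y _ /=.
    rewrite {1}(ht y.1) !mulrDl !mulr_suml addrAC; congr (_ + _ + _).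
    - by apply: eq_bigr => j _; rewrite pevalZ mulrAC.
    - rewrite big_enum; apply: eq_bigr => i _.
      by rewrite mpolyXD rmorphM pevalX; ring.
    - by apply: eq_bigr => l _; rewrite mulrAC.
  by rewrite /=; ring.
have [|b hb] := choice (fun j b => valued b /\ forall k, ipow k (b - peval ((st k).1.1 j))).
  move=> j; have [|b b1 b2] := @valued_limit (fun k => (st k).1.1 j); last by exists b.
  move=> k /=; rewrite addrC addKr big_seq; apply: lowdeg_sum => y hy; apply: lowdegZ.
  by rewrite -(eqP (allP (degs k) y hy)); apply: lowdegX.
have [|g hg] := choice (fun l g => forall k, ipow k (g - (st k).1.2 l)).
  move=> l; apply: ipow_limit => k /=; rewrite addrC addKr big_seq; apply: ipow_sum => y hy.
  by apply: ipowMl; rewrite -(eqP (allP (degs k) y hy)); apply: ipow_monomial.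
exists b, g; split; first by move=> j; case: (hb j).
apply/eqP; rewrite -subr_eq0; apply/eqP/ipow_sep => k.
rewrite {1}(inv k).
set A1 := \sum_j _; set A2 := \sum_l _; set A3 := \sum_(_ <- _) _.
set B1 := \sum_j _; set B2 := \sum_l _.
have -> : A1 + A2 + A3 - (B1 + B2) = A3 - (B1 - A1) - (B2 - A2) by ring.
apply: ipowB; first apply: ipowB.
- rewrite /A3 big_seq; apply: ipow_sum => y hy; apply: ipowMl.
  by rewrite -(eqP (allP (degs k) y hy)); apply: ipow_monomial.
- by rewrite -sumrB; apply: ipow_sum => j _; rewrite -mulrBl; apply: ipowMr; case: (hb j).
- by rewrite -sumrB; apply: ipow_sum => l _; rewrite -mulrBl; apply: ipowMr.
Qed.

End Finiteness.

End Values.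

End CoefficientField.

Section CharPolyCoefficients.
Variables (R : comNzRingType) (S : R -> Prop).
Hypotheses (S0 : S 0) (S1 : S 1) (SD : forall x y, S x -> S y -> S (x + y)).
Hypotheses (SN : forall x, S x -> S (- x)) (SM : forall x y, S x -> S y -> S (x * y)).

Lemma char_poly_coef N (A : 'M[R]_N) : (forall i j, S (A i j)) -> forall i, S (char_poly A)`_i.
Proof.
move=> hA; pose PS (p : {poly R}) := forall i, S p`_i.
have PSM p r : PS p -> PS r -> PS (p * r).
  by move=> hp hr i; rewrite coefM; elim/big_ind: _ => // j _; apply: SM.
have PS1 : PS 1 by move=> i; rewrite coef1; case: (i == 0%N).
have PSN p : PS p -> PS (- p) by move=> hp i; rewrite coefN; apply: SN.
have PSD p r : PS p -> PS r -> PS (p + r) by move=> hp hr i; rewrite coefD; apply: SD.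
suff: PS (char_poly A) by [].
rewrite /char_poly /determinant; apply: (big_ind PS) => //; first by move=> i; rewrite coef0.
have PSs (b : bool) : PS ((-1) ^+ b) by case: b; rewrite ?expr0 // expr1; apply: PSN.
move=> s _; apply: (PSM); first exact: PSs.
apply: (big_ind PS PS1 PSM) => i _; rewrite !mxE; apply: PSD.
  by case: eqP => _ j; rewrite ?mulr1n ?mulr0n ?coefX ?coef0 //; case: (j == 1%N).
by apply: PSN => j; rewrite coefC; case: (j == 0%N).
Qed.

End CharPolyCoefficients.

(** The Cayley-Hamilton theorem, for a multiplication that is described by A only
    modulo an ideal. *)
Lemma char_poly_ideal (R : comNzRingType) N (A : 'M[R]_N) (e : 'I_N -> R) (y : R) (J : R -> Prop) :
  J 0 -> (forall a x z, J x -> J z -> J (a * x + z)) ->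
  (forall i, J (y * e i - \sum_j A i j * e j)) -> forall i, J ((char_poly A).[y] * e i).
Proof.
move=> J0 Jlin hA i.
have -> : (char_poly A).[y] = \det (y%:M - A).
  rewrite /char_poly -[LHS]/(horner_eval y _) -det_map_mx; congr (\det _).
  apply/matrixP => a b; rewrite !mxE rmorphB rmorphMn /= /horner_eval.
  by rewrite hornerX hornerC.
apply: (det_ideal J0 Jlin) => j; have := hA j; congr J.
rewrite (bigD1 j) //= [RHS](bigD1 j) //= !mxE eqxx mulr1n opprD addrA -mulrBl.
congr (_ + _); rewrite -sumrN.
by apply: eq_bigr => l lj; rewrite !mxE eq_sym (negbTE lj) sub0r mulNr.
Qed.

Section Weights.
Variables (K : fieldType) (D : nat) (f : pseries D K).

(** The lexicographically least exponent, the last variable counting first. *)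
Lemma lex_least b0 : f b0 != 0 -> exists2 a, f a != 0 &
  forall b, f b != 0 -> b = a \/ exists i : 'I_D, (forall j : 'I_D, (i < j)%N -> b j = a j) /\ (a i < b i)%N.
Proof.
move=> fb0.
suff h k : (k <= D)%N -> exists2 a, f a != 0 & forall b, f b != 0 ->
    (forall i : 'I_D, (D <= i + k)%N -> b i = a i) \/
    exists i : 'I_D, (forall j : 'I_D, (i < j)%N -> b j = a j) /\ (a i < b i)%N.
  have [a fa ha] := h D (leqnn D); exists a => // b /ha[ab|]; last by right.
  by left; apply/mnmP => i; apply: ab; rewrite leq_addl.
elim: k => [|k ih] kD.
  by exists b0 => // b _; left => i; rewrite addn0 leqNgt ltn_ord.
have [a fa ha] := ih (ltnW kD).
have i0P : (D - k.+1 < D)%N by lia.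
pose i0 := Ordinal i0P.
pose S r := asb (exists b, [/\ f b != 0, forall i : 'I_D, (D <= i + k)%N -> b i = a i & b i0 = r]).
have [|r /asbP[a' [fa' a'a a'r]] rmin] := @ex_minnP S.
  by exists (a i0); apply/asbP; exists a.
exists a' => // b fb.
have [agree|nagree] := excluded_middle_informative (forall i : 'I_D, (D <= i + k)%N -> b i = a i).
  have le : (a' i0 <= b i0)%N by rewrite a'r; apply: rmin; apply/asbP; exists b.
  have [lt|ge] := ltnP (a' i0) (b i0).
    right; exists i0; split=> // j; rewrite /= => ji.
    by rewrite agree ?a'a //; lia.
  left=> i hi; have [Di|Di] := leqP D (i + k); first by rewrite agree ?a'a.
  have -> : i = i0 by apply: val_inj; rewrite /=; lia.
  by apply/eqP; rewrite eqn_leq le ge.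
right; have [//|[i [ij ai]]] := ha b fb.
have Di : (D <= i + k)%N.
  rewrite leqNgt; apply/negP => hi; apply: nagree => j hj; apply: ij; lia.
exists i; split; last by rewrite a'a.
by move=> j hj; rewrite ij // a'a //; lia.
Qed.

(** Weights M^i with M larger than the exponents of the lexicographically least
    monomial make it the only one of least weight. *)
Lemma weight_monomial b0 : f b0 != 0 -> exists (w : 'I_D -> nat) (a : 'X_{1..D}),
  [/\ forall i, (0 < w i)%N, forall i : 'I_D, i = 0%N :> nat -> w i = 1%N, f a != 0 &
      forall b, f b != 0 -> b != a -> (\sum_i w i * a i < \sum_i w i * b i)%N].
Proof.
move=> /lex_least[a fa ha]; pose M := (mdeg a).+1.
exists (fun i => M ^ i)%N, a; split=> //.
- by move=> i; rewrite expn_gt0.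
- by move=> i ->.
move=> b /ha[-> /eqP //|[i [ij ai]] _].
rewrite (bigID (fun j : 'I_D => (i < j)%N)) [X in (_ < X)%N](bigID (fun j : 'I_D => (i < j)%N)) /=.
have -> : (\sum_(j < D | (i < j)%N) M ^ j * b j = \sum_(j < D | (i < j)%N) M ^ j * a j)%N.
  by apply: eq_bigr => j /ij ->.
rewrite ltn_add2l (bigD1 i) ?ltnn //= [X in (_ < X)%N](bigD1 i) ?ltnn //=.
apply: (@leq_trans (M ^ i * (a i).+1)%N); last first.
  by apply: leq_trans (leq_addr _ _); rewrite leq_mul2l ai orbT.
rewrite mulnS addnC ltn_add2r.
have [i00|ipos] := posnP i.
  rewrite big1 ?expn_gt0 // => j /andP[]; rewrite -leqNgt i00 leqn0 => /eqP j0 /eqP ne.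
  by case: ne; apply: val_inj; rewrite /= j0 i00.
rewrite -(@ltn_pmul2r M) // big_distrl /=.
apply: (@leq_ltn_trans (\sum_j M ^ i * a j)%N).
  rewrite [X in (_ <= X)%N](bigID (fun j : 'I_D => ~~ (i < j)%N && (j != i))) /=.
  apply: leq_trans (leq_addr _ _); apply: leq_sum => j /andP[ji jne].
  rewrite mulnAC -expnSr; apply: leq_mul => //; apply: leq_pexp2l => //.
  by rewrite ltn_neqAle jne leqNgt.
by rewrite -big_distrr /= -mdegE ltn_mul2l expn_gt0 /= ltnS.
Qed.

End Weights.

Section DimensionBound.
Variables (O : comNzRingType) (FF : fieldType) (red : {rmorphism O -> FF}).
Variables (R : cln_alg red) (kap : {rmorphism FF -> R}).
Local Notation res := (cln_res R).
Hypothesis kapK : forall c, res (kap c) = c.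
Let m : {pred R} := [pred x | res x == 0].
Local Notation ipow := (ideal_pow m).

(** Membership in P + (v_1, .., v_D). *)
Definition in_sum D (v : 'I_D -> R) (P : {pred R}) (z : R) :=
  exists c : 'I_D -> R, z - \sum_i c i * v i \in P.

Lemma idealD (P : {pred R}) : idealr_closed P -> forall x y, x \in P -> y \in P -> x + y \in P.
Proof. by move=> [_ _ h] x y hx hy; rewrite -[x]mul1r; apply: h. Qed.

Lemma idealM (P : {pred R}) : idealr_closed P -> forall a x, x \in P -> a * x \in P.
Proof. by move=> [h0 _ h] a x hx; rewrite -[_ * _]addr0; apply: h. Qed.

Lemma idealB (P : {pred R}) : idealr_closed P -> forall x y, x \in P -> y \in P -> x - y \in P.
Proof. by move=> [_ _ h] x y hx hy; rewrite addrC -mulN1r; apply: h. Qed.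

Lemma in_sum_lin D (v : 'I_D -> R) P : idealr_closed P ->
  forall a x y, in_sum v P x -> in_sum v P y -> in_sum v P (a * x + y).
Proof.
move=> hP a x y [c hc] [d hd]; exists (fun i => a * c i + d i).
have -> : \sum_i (a * c i + d i) * v i = a * (\sum_i c i * v i) + \sum_i d i * v i.
  by rewrite mulr_sumr -big_split; apply: eq_bigr => i _; rewrite mulrDl mulrA.
rewrite (_ : _ - _ = a * (x - \sum_i c i * v i) + (y - \sum_i d i * v i)); last by ring.
by case: hP => _ _; apply.
Qed.

Lemma in_sum_ideal D (v : 'I_D -> R) (P : {pred R}) x : x \in P -> in_sum v P x.
Proof.
by move=> hx; exists (fun=> 0); rewrite big1 ?subr0 // => i _; rewrite mul0r.
Qed.

Lemma in_sum_gen D (v : 'I_D -> R) (P : {pred R}) i : idealr_closed P -> in_sum v P (v i).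
Proof.
move=> [P0 _ _]; exists (fun j => (j == i)%:R).
by rewrite (bigD1 i) //= eqxx mul1r big1 ?addr0 ?subrr // => j /negbTE ->; rewrite mul0r.
Qed.

(** An element y of P1 outside P0 satisfies a monic equation with coefficients
    in the ring of values at v, over which R is finite modulo P0; the lowest
    coefficient outside P0 is a multiple of y modulo P0. *)
Lemma valued_in_step D (v : 'I_D -> R) N (e : 'I_N -> R) (P0 P1 : {pred R}) y :
  prime_ideal P0 -> prime_ideal P1 -> {subset P0 <= P1} -> y \in P1 -> y \notin P0 ->
  (forall i, res (v i) = 0) ->
  (forall x, exists2 c : 'I_N -> R, forall j, valued kap v (c j) & x - \sum_j c j * e j \in P0) ->
  exists a, [/\ valued kap v a, a \in P1 & a \notin P0].
Proof.
move=> [iP0 pP0] [iP1 pP1] sub y1 y0 hv fin.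
have [P00 P01 P0lin] := iP0.
have [A hA] := choice (fun i (c : 'I_N -> R) => (forall j, valued kap v (c j)) /\
  y * e i - \sum_j c j * e j \in P0)
  (fun i => let: ex_intro2 c h1 h2 := fin (y * e i) in ex_intro _ c (conj h1 h2)).
pose chi := char_poly (\matrix_(i, j) A i j).
have chiV i : valued kap v chi`_i.
  apply: char_poly_coef => [||x z|x|x z|a b].
  - exact: valued0.
  - exact: valued1.
  - exact: valuedD.
  - exact: valuedN.
  - exact: valuedM.
  - by rewrite mxE; case: (hA a).
have chiy : chi.[y] \in P0.
  have [c _ hc] := fin 1.
  have he j : chi.[y] * e j \in P0.
    apply: (@char_poly_ideal _ _ _ _ _ (fun x => x \in P0)) => //.
    move=> i; have [_] := hA i; congr (_ - _ \in P0).
    by apply: eq_bigr => l _; rewrite mxE.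
  have E : chi.[y] = chi.[y] * (1 - \sum_j c j * e j) + \sum_j c j * (chi.[y] * e j).
    rewrite mulrBr mulr1 mulr_sumr -[LHS](subrK (\sum_j chi.[y] * (c j * e j))).
    by congr (_ + _); apply: eq_bigr => j _; rewrite mulrCA.
  rewrite E; apply: P0lin => //; elim/big_ind: _ => //; first exact: idealD.
  by move=> j _; apply: idealM.
have lead : exists i, chi`_i \notin P0.
  exists (size chi).-1; rewrite -/(lead_coef chi).
  by rewrite (monicP (char_poly_monic _)).
elim/poly_ind: (chi) chiV chiy lead => [|p c ih] pV py [i pi0].
  by case/negP: pi0; rewrite coef0.
have cV : valued kap v c by have := pV 0%N; rewrite coefD coefMX coefC add0r.
have pE : (p * 'X + c%:P).[y] = p.[y] * y + c by rewrite hornerMXaddC.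
have [c0|c0] := boolP (c \in P0); last first.
  exists c; split=> //; rewrite -[c](addKr (p.[y] * y)) addrC -pE.
  by apply: idealB => //; [exact: sub|apply: idealM].
apply: ih.
- by move=> j; have := pV j.+1; rewrite coefD coefMX coefC addr0.
- have : p.[y] * y \in P0 by rewrite -[_ * _](addrK c) -pE; apply: idealB.
  by move/pP0; rewrite (negbTE y0) orbF.
- case: i pi0 => [|j]; first by rewrite coefD coefMX coefC add0r c0.
  by rewrite coefD coefMX coefC addr0; exists j.
Qed.

(** Noether normalisation: some power series f not zero satisfies f(v) = 0
    modulo P1. Modulo the elements v_i - v_0^(w_i), with suitable weights w, this
    relation says that v_0^e times a unit vanishes, so these elements replace the
    v_i. *)
Lemma dimension_drop D (v : 'I_D.+1 -> R) (P0 P1 : {pred R}) b y :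
  prime_ideal P0 -> prime_ideal P1 -> {subset P0 <= P1} -> y \in P1 -> y \notin P0 ->
  (forall i, res (v i) = 0) -> (forall z, ipow b z -> in_sum v P0 z) ->
  exists (v' : 'I_D -> R) b', (forall i, res (v' i) = 0) /\
    forall z, ipow b' z -> in_sum v' P1 z.
Proof.
move=> pr0 pr1 sub y1 y0 hv hb; have [iP0 _] := pr0; have [iP1 _] := pr1.
have [P10 _ _] := iP1.
have [L [h hP0]] := cln_noetherian iP0.
have [I [e0 he0]] := finite_span kapK b.
pose e (j : 'I_#|I|) := e0 (enum_val j).
have step x : exists (c : 'I_#|I| -> FF) (s : 'I_D.+1 -> R) (t : 'I_L -> R),
    x = \sum_j kap (c j) * e j + \sum_i v i * s i + \sum_l t l * tnth h l.
  have [c /hb[s /hP0[t xE]]] := he0 x; exists (c \o enum_val), s, t.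
  rewrite -xE (_ : \sum_j _ = \sum_i kap (c i) * e0 i); last first.
    by rewrite [RHS](reindex (@enum_val _ I)) //; apply/onW_bij/enum_val_bij.
  rewrite (eq_bigr (fun i => s i * v i)) => [|i _]; last exact: mulrC.
  by move: (\sum_i kap _ * _) (\sum_i s i * v i) => X Y; ring.
have fin x : exists2 c : 'I_#|I| -> R, forall j, valued kap v (c j) &
    x - \sum_j c j * e j \in P0.
  have [c [t [hc xE]]] := module_finite hv step x; exists c => //.
  by rewrite xE addrC addKr; apply/hP0; exists t.
have [a [[f fa] a1 a0]] := valued_in_step pr0 pr1 sub y1 y0 hv fin.
have [b0 fb0] : exists b0, f b0 != 0.
  apply: NNPP => nf; case/negP: a0; rewrite (_ : a = 0); first by case: iP0.
  apply: ipow_sep => k; have := fa k 0; rewrite rmorph0 subr0; apply=> x _.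
  by rewrite mcoeff0; apply/eqP/negPn/negP => fx; apply: nf; exists x.
have [w [al [w_gt0 w0 fal al_min]]] := weight_monomial fb0.
pose wt (x : 'X_{1..D.+1}) := (\sum_i w i * x i)%N.
pose v' (i : 'I_D) := v (lift ord0 i) - v ord0 ^+ w (lift ord0 i).
pose J := in_sum v' P1.
have Jlin := in_sum_lin (v := v') iP1.
have JP x : x \in P1 -> J x by exact: in_sum_ideal.
have J0 : J 0 by apply: JP.
have JD x z : J x -> J z -> J (x + z) by move=> hx hz; rewrite -[x]mul1r; apply: Jlin.
have JM x z : J z -> J (x * z) by move=> hz; rewrite -[_ * _]addr0; apply: Jlin.
have JN x : J x -> J (- x) by move=> hx; rewrite -mulN1r; apply: JM.
have JB x z : J x -> J z -> J (x - z) by move=> hx hz; apply/JD/JN.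
have Jv i : J (v i - v ord0 ^+ w i).
  case: (unliftP ord0 i) => [j ->|->]; first exact: in_sum_gen.
  by rewrite w0 // expr1 subrr.
have Jcong x1 x2 z1 z2 : J (x1 - z1) -> J (x2 - z2) -> J (x1 * x2 - z1 * z2).
  move=> h1 h2; rewrite (_ : _ - _ = x1 * (x2 - z2) + z2 * (x1 - z1)); last by ring.
  by apply: JD; apply: JM.
have Jmon x : J (peval kap v 'X_[x] - v ord0 ^+ wt x).
  rewrite peval_monomial /wt.
  have -> : v ord0 ^+ (\sum_i w i * x i)%N = \prod_i v ord0 ^+ (w i * x i)%N.
    by elim/big_rec2: _ => [|i k z _ <-]; rewrite ?expr0 ?exprD.
  apply: (big_ind2 (fun x z => J (x - z))); first by rewrite subrr.
    by move=> *; apply: Jcong.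
  move=> i _; rewrite exprM; elim: (x i) => [|k ih]; first by rewrite subrr.
  by rewrite !exprS; apply: Jcong.
(* modulo J, the b-th power of m consists of multiples of v_0 *)
pose near K z := exists r, J (z - v ord0 ^+ K * r).
have nearD K x z : near K x -> near K z -> near K (x + z).
  move=> [r hr] [s hs]; exists (r + s).
  by rewrite (_ : _ - _ = (x - v ord0 ^+ K * r) + (z - v ord0 ^+ K * s)); [apply: JD|ring].
have near0 K : near K 0 by exists 0; rewrite mulr0 subrr.
have nearM K x z : near K z -> near K (x * z).
  move=> [r hr]; exists (x * r).
  by rewrite (_ : _ - _ = x * (z - v ord0 ^+ K * r)); [apply: JM|ring].
have near1 z : ipow b z -> near 1 z.
  move=> /hb[c hc]; rewrite -[z](subrK (\sum_i c i * v i)); apply: (nearD).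
    by exists 0; rewrite mulr0 subr0; apply/JP/sub.
  apply: (big_ind (near 1)) => //; first exact: nearD.
  move=> i _; apply: (nearM); exists (v ord0 ^+ (w i).-1).
  by rewrite -exprD add1n prednK.
have nearP K z : ipow (b * K) z -> near K z.
  elim: K z => [|K ih] z; first by exists z; rewrite mul1r subrr.
  rewrite mulnS; apply: ipow_split => //; first exact: nearD.
  move=> x1 x2 /near1[r1 h1] /ih[r2 h2]; exists (r1 * r2).
  rewrite (_ : v ord0 ^+ K.+1 * (r1 * r2) = (v ord0 ^+ 1 * r1) * (v ord0 ^+ K * r2)).
    exact: Jcong.
  by rewrite exprS expr1; ring.
(* the relation f(v) = 0 now reads v_0^E * unit = 0 *)
pose E := wt al; pose k := (b * E.+1 + E.+1)%N.
have al_k : (mdeg al < k)%N.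
  rewrite ltn_addl // ltnS mdegE; apply: leq_sum => i _.
  by rewrite leq_pmull.
have relF : near E.+1 (peval kap v (ptrunc f k)).
  rewrite -[peval _ _ _](subKr a) addrC; apply: (nearD); last first.
    by exists 0; rewrite mulr0 subr0; apply: JP.
  rewrite -mulN1r; apply/nearM/nearP; apply: ipowW (fa k _ (approx_ptrunc f)).
  exact: leq_addr.
have restF : near E.+1 (peval kap v (ptrunc f k) - kap (f al) * v ord0 ^+ E).
  rewrite /ptrunc rmorph_sum (bigD1 (BMultinom al_k)) //= addrAC; apply: (nearD).
    exists 0; rewrite mulr0 subr0 -[mmap _ _ _]/(peval kap v _) pevalZ -mulrBr.
    exact: JM.
  apply: (big_ind (near E.+1)) => //; first exact: nearD.
  move=> x xal; rewrite -[mmap _ _ _]/(peval kap v _) pevalZ.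
  have [fx0|fx] := eqVneq (f x) 0; first by rewrite fx0 rmorph0 mul0r.
  apply: (nearM); exists (v ord0 ^+ (wt x - E.+1)); rewrite -exprD subnKC //.
  apply: al_min => //; apply: contra xal => /eqP xE; apply/eqP/val_inj; exact: xE.
have : near E.+1 (kap (f al) * v ord0 ^+ E).
  rewrite -[kap _ * _](subKr (peval kap v (ptrunc f k))); apply: (nearD) => //.
  by rewrite -mulN1r; apply: (nearM).
move=> [r hr].
have [s hs] : exists s, (kap (f al) - v ord0 * r) * s = 1.
  by apply: cln_local; rewrite rmorphB rmorphM kapK hv mul0r subr0.
have JE : J (v ord0 ^+ E).
  rewrite -[v ord0 ^+ E]mulr1 -hs (_ : _ * _ = s * (kap (f al) * v ord0 ^+ E - v ord0 ^+ E.+1 * r)).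
    exact: JM.
  by rewrite exprS; ring.
exists v', (b * E)%N; split.
  by move=> i; rewrite rmorphB rmorphXn !hv expr0n eqn0Ngt w_gt0 subrr.
move=> z /nearP[x hx]; rewrite -[z](subrK (v ord0 ^+ E * x)) [_ * x]mulrC.
by apply: JD; [rewrite mulrC|apply: JM].
Qed.

Lemma proper_max (P : {pred R}) x : idealr_closed P -> x \in P -> res x = 0.
Proof.
move=> iP xP; apply/eqP/negPn/negP => /cln_local[y xy].
by have [_ /negP[]] := iP; rewrite -xy mulrC; apply: idealM.
Qed.

(** Each step of the chain lowers the number of elements needed to generate an
    m-primary ideal; when none is left, P 0 is the maximal ideal. *)
Theorem chain_bound D (v : 'I_D -> R) b (P : nat -> {pred R}) :
  (forall i, res (v i) = 0) -> (forall z, ipow b z -> in_sum v (P 0%N) z) ->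
  (forall i, (i <= D.+1)%N -> prime_ideal (P i)) ->
  (forall i, (i < D.+1)%N -> {subset P i <= P i.+1} /\ ~ {subset P i.+1 <= P i}) -> False.
Proof.
elim: D v b P => [|D ih] v b P hv hb pr ch.
  have [_ []] := ch 0%N isT => x x1.
  have [iP0 pP0] := pr 0%N isT; have [iP1 _] := pr 1%N isT.
  have xb : x ^+ b \in P 0%N.
    have /(ipowX b) : ipow 1 x by apply/ipow1_res/(proper_max iP1).
    by rewrite mul1n => /hb[c]; rewrite big_ord0 subr0.
  elim: b xb {hb} => [|b ihb]; first by have [_ /negP] := iP0.
  by rewrite exprS => /pP0/orP[].
have [sub nsub] := ch 0%N isT.
have [y y1 y0] : exists2 y, y \in P 1%N & y \notin P 0%N.
  apply: NNPP => no; apply: nsub => y y1; apply/negPn/negP => y0.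
  by apply: no; exists y.
have [v' [b' [hv' hb']]] := dimension_drop (pr 0%N isT) (pr 1%N isT) sub y1 y0 hv hb.
apply: (ih v' b' (fun i => P i.+1)) => // i hi; [exact: pr|exact: ch].
Qed.

Theorem krull_bound D (v : 'I_D -> R) :
  (forall x, res x = 0 <-> exists c, x = \sum_i c i * v i) -> ~ prime_chain R D.+1.
Proof.
move=> hv [P [pr ch]]; apply: (@chain_bound D v 1 P) => //.
  move=> i; apply/hv; exists (fun j => (j == i)%:R).
  by rewrite (bigD1 i) //= eqxx mul1r big1 ?addr0 // => j /negbTE ->; rewrite mul0r.
move=> z /ipow1_res/hv[c ->]; exists c; rewrite subrr.
by have [[]] := pr 0%N isT.
Qed.

End DimensionBound.

(** * The universal deformation *)

Lemma generic_multiplication (A O : comNzRingType) (sA : {rmorphism A -> O}) (pi : A) p e d :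
  p \in [pchar A] -> (0 < e)%N ->
  aser (p ^ e) (genU sA pi d.+1) =
  series_of_mpoly ((sA pi)%:MP *: 'X_0 + \sum_(i < d) 'X_i *: 'X_0 ^+ ((p ^ e) ^ i.+1)
    + 'X_0 ^+ ((p ^ e) ^ d.+1) : {mpoly {mpoly O[d]}[1]}).
Proof.
move=> pA e0; have pB := pchar_mpoly d (pchar_rmorph sA pA).
have ends (V : zmodType) (f : nat -> V) k : (forall j, (d.+1 < j)%N -> f j = 0) ->
    \sum_(j < d.+2 + k) f j = f 0%N + \sum_(i < d) f i.+1 + f d.+1.
  move=> hf; rewrite big_split_ord /= [X in _ + X]big1 ?addr0.
    by rewrite big_ord_recr big_ord_recl.
  by move=> i _; apply: hf; rewrite /= leq_addr.
have gen0 : genU sA pi d.+1 0%N = (sA pi)%:MP by [].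
have genS (i : 'I_d) : genU sA pi d.+1 i.+1 = 'X_i.
  by rewrite /genU /monic_tw ltnS ltn_ord /= valK.
have genL : genU sA pi d.+1 d.+1 = 1 by rewrite /genU /monic_tw ltnn eqxx.
have gen_big j : (d.+1 < j)%N -> genU sA pi d.+1 j = 0.
  by move=> hj; rewrite /genU /monic_tw ltnNge ltnW //= (gtn_eqF hj).
apply: functional_extensionality => m.
rewrite (@approx_aser _ p e pB e0 _ (d.+2 + mdeg m)); last by lia.
rewrite /series_of_mpoly /aserpoly.
pose f j : {mpoly {mpoly O[d]}[1]} := genU sA pi d.+1 j *: 'X_0 ^+ ((p ^ e) ^ j).
have := ends _ f (mdeg m).
rewrite /f gen0 genL scale1r expn0 expr1 => -> => [|j hj]; last first.
  by rewrite gen_big // scale0r.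
by under eq_bigr => i _ do rewrite genS.
Qed.

Theorem proposition5p1p1
  (* the local field F, its residue field, a uniformizer *)
  (F : fieldType) (vF : dvaluation F) (hF : vcomplete vF)
  (Fq : finFieldType) (redF : {rmorphism ring_of_integers vF -> Fq})
  (hFq : residue_map redF)
  (pi : ring_of_integers vF) (hpi : uniformizer pi)
  (* an algebraic closure FF of the residue field *)
  (FF : closedFieldType) (jF : {rmorphism Fq -> FF})
  (hFF : forall y : FF, algebraicOver jF y)
  (* the completion L of the maximal unramified extension Fnr of F *)
  (Fnr : fieldType) (vnr : dvaluation Fnr) (jnr : {rmorphism F -> Fnr})
  (hnr : maximal_unramified vF vnr jnr)
  (L : fieldType) (vL : dvaluation L) (jL : {rmorphism Fnr -> L})
  (hL : vcompletion vnr vL jL)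
  (* the map induced on rings of integers, and the residue field of L *)
  (jO : {rmorphism ring_of_integers vF -> ring_of_integers vL})
  (hjO : forall a, int_val (jO a) = jL (jnr (int_val a)))
  (redL : {rmorphism ring_of_integers vL -> FF})
  (hredL : residue_map redL)
  (hred : forall a, redL (jO a) = jF (redF a))
  (* the formal module XX of height n and its deformation ring *)
  (n : nat) (XX : formal_module (ring_of_integers vF) FF)
  (hXX : is_formal_module (redL \o jO) XX)
  (hn : has_height XX pi #|Fq| n)
  (R0 : cln_alg redL) (hR0 : represents_deformations jO XX R0)
  (hchar : exists p : nat, p \in [pchar F]) :
  exists (u : n.-tuple R0)
         (X : formal_module (ring_of_integers vF)
                            {mpoly (ring_of_integers vL)[n.-1]})
         (iota : pseries 1 FF),
    (* the inclusion of O[u_1, .., u_(n-1)] in R0 *)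
    let ev : {mpoly (ring_of_integers vL)[n.-1]} -> R0 :=
      mmap (cln_str R0) (fun i : 'I_n.-1 => u`_i.+1) in
    [/\ u`_0 = cln_str R0 (jO pi) /\ regular_system_of_parameters u,
        injective ev,
        is_formal_module (fun a => (jO a)%:MP) X /\
        is_fm_iso XX (fm_map (cln_res R0 \o ev) X) iota,
        universal_deformation jO XX (Deformation (fm_map ev X) iota)
      & exists t : pseries 1 {mpoly (ring_of_integers vL)[n.-1]},
          coordinate t /\
          act_in_coordinate X pi t
            (series_of_mpoly
               ((jO pi)%:MP *: 'X_0
                + \sum_(i < n.-1) 'X_i *: 'X_0 ^+ (#|Fq| ^ i.+1)
                + 'X_0 ^+ (#|Fq| ^ n)))].
Proof.
have [p pF] := hchar.
have pA : p \in [pchar ring_of_integers vF].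
  apply/andP; split; first by case/andP: pF.
  apply/eqP/int_val_inj; rewrite int_val0 -(pcharf0 pF).
  exact: (rmorph_nat (val : {rmorphism ring_of_integers vF -> F})).
have pq := pchar_rmorph redF pA.
have [e hk] : exists e, #|Fq| = (p ^ e)%N by exists (logn p #|Fq|); exact: card_pprimeChar pq.
have e0 := card_exponent_gt0 hk.
(* digits of o: representatives of the residue field form a subfield *)
have sepF := @pdiv_sep _ _ _ hpi.
have [t tK] : exists t : {rmorphism Fq -> ring_of_integers vF}, forall y, redF (t y) = y.
  apply: (teichmuller pA (@pdiv_sep _ _ _ hpi) (@pdiv_complete _ _ _ hpi hF)
    (residue_surj hFq) (residue_ker hpi hFq)).
  by move=> y; exists e => //; rewrite -hk expf_card.
have digits a : exists z b, a = t z + pi * b.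
  have [b hb] : pdiv pi 1 (a - t (redF a)).
    by apply/(residue_ker hpi hFq); rewrite rmorphB tK subrr.
  by exists (redF a), b; rewrite -[LHS](subrK (t (redF a))) hb expr1 addrC.
(* pi is still a uniformizer of the completed unramified extension *)
have hpiL : uniformizer (jO pi).
  have [pi0 vpi] := hpi; have pin0 : jnr (int_val pi) != 0 by rewrite fmorph_eq0.
  split; first by rewrite hjO fmorph_eq0.
  by rewrite hjO; case: hL => -> // _ _; case: hnr => -[_ ->].
have pL := pchar_rmorph jO pA.
have pFF := pchar_rmorph jF pq.
have red_pi : redL (jO pi) = 0.
  by apply/(residue_ker hpiL hredL); exists 1; rewrite expr1 mulr1.
have [tau tauK] : exists tau : {rmorphism FF -> ring_of_integers vL}, forall y, redL (tau y) = y.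
  apply: (teichmuller pL (@pdiv_sep _ _ _ hpiL) (@pdiv_complete _ _ _ hpiL _)
    (residue_surj hredL) (residue_ker hpiL hredL)); first by case: hL.
  by move=> y; apply: algebraic_frobenius_periodic pFF (hFF y).
have digitsL a : exists b, a = tau (redL a) + jO pi * b.
  have [b hb] : pdiv (jO pi) 1 (a - tau (redL a)).
    by apply/(residue_ker hpiL hredL); rewrite rmorphB tauK subrr.
  by exists b; rewrite -[LHS](subrK (tau (redL a))) hb expr1 addrC.
have pi_regular x : jO pi * x = 0 -> x = 0.
  case/int_dom=> // pi0; have [/eqP] := hpiL; case.
  by rewrite pi0 int_val0.
have pi_unit k : (0 < k)%N -> exists y, (jO pi ^+ k - 1) * y = 1.
  move=> k0; apply: (residue_unit hredL); rewrite rmorphB rmorphXn red_pi rmorph1.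
  by rewrite expr0n eqn0Ngt k0 sub0r oppr_eq0 oner_eq0.
case: n hn => [|d] {}hn.
  have : (2 <= #|Fq| ^ 0)%N; last by rewrite expn0.
  apply: (quotient_rank_ge hn) => -[|[|//]] _; rewrite /cf.
    by rewrite mulm0n; apply: fm_act0 hXX.
  by have [_ [_ _ _ _ h]] := hXX; rewrite mulm1n h /= red_pi.
have n0 : (0 < d.+1)%N by [].
rewrite hk in hn *.
have [alpha [al0 alD alM alt al_pi]] :=
  generic_family (n := d.+1) pA hk n0 digits pi_regular pi_unit.
have [iota hiota] := special_fibre pA hk n0 digits red_pi al0 alD alM alt al_pi hXX hn.
have [w [hw univ rep]] :=
  represented_by_parameters pA hk n0 digits red_pi al0 alD alM alt al_pi hXX hiota hR0.
have rigid (S : cln_alg redL) (phi psi : cln_hom R0 S) :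
    (forall i, phi (w i) = psi (w i)) -> phi =1 psi.
  move=> h; have [|chi [_ uchi]] := rep S (fun i => psi (w i)).
    by move=> i; rewrite cln_hom_res.
  by move=> x; rewrite (uchi phi h) (uchi psi).
have extend (S : cln_alg redL) (v : 'I_d -> S) : (forall i, cln_res S (v i) = 0) ->
    exists phi : cln_hom R0 S, forall i, phi (w i) = v i.
  by move=> hv; have [phi [hphi _]] := rep S v hv; exists phi.
have gen := max_params digitsL tauK red_pi hw rigid.
have [Phi hPhi] := expansion digitsL tauK red_pi pi_regular rigid extend.
pose u := [tuple params (jO pi) w i | i < d.+1].
have uE (i : 'I_d) : u`_i.+1 = w i.
  rewrite -[i.+1]/(nat_of_ord (lift ord0 i)) -tnth_nth tnth_mktuple /params liftK //.
have u0 : u`_0 = cln_str R0 (jO pi).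
  by rewrite -[0%N]/(nat_of_ord (@ord0 d)) -tnth_nth tnth_mktuple /params unlift_none.
have evE : mmap (cln_str R0) (fun i : 'I_d => u`_i.+1) = point w :> (_ -> _).
  rewrite /point /=; congr (mmap _ _).
  by apply: functional_extensionality => i; rewrite uE.
exists u, (tw_module (p ^ e) alpha), iota; rewrite /= evE; split.
- split; first exact: u0.
  split.
    split; first exact: parameter_prime_chain hPhi.
    exact: (@krull_bound _ _ _ R0 (cln_str R0 \o tau)
      (fun c => etrans (cln_res_str R0 (tau c)) (tauK c)) _ (params (jO pi) w) gen).
  move=> x; rewrite inE; split=> [/eqP/gen[c ->]|[c ->]].
    by exists c; apply: eq_bigr => i _; rewrite tnth_mktuple.
  by apply/eqP/gen; exists c; apply: eq_bigr => i _; rewrite tnth_mktuple.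
- exact: (mmap_params_inj hPhi digitsL (@pdiv_sep _ _ _ hpiL)).
- split.
    apply: (tw_module_formal (s := strB jO d.+1) (pchar_rmorph (strB jO d.+1) pA) e0 al0 alD alM).
    by rewrite -(rmorph1 t) alt !rmorph1.
  have -> : fm_map (cln_res R0 \o point w) (tw_module (p ^ e) alpha) =
      special redL p e alpha.
    rewrite -(fibre_res p e alpha hw).
    apply: etrans (tw_module_map p e (cln_res R0 \o point w : {rmorphism _ -> FF}) alpha) _.
    by apply: esym; apply: (tw_module_map p e (cln_res R0)).
  exact: hiota.
- suff -> : Deformation (fm_map (point w) (tw_module (p ^ e) alpha)) iota =
      fibre p e alpha iota w by exact: univ.
  by rewrite /fibre; congr Deformation; apply: (tw_module_map p e (point w)).
exists (pT _); split.
  split; first exact: pT0.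
  exists (pT _); split; first exact: pT0.
    by rewrite sub1E sub1_id.
  by rewrite sub1E sub1_id.
have X0 : fm_act (tw_module (p ^ e) alpha) pi 0%MM = 0.
  exact: aser0 (pchar_rmorph (strB jO d.+1) pA) e0 _.
rewrite /act_in_coordinate !sub1E sub1_id sub1T //= al_pi.
by rewrite (generic_multiplication jO pi d pA e0).
Qed.
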